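(* Let $2\le p<+\infty$ and let $f\in H^p\setminus\{0\}$. Let $M(y)=\int_{-\infty}^{+\infty}|f(x+iy)|^p\,dx$ for $y>0$. Assume the functions $\varphi:(0,+\infty)\to(-\infty,+\infty)$, $\varphi\in\mathcal{D}^3(0,+\infty)$, and $h:(0,+\infty)\to(-\infty,+\infty)$ meet the conditions (i) $\varphi(y)=\int_0^y\varphi'(t)\,dt$ and $\varphi'(y)>0$ for all $y\in(0,+\infty)$; (ii) either $\lim_{y\to0^+}\frac{\varphi''(y)\varphi(y)}{\varphi'^2(y)}<1$ and $\varphi'^2\varphi''+\varphi\varphi'\varphi'''-2\varphi\varphi''^2\le 0$ on $(0,+\infty)$, or, as an alternative, $\lim_{y\to0^+}\frac{\varphi''(y)\varphi(y)}{\varphi'^2(y)}=1$ and $\varphi'^2\varphi''+\varphi\varphi'\varphi'''-2\varphi\varphi''^2<0$ on $(0,+\infty)$; (iii) $h(y)=\int_0^y\varphi'(t)M(t)\,dt$ for all $y\in(0,+\infty)$. Then $\frac{h}{\varphi}$ and $\log\frac{h}{\varphi}$ both belong to $\mathcal{D}^2(0,+\infty)$, and moreover $$\Bigl(\frac{h}{\varphi}\Bigr)'<0,\qquad \Bigl(\log\frac{h}{\varphi}\Bigr)''>0\qquad\text{on }(0,+\infty).$$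
   Context: For a non-empty open interval $I\subset\mathbb{R}$ and $n\ge 1$, $\mathcal{D}^n(I)$ denotes the class of all real-valued functions having a finite $n$-th derivative everywhere in $I$ (no continuity of the $n$-th derivative is required). $H^p$ is the Hardy space of the upper half-plane: the holomorphic functions $f$ on $\{z\in\mathbb{C}:\operatorname{Im}z>0\}$ with $\sup_{y>0}\int_{-\infty}^{+\infty}|f(x+iy)|^p\,dx<+\infty$. A prime denotes differentiation. *)

(* Defs.v *)
From HB Require Import structures.
From mathcomp Require Export all_boot all_order all_algebra.
From mathcomp Require Export all_classical all_reals all_analysis.
From mathcomp Require Export complex.
Set Implicit Arguments.
Unset Strict Implicit.
Unset Printing Implicit Defensive.

Export Order.TTheory GRing.Theory Num.Theory.
Export numFieldNormedType.Exports.

#[global] Open Scope ring_scope.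
#[global] Open Scope complex_scope.
#[global] Open Scope classical_set_scope.

Import Normc.

(* A function on an interval I is represented by a total function R -> R whose
   values outside I are irrelevant; since I is open, the iterated derivatives
   f^`(k) at points of I depend only on the restriction of f to I. *)
Definition classD (R : realType) (n : nat) (I : set R) (f : R -> R) : Prop :=
  forall k, (k < n)%N -> forall x, I x -> derivable f^`(k) x 1.

(* Derivability over the field R[i] regarded as a normed module over itself
   (R[i]^o) is complex differentiability. *)
Definition holomorphic_upper (R : realType) (f : R[i] -> R[i]) : Prop :=
  forall z : R[i], 0 < complex.Im z -> derivable (f : R[i]^o -> R[i]^o) z 1.

Definition hardy_mean (R : realType) (p : R) (f : R[i] -> R[i]) (y : R) :
    \bar R :=
  (\int[@lebesgue_measure R]_(x in [set: R]) (normc (f (x +i* y)) `^ p)%:E)%E.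

Definition hardy (R : realType) (p : R) (f : R[i] -> R[i]) : Prop :=
  holomorphic_upper f /\
  (ereal_sup [set hardy_mean p f y | y in `]0%R, +oo[] < +oo)%E.

(* Main.v *)
Require Import Defs.
From mathcomp Require Import measurable_realfun ring lra.
Set Implicit Arguments.
Unset Strict Implicit.
Unset Printing Implicit Defensive.
Import Normc.

(** Write M y for the integral of |f|^p over the line at height y.  The proof
rests on three facts about M: it is differentiable, M' < 0, and M' / M is
nondecreasing; the rest is a comparison of derivatives on the half-line.

Convexity of M.  In the strip c - r < Im z < c + r Cauchy's formula with the
kernel 1 / sinh ([strip_formula]) represents f by its values on the two edges.
For a point u + i c of the centre line the kernel on the edges is a constant
multiple of 1 / cosh, so |f (u + i c)| is at most the average of |f| over both
edges with this positive weight ([strip_centre]).  The two vertical sides that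
close the contour may be neglected because, by Tonelli's theorem, f has bounded
integrals over vertical segments at arbitrarily remote abscissas
([locally_hardy_vertical_bounded]).  Jensen's inequality and Tonelli's theorem give
2 M c <= M (c - r) + M (c + r) ([hmean_midpoint]).  This applies also to
exp (i t z) f z, whose mean at height y is exp (- p t y) M y; the best choice of
t yields (M c)^2 <= M (c - r) M (c + r) ([hmean_log_midpoint]).  Equality in the
first of these inequalities would make |f| almost everywhere constant on a
line, hence zero by integrability ([hmean_midpoint_eq]); so a bounded M that is
not identically zero is positive with M' < 0 ([logconvex_bounded_derive]).

Differentiability of M.  Off the centre line the same formula bounds |f| and
the Lipschitz constant of f in the vertical direction by the edge average, so
the derivative of |f|^p in y is dominated by an integrable function
([derivable_hmean]).

Real variables.  Put w = phi / phi', so that w' = 1 - q with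
q = phi phi'' / phi'^2.  The third-order condition says that q is
nonincreasing, and together with the limit at 0 it gives q < 1
([quotient_lt1]).  The logarithmic derivative of h / phi is - g, where g = N / D,
N = h - phi M and D = w h.  As M decreases, N > 0, so h / phi decreases.  The
derivative of g has the sign of rho - g, where
rho = N' / D' = m / (w' a + 1), m = - M' / M, a = h / (phi M).
Here m is nonincreasing, w' is nondecreasing, and a increases wherever
g <= rho.  If g <= rho at y0, this persists on the whole of (0, y0), and rho is
larger there than at y0; so N' > rho(y0) D' on (0, y0), and as D vanishes at 0
while N > 0, integration gives g(y0) > rho(y0), a contradiction
([decay_gap_lt0]).  Hence g' < 0, that is, log (h / phi) is strictly convex. *)

(** * Complex derivatives *)

Section ComplexDerivative.
Context {R : realType}.
Implicit Types (f g : R[i] -> R[i]) (z w l : R[i]).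

(** The real modulus replaces the complex-valued norm of [R[i]], so that all
   estimates take place in [R]. *)
Definition cderiv f z l := forall e : R, 0 < e ->
  exists2 d : R, 0 < d & forall h : R[i], normc h < d ->
    normc (f (z + h) - f z - l * h) <= e * normc h.

Lemma normc_ge0 z : 0 <= normc z.
Proof. by case: z => a b /=; exact: sqrtr_ge0. Qed.

Lemma normcB z w : normc (z - w) = normc (w - z).
Proof. by rewrite -normcN opprB. Qed.

Lemma gt0_complexE (d : R[i]) : 0 < d -> 0 < complex.Re d /\ d = (complex.Re d)%:C.
Proof. by case: d => a b; rewrite ltcE /= => /andP[/eqP -> ->]. Qed.

Lemma derivable_cderiv f z :
  derivable (f : R[i]^o -> R[i]^o) z 1 <-> exists l, cderiv f z l.
Proof.
split.
  move=> /cvg_ex[/= l /cvgrPdist_le fl]; exists l => e e0.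
  have /fl : 0 < e%:C :> R[i] by rewrite ltcR.
  move=> /nbhs_ballP[d /gt0_complexE[d0 dE] H].
  exists (complex.Re d) => // h hd.
  have [->|h0] := eqVneq h 0.
    by rewrite addr0 mulr0 subrr subr0 normc0 mulr0.
  have /= := H h.
  rewrite /ball /= sub0r normrN dE ltcR => /(_ hd h0).
  rewrite -[`|_ - _|]/((normc _)%:C) lecR scaler1 => K.
  have -> : f (z + h) - f z - l * h = - ((l - h^-1 * (f (h + z) - f z)) * h).
    rewrite mulrBl mulrAC mulVf // mul1r opprB [h + z]addrC; ring.
  by rewrite normcN normcM ler_wpM2r // normc_ge0.
move=> [l fl]; apply/cvg_ex; exists l; apply/cvgrPdist_le => e /gt0_complexE[e0 eE].
have [d d0 H] := fl _ e0.
apply/nbhs_ballP; exists d%:C => [|h /=]; first by rewrite /= ltcR.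
rewrite /ball /= sub0r normrN -[`|h|]/((normc h)%:C) ltcR => hd h0.
rewrite eE -[`|_ - _|]/((normc _)%:C) lecR scaler1.
have hp : 0 < normc h.
  rewrite lt_neqAle normc_ge0 andbT eq_sym; apply: contra_neq h0; exact: eq0_normc.
rewrite -(ler_pM2r hp) -normcM mulrBl -[_ *: _]/(_ * _) mulrAC mulVf // mul1r.
rewrite -normcN opprB [h + z]addrC; exact: H.
Qed.

Lemma cderiv_lip f z l : cderiv f z l ->
  exists2 d : R, 0 < d & forall h : R[i], normc h < d ->
    normc (f (z + h) - f z) <= (normc l + 1) * normc h.
Proof.
move=> /(_ 1 ltr01)[d d0 H]; exists d => // h /H hd.
have -> : f (z + h) - f z = (f (z + h) - f z - l * h) + l * h by ring.
apply: (le_trans (le_normcD _ _)); rewrite normcM mulrDl addrC.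
by rewrite lerD2l.
Qed.

Lemma cderivM f g z l m : cderiv f z l -> cderiv g z m ->
  exists n, cderiv (fun w => f w * g w) z n.
Proof.
move=> fl gm; apply/derivable_cderiv.
by apply: derivableM; apply/derivable_cderiv; [exists l|exists m].
Qed.

Lemma cderivV f z l : cderiv f z l -> f z != 0 ->
  exists n, cderiv (fun w => (f w)^-1) z n.
Proof.
move=> fl f0; apply/derivable_cderiv.
by apply: derivableV => //; apply/derivable_cderiv; exists l.
Qed.

End ComplexDerivative.

(** * Integrals of complex functions over segments and rectangles *)

Lemma eqcP {R : realType} (z w : R[i]) :
  complex.Re z = complex.Re w -> complex.Im z = complex.Im w -> z = w.
Proof. by case: z; case: w => a b c d /= -> ->. Qed.

Lemma normc_leD {R : realType} (z : R[i]) :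
  normc z <= `|complex.Re z| + `|complex.Im z|.
Proof.
case: z => u v /=; have h : 0 <= `|u| + `|v| by rewrite addr_ge0.
rewrite -[leRHS]ger0_norm // -sqrtr_sqr ler_wsqrtr // sqrrD !real_normK ?num_real //.
by rewrite addrAC lerDl mulrn_wge0 // mulr_ge0.
Qed.

Lemma normRe_le {R : realType} (z : R[i]) : `|complex.Re z| <= normc z.
Proof. by case: z => u v /=; rewrite -sqrtr_sqr ler_wsqrtr // lerDl sqr_ge0. Qed.

Lemma normIm_le {R : realType} (z : R[i]) : `|complex.Im z| <= normc z.
Proof. by case: z => u v /=; rewrite -sqrtr_sqr ler_wsqrtr // lerDr sqr_ge0. Qed.

Lemma measurable_normc d (T : measurableType d) (R : realType) (D : set T)
    (g : T -> R[i]) :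
  measurable_fun D (@complex.Re R \o g) -> measurable_fun D (@complex.Im R \o g) ->
  measurable_fun D (fun x => normc (g x)).
Proof.
move=> mr mi.
have -> : (fun x => normc (g x)) =
    @Num.sqrt R \o (fun x => complex.Re (g x) ^+ 2 + complex.Im (g x) ^+ 2).
  by apply/funext => x /=; case: (g x).
apply: measurableT_comp.
  by apply: continuous_measurable_fun; apply: sqrt_continuous.
apply: measurable_funD; first exact: (@measurable_funX _ _ _ _ _ 2 mr).
exact: (@measurable_funX _ _ _ _ _ 2 mi).
Qed.

Section RealIntegrable.
Context d (T : measurableType d) (R : realType) (mu : {measure set T -> \bar R}).
Context (D : set T) (mD : measurable D).
Implicit Types (f g : T -> R) (k : R).

Lemma integrable_EFinD f g : mu.-integrable D (EFin \o f) -> mu.-integrable D (EFin \o g) ->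
  mu.-integrable D (EFin \o (fun x => f x + g x)).
Proof. by move=> fi gi; exact: (@integrableD _ _ _ mu D _ _ _ fi gi). Qed.

Lemma integrable_EFinB f g : mu.-integrable D (EFin \o f) -> mu.-integrable D (EFin \o g) ->
  mu.-integrable D (EFin \o (fun x => f x - g x)).
Proof. by move=> fi gi; exact: (@integrableB _ _ _ mu D _ _ _ fi gi). Qed.

Lemma integrable_EFinZ k f : mu.-integrable D (EFin \o f) ->
  mu.-integrable D (EFin \o (fun x => k * f x)).
Proof. by move=> fi; exact: (@integrableZl _ _ _ mu D _ k _ fi). Qed.

End RealIntegrable.

Section ComplexIntegral.
Context {R : realType}.
Notation mu := (@lebesgue_measure R).
Implicit Types (g : R -> R[i]) (a b c d : R).

(** Componentwise, so that the integration theory of real functions applies. *)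
Definition cint g a b : R[i] :=
  (\int[mu]_(x in `[a, b]) complex.Re (g x)) +i* (\int[mu]_(x in `[a, b]) complex.Im (g x)).

Definition cintble g a b := mu.-integrable `[a, b] (EFin \o (@complex.Re R \o g)) /\
  mu.-integrable `[a, b] (EFin \o (@complex.Im R \o g)).

Lemma cintbleZ k g a b : cintble g a b -> cintble (fun x => k * g x) a b.
Proof.
case: k => k l [gr gi]; split.
  apply: (@eq_integrable _ _ _ mu `[a, b] _
    (fun x => k%:E * (complex.Re (g x))%:E - l%:E * (complex.Im (g x))%:E)%E) => //.
    by move=> x _ /=; case: (g x).
  by apply: integrableB => //; apply: integrableZl.
apply: (@eq_integrable _ _ _ mu `[a, b] _
  (fun x => k%:E * (complex.Im (g x))%:E + l%:E * (complex.Re (g x))%:E)%E) => //.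
  by move=> x _ /=; case: (g x).
by apply: integrableD => //; apply: integrableZl.
Qed.

Lemma cintbleD f g a b : cintble f a b -> cintble g a b ->
  cintble (fun x => f x + g x) a b.
Proof.
move=> [fr fi] [gr gi]; split.
  apply: (@eq_integrable _ _ _ mu `[a, b] _
    (fun x => (complex.Re (f x))%:E + (complex.Re (g x))%:E)%E) => //.
    by move=> x _ /=; case: (g x) => ? ?; case: (f x).
  exact: integrableD.
apply: (@eq_integrable _ _ _ mu `[a, b] _
    (fun x => (complex.Im (f x))%:E + (complex.Im (g x))%:E)%E) => //.
  by move=> x _ /=; case: (g x) => ? ?; case: (f x).
exact: integrableD.
Qed.

Lemma cintZ k g a b : cintble g a b ->
  cint (fun x => k * g x) a b = k * cint g a b.
Proof.
case: k => k l [gr gi].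
have kr := @integrableZl _ _ _ mu `[a, b] _ k _ gr.
have ki := @integrableZl _ _ _ mu `[a, b] _ k _ gi.
have lr := @integrableZl _ _ _ mu `[a, b] _ l _ gr.
have li := @integrableZl _ _ _ mu `[a, b] _ l _ gi.
apply: eqcP => /=.
  rewrite -!RintegralZl // -RintegralB //; [|exact: kr|exact: li].
  by apply: eq_Rintegral => x _; case: (g x).
rewrite -!RintegralZl // -RintegralD //; [|exact: ki|exact: lr].
by apply: eq_Rintegral => x _; case: (g x).
Qed.

Lemma cintD f g a b : cintble f a b -> cintble g a b ->
  cint (fun x => f x + g x) a b = cint f a b + cint g a b.
Proof.
move=> [fr fi] [gr gi]; apply: eqcP => /=.
  rewrite -RintegralD //.
  by apply: eq_Rintegral => x _; case: (g x) => ? ?; case: (f x).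
rewrite -RintegralD //.
by apply: eq_Rintegral => x _; case: (g x) => ? ?; case: (f x).
Qed.

Lemma eq_cint f g a b : (forall x, a <= x <= b -> f x = g x) -> cint f a b = cint g a b.
Proof.
by move=> fg; apply: eqcP => /=; apply: eq_Rintegral => x /set_mem /=; rewrite in_itv /= => xab; rewrite fg.
Qed.

Lemma eq_cintble f g a b : (forall x, a <= x <= b -> f x = g x) -> cintble f a b -> cintble g a b.
Proof.
move=> fg [fr fi]; split.
  by apply: eq_integrable fr => // x /set_mem /=; rewrite in_itv /= => xab; rewrite fg.
by apply: eq_integrable fi => // x /set_mem /=; rewrite in_itv /= => xab; rewrite fg.
Qed.

Lemma integrable_normc g a b : cintble g a b ->
  mu.-integrable `[a, b] (fun x => (normc (g x))%:E).
Proof.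
move=> [gr gi].
have mr : measurable_fun `[a, b] (@complex.Re R \o g).
  by move/integrableP : gr => [/measurable_EFinP].
have mi : measurable_fun `[a, b] (@complex.Im R \o g).
  by move/integrableP : gi => [/measurable_EFinP].
apply: (@le_integrable _ _ _ mu `[a, b] _ _
  (fun x => `|(complex.Re (g x))%:E| + `|(complex.Im (g x))%:E|)%E) => //.
- by apply/measurable_EFinP; exact: measurable_normc.
- move=> x _ /=; rewrite lee_fin ger0_norm ?normc_ge0 //.
  by rewrite [leRHS]ger0_norm ?addr_ge0 //; exact: normc_leD.
- by apply: integrableD => //; apply: integrable_abse.
Qed.

(** Pairing the integral with its own value reduces the triangle inequality to
   the Cauchy-Schwarz inequality in the plane. *)
Lemma normc_cint_le g a b : cintble g a b ->
  normc (cint g a b) <= \int[mu]_(x in `[a, b]) normc (g x).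
Proof.
move=> gi; have ng := integrable_normc gi.
case: gi => gr gi; set N := normc _.
have N0 : 0 <= N by exact: normc_ge0.
move: N0; rewrite le_eqVlt => /orP[/eqP <-|N0].
  by apply: Rintegral_ge0 => x _; exact: normc_ge0.
rewrite -(ler_pM2l N0) -RintegralZl //.
set A := \int[mu]_(x in `[a, b]) complex.Re (g x).
set B := \int[mu]_(x in `[a, b]) complex.Im (g x).
have -> : N * N = A * A + B * B.
  by rewrite -expr2 /N /= -/A -/B sqr_sqrtr ?addr_ge0 ?sqr_ge0 // !expr2.
have Ar : mu.-integrable `[a, b] (EFin \o (fun x => A * complex.Re (g x))).
  exact: (@integrableZl _ _ _ mu `[a, b] _ A _ gr).
have Bi : mu.-integrable `[a, b] (EFin \o (fun x => B * complex.Im (g x))).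
  exact: (@integrableZl _ _ _ mu `[a, b] _ B _ gi).
have -> : A * A + B * B =
    \int[mu]_(x in `[a, b]) (A * complex.Re (g x) + B * complex.Im (g x)).
  by rewrite RintegralD // !RintegralZl.
apply: le_Rintegral => //.
- exact: integrable_EFinD.
- exact: (@integrableZl _ _ _ mu `[a, b] _ N _ ng).
- move=> x _; have := normRe_le ((A -i* B) * g x); rewrite normcM.
  have -> : normc (A -i* B) = N by rewrite /= sqrrN.
  move/(le_trans (ler_norm _)); apply: le_trans.
  by case: (g x) => u v /=; rewrite mulNr opprK.
Qed.

Lemma cint_split g a c b : a <= c -> c <= b -> cintble g a b ->
  cint g a b = cint g a c + cint g c b.
Proof.
move=> ac cb [gr gi]; rewrite /cint.
have acb : `]c, b] `<=` `[a, b] by apply: subset_itv; rewrite bnd_simp.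
apply: eqcP => /=; apply/eqP; rewrite addrC -subr_eq; apply/eqP.
  rewrite Rintegral_itvB ?bnd_simp // Rintegral_itv_obnd_cbnd //.
  exact: (@integrableS _ _ _ mu _ _ _ _ _ acb gr).
rewrite Rintegral_itvB ?bnd_simp // Rintegral_itv_obnd_cbnd //.
exact: (@integrableS _ _ _ mu _ _ _ _ _ acb gi).
Qed.

Lemma cintble_cont g a b : (forall x, a <= x <= b ->
    {for x, continuous (@complex.Re R \o g)} /\ {for x, continuous (@complex.Im R \o g)}) ->
  cintble g a b.
Proof.
move=> H; split; apply: continuous_compact_integrable; try exact: segment_compact.
  by apply: continuous_in_subspaceT => x /set_mem /=; rewrite in_itv /= => /H[].
by apply: continuous_in_subspaceT => x /set_mem /=; rewrite in_itv /= => /H[].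
Qed.

Lemma lebesgue_itvcc a b : a <= b -> mu `[a, b] = (b - a)%:E.
Proof.
move=> ab; have := @lebesgue_measure_itv R `[a, b]%R; move=> /= ->.
rewrite lte_fin; case: ltP => // ba.
have -> : a = b by apply/le_anti; rewrite ab ba.
by rewrite subrr.
Qed.

Lemma Rintegral_cst_itv C a b : a <= b ->
  \int[mu]_(x in `[a, b]) C = C * (b - a).
Proof.
move=> ab; rewrite Rintegral_cst //; congr (C * _).
by rewrite -[RHS]/(fine (b - a)%:E); congr fine; exact: lebesgue_itvcc.
Qed.

Lemma integrable_cst_itv C a b : mu.-integrable `[a, b] (EFin \o (fun=> C)).
Proof.
apply: continuous_compact_integrable; first exact: segment_compact.
by apply: continuous_subspaceT => x; exact: cst_continuous.
Qed.

Lemma normc_cint_bound C g a b : a <= b -> cintble g a b ->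
  (forall x, a <= x <= b -> normc (g x) <= C) ->
  normc (cint g a b) <= C * (b - a).
Proof.
move=> ab gi gC; apply: (le_trans (normc_cint_le gi)).
rewrite -Rintegral_cst_itv //; apply: le_Rintegral => //.
- exact: integrable_normc.
- exact: integrable_cst_itv.
Qed.

Lemma cintble_cst k a b : cintble (fun=> k) a b.
Proof. by split; exact: integrable_cst_itv. Qed.

Lemma cint_cst k a b : a <= b -> cint (fun=> k) a b = k * (b - a)%:C.
Proof.
by move=> ab; apply: eqcP; rewrite /= !Rintegral_cst_itv //; case: k => u v /=; ring.
Qed.

Lemma is_derive_halfsqr (x : R) : is_derive x (1:R) (fun x : R => x ^+ 2 / 2) x.
Proof. by apply: is_derive_eq; rewrite /GRing.scale /=; field. Qed.

Lemma Rintegral_id (a b : R) : a < b -> \int[mu]_(x in `[a, b]) x = (b ^+ 2 - a ^+ 2) / 2.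
Proof.
move=> ab; rewrite /Rintegral (@continuous_FTC2 _ (fun x => x) (fun x => x ^+ 2 / 2)) //=.
- ring.
- by apply: continuous_subspaceT => x; exact: cvg_id.
- have cF (x : R) : {for x, continuous (fun x : R => x ^+ 2 / 2)}.
    apply/differentiable_continuous/derivable1_diffP.
    by case: (is_derive_halfsqr x).
  split.
  + by move=> x _; case: (is_derive_halfsqr x).
  + by apply: cvg_at_right_filter; exact: cF.
  + by apply: cvg_at_left_filter; exact: cF.
- by move=> x _; rewrite derive1E; case: (is_derive_halfsqr x).
Qed.

Lemma cintble_real a b : cintble (fun x => x%:C) a b.
Proof.
split; last exact: integrable_cst_itv.
apply: continuous_compact_integrable; first exact: segment_compact.
by apply: continuous_subspaceT => x; exact: cvg_id.
Qed.

Lemma cint_real a b : a < b -> cint (fun x => x%:C) a b = ((b ^+ 2 - a ^+ 2) / 2)%:C.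
Proof.
move=> ab; apply: eqcP => /=; first by rewrite Rintegral_id.
by rewrite Rintegral_cst_itv ?mul0r // ltW.
Qed.

End ComplexIntegral.

Section Rectangle.
Context {R : realType}.
Implicit Types (g : R[i] -> R[i]) (a b c d x y : R).

(** The sides are parametrized so that the boundary is run counterclockwise. *)
Definition rect g a b c d : R[i] :=
  cint (fun x => g (x +i* c)) a b - cint (fun x => g (x +i* d)) a b
  + 'i * cint (fun y => g (b +i* y)) c d - 'i * cint (fun y => g (a +i* y)) c d.

Definition rectble g a b c d :=
  [/\ cintble (fun x => g (x +i* c)) a b, cintble (fun x => g (x +i* d)) a b,
      cintble (fun y => g (b +i* y)) c d & cintble (fun y => g (a +i* y)) c d].

Lemma rect_splitx g a m b c d : a <= m -> m <= b -> rectble g a b c d ->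
  rect g a b c d = rect g a m c d + rect g m b c d.
Proof.
move=> am mb [h1 h2 h3 h4].
by rewrite /rect (cint_split am mb h1) (cint_split am mb h2); ring.
Qed.

Lemma rect_splity g a b c m d : c <= m -> m <= d -> rectble g a b c d ->
  rect g a b c d = rect g a b c m + rect g a b m d.
Proof.
move=> cm md [h1 h2 h3 h4].
by rewrite /rect (cint_split cm md h3) (cint_split cm md h4); ring.
Qed.

Lemma rectD f g a b c d : rectble f a b c d -> rectble g a b c d ->
  rect (fun z => f z + g z) a b c d = rect f a b c d + rect g a b c d.
Proof. by move=> [? ? ? ?] [? ? ? ?]; rewrite /rect !cintD //; ring. Qed.

Lemma rectZ k g a b c d : rectble g a b c d ->
  rect (fun z => k * g z) a b c d = k * rect g a b c d.
Proof. by move=> [? ? ? ?]; rewrite /rect !cintZ //; ring. Qed.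

Lemma rectbleD f g a b c d : rectble f a b c d -> rectble g a b c d ->
  rectble (fun z => f z + g z) a b c d.
Proof. by move=> [? ? ? ?] [? ? ? ?]; split; exact: cintbleD. Qed.

Lemma rectbleZ k g a b c d : rectble g a b c d -> rectble (fun z => k * g z) a b c d.
Proof. by move=> [? ? ? ?]; split; exact: cintbleZ. Qed.

Lemma rectble_id a b c d : rectble (fun z => z) a b c d.
Proof.
have H x : cintble (fun u : R => u +i* x) a b.
  have := cintbleD (cintble_real a b) (cintble_cst (0 +i* x) a b).
  by apply: eq_cintble => u _; apply: eqcP => /=; ring.
have V x : cintble (fun u : R => x +i* u) c d.
  have := cintbleD (cintbleZ 'i (cintble_real c d)) (cintble_cst (x%:C) c d).
  by apply: eq_cintble => u _; apply: eqcP => /=; ring.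
by split.
Qed.

Lemma rect_id a b c d : a < b -> c < d -> rect (fun z => z) a b c d = 0.
Proof.
move=> ab cd; rewrite /rect.
have H x : cint (fun u : R => u +i* x) a b =
    ((b ^+ 2 - a ^+ 2) / 2)%:C + (0 +i* x) * (b - a)%:C.
  rewrite -cint_real // -cint_cst ?(ltW ab) // -cintD; last exact: cintble_cst.
    by apply: eq_cint => u _; apply: eqcP => /=; ring.
  exact: cintble_real.
have V x : cint (fun u : R => x +i* u) c d =
    'i * ((d ^+ 2 - c ^+ 2) / 2)%:C + x%:C * (d - c)%:C.
  rewrite -cint_real // -cint_cst ?(ltW cd) // -cintZ; last exact: cintble_real.
  rewrite -cintD; last exact: cintble_cst.
    by apply: eq_cint => u _; apply: eqcP => /=; ring.
  by apply: cintbleZ; exact: cintble_real.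
by rewrite !H !V; apply: eqcP => /=; field.
Qed.

Lemma rect_cst k a b c d : a <= b -> c <= d -> rect (fun=> k) a b c d = 0.
Proof. by move=> ab cd; rewrite /rect !cint_cst //; ring. Qed.

Lemma rectble_cst k a b c d : rectble (fun=> k) a b c d.
Proof. by split; exact: cintble_cst. Qed.

Lemma normc_i : normc 'i = 1 :> R.
Proof. by rewrite /= expr0n /= add0r expr1n sqrtr1. Qed.

Lemma normc_rect_bound (C : R) g a b c d : a <= b -> c <= d -> rectble g a b c d ->
  (forall x y, a <= x <= b -> c <= y <= d ->
     (x == a) || (x == b) || (y == c) || (y == d) -> normc (g (x +i* y)) <= C) ->
  normc (rect g a b c d) <= C * (2 * ((b - a) + (d - c))).
Proof.
move=> ab cd [h1 h2 h3 h4] gC; rewrite /rect.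
have e1 : normc (cint (fun x => g (x +i* c)) a b) <= C * (b - a).
  by apply: normc_cint_bound => // x xab; apply: gC; rewrite // ?lexx ?eqxx ?orbT.
have e2 : normc (cint (fun x => g (x +i* d)) a b) <= C * (b - a).
  by apply: normc_cint_bound => // x xab; apply: gC; rewrite // ?lexx ?eqxx ?orbT ?andbT.
have e3 : normc (cint (fun y => g (b +i* y)) c d) <= C * (d - c).
  by apply: normc_cint_bound => // x xab; apply: gC; rewrite // ?lexx ?eqxx ?orbT ?andbT.
have e4 : normc (cint (fun y => g (a +i* y)) c d) <= C * (d - c).
  by apply: normc_cint_bound => // x xab; apply: gC; rewrite // ?lexx ?eqxx ?orbT ?andbT.
apply: (le_trans (le_normcD _ _)); rewrite normcN normcM normc_i mul1r.
have := le_normcD (cint (fun x => g (x +i* c)) a b - cint (fun x => g (x +i* d)) a b)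
  ('i * cint (fun y => g (b +i* y)) c d).
have := le_normcD (cint (fun x => g (x +i* c)) a b) (- cint (fun x => g (x +i* d)) a b).
rewrite normcN normcM normc_i mul1r; lra.
Qed.

End Rectangle.

(** * Goursat's theorem *)

Section Goursat.
Context {R : realType}.
Implicit Types (g : R[i] -> R[i]) (a b c d x y : R).

Lemma normcR x : normc (x%:C) = `|x|.
Proof. by rewrite /= expr0n addr0 sqrtr_sqr. Qed.

Lemma normc_iR x : normc (0 +i* x) = `|x|.
Proof. by rewrite /= expr0n add0r sqrtr_sqr. Qed.

(** Any line through a point of complex differentiability is traversed
   continuously; [w] is the direction of the line. *)
Lemma cderiv_continuous_line g (w : R[i]) (p : R -> R[i]) x l :
  (forall t : R, p (x + t) = p x + t%:C * w) -> cderiv g (p x) l ->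
  {for x, continuous (fun u => complex.Re (g (p u)))} /\
  {for x, continuous (fun u => complex.Im (g (p u)))}.
Proof.
move=> pE /cderiv_lip[d d0 H].
have w0 : 0 < normc w + 1 by rewrite ltr_wpDl // normc_ge0.
have l0 : 0 < normc l + 1 by rewrite ltr_wpDl // normc_ge0.
have K (e : R) : 0 < e -> \forall u \near x, normc (g (p u) - g (p x)) <= e.
  move=> e0; near=> u.
  have -> : u = x + (u - x) by ring.
  have hu : normc ((u - x)%:C * w) <= `|u - x| * (normc w + 1).
    by rewrite normcM normcR ler_wpM2l // lerDl.
  rewrite pE; apply: (le_trans (H _ _)).
    apply: (le_lt_trans hu); rewrite -ltr_pdivlMr //.
    near: u; apply/nbhs_ballP; exists (d / (normc w + 1)); first exact: divr_gt0.
    by move=> u; rewrite /ball /= distrC.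
  rewrite -ler_pdivlMl //; apply: (le_trans hu).
  rewrite -ler_pdivlMr //; apply: ltW.
  near: u; apply/nbhs_ballP.
  exists ((normc l + 1)^-1 * e / (normc w + 1)) => /=.
    by rewrite divr_gt0 // mulr_gt0 // invr_gt0.
  by move=> u; rewrite /ball /= distrC.
split; apply/cvgrPdist_le => e e0; near=> u; rewrite distrC.
  have -> : complex.Re (g (p u)) - complex.Re (g (p x)) = complex.Re (g (p u) - g (p x)).
    by case: (g (p u)); case: (g (p x)).
  apply: (le_trans (normRe_le _)); near: u; exact: K.
have -> : complex.Im (g (p u)) - complex.Im (g (p x)) = complex.Im (g (p u) - g (p x)).
  by case: (g (p u)); case: (g (p x)).
apply: (le_trans (normIm_le _)); near: u; exact: K.
Unshelve. all: by end_near. Qed.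

Definition cderivable g z := exists l, cderiv g z l.

Lemma cintble_horizontal g a b y :
  (forall x, a <= x <= b -> cderivable g (x +i* y)) -> cintble (fun x => g (x +i* y)) a b.
Proof.
move=> H; apply: cintble_cont => x /H[l Hl].
apply: (@cderiv_continuous_line g 1 (fun x => x +i* y) x l) => // t.
by apply: eqcP => /=; ring.
Qed.

Lemma cintble_vertical g c d x :
  (forall y, c <= y <= d -> cderivable g (x +i* y)) -> cintble (fun y => g (x +i* y)) c d.
Proof.
move=> H; apply: cintble_cont => y /H[l Hl].
apply: (@cderiv_continuous_line g 'i (fun y => x +i* y) y l) => // t.
by apply: eqcP => /=; ring.
Qed.

Lemma rectble_cderivable g a b c d : a <= b -> c <= d ->
  (forall x y, a <= x <= b -> c <= y <= d -> cderivable g (x +i* y)) ->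
  rectble g a b c d.
Proof.
move=> ab cd H; split; [apply: cintble_horizontal|apply: cintble_horizontal|
  apply: cintble_vertical|apply: cintble_vertical] => x xI; apply: H;
  rewrite // ?lexx ?ab ?cd //.
Qed.

(** The contour integral over a rectangle is the sum of those over its four
   quarters, so one of them carries at least a fourth of it. *)
Lemma rect_quarter g a c (l h : R) : 0 <= l -> 0 <= h ->
  (forall x y, a <= x <= a + 2 * l -> c <= y <= c + 2 * h -> cderivable g (x +i* y)) ->
  exists q : R * R, [/\ a <= q.1 <= a + l, c <= q.2 <= c + h &
    normc (rect g a (a + 2 * l) c (c + 2 * h)) <=
    4 * normc (rect g q.1 (q.1 + l) q.2 (q.2 + h))].
Proof.
move=> l0 h0 H.
set A := rect g a (a + l) c (c + h).
set B := rect g (a + l) (a + l + l) c (c + h).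
set C := rect g a (a + l) (c + h) (c + h + h).
set D := rect g (a + l) (a + l + l) (c + h) (c + h + h).
have E : rect g a (a + 2 * l) c (c + 2 * h) = A + B + (C + D).
  have l2 : a + 2 * l = a + l + l by ring.
  have h2 : c + 2 * h = c + h + h by ring.
  rewrite l2 h2 (@rect_splity _ g a _ c (c + h)) ?(lerDl, h0) //; last first.
    by apply: rectble_cderivable => [| |x y xI yI]; [lra|lra|apply: H; lra].
  rewrite (@rect_splitx _ g a (a + l)) ?(lerDl, l0) //; last first.
    by apply: rectble_cderivable => [| |x y xI yI]; [lra|lra|apply: H; lra].
  rewrite (@rect_splitx _ g a (a + l) _ (c + h)) ?(lerDl, l0) //.
  by apply: rectble_cderivable => [| |x y xI yI]; [lra|lra|apply: H; lra].
rewrite E; have le_sum : normc (A + B + (C + D)) <= normc A + normc B + (normc C + normc D).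
  by apply: le_trans (le_normcD _ _) _; apply: lerD; exact: le_normcD.
(* One of the four terms is at least a fourth of the bound of their sum. *)
have pigeon (x p q r s : R) : x <= p + q + (r + s) ->
    [|| x <= 4 * p, x <= 4 * q, x <= 4 * r | x <= 4 * s].
  clear; move=> xle; have [?|xp] := leP x (4 * p) => //=.
  have [?|xq] := leP x (4 * q) => //=; have [?|xr] := leP x (4 * r) => //=; lra.
have hl : a <= a <= a + l by rewrite lexx lerDl.
have hh : c <= c <= c + h by rewrite lexx lerDl.
have hl' : a <= a + l <= a + l by rewrite lexx lerDl l0.
have hh' : c <= c + h <= c + h by rewrite lexx lerDl h0.
case/or4P: (pigeon _ _ _ _ _ le_sum) => quarter.
- by exists (a, c); split.
- by exists (a + l, c); split.
- by exists (a, c + h); split.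
- by exists (a + l, c + h); split.
Qed.

(** A point with a complex derivative has small contour integrals around it:
   affine functions integrate to zero. *)
Lemma rect_small g (z l : R[i]) (e r : R) a b c d :
  a < b -> c < d -> rectble g a b c d ->
  a <= complex.Re z <= b -> c <= complex.Im z <= d ->
  b - a + (d - c) < r -> 0 <= e ->
  (forall h, normc h < r -> normc (g (z + h) - g z - l * h) <= e * normc h) ->
  normc (rect g a b c d) <= e * (2 * (b - a + (d - c)) ^+ 2).
Proof.
move=> ab cd gi za zc br e0 H.
set A := fun w => (g z - l * z) + l * w.
have Ai : rectble A a b c d.
  by apply: rectbleD; [exact: rectble_cst|apply: rectbleZ; exact: rectble_id].
have A0 : rect A a b c d = 0.
  rewrite rectD; [|exact: rectble_cst|apply: rectbleZ; exact: rectble_id].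
  rewrite rect_cst ?ltW // rectZ ?rect_id ?mulr0 ?addr0 //; exact: rectble_id.
have -> : rect g a b c d = rect (fun w => g w + (-1) * A w) a b c d.
  by rewrite rectD ?rectZ ?A0 ?mulr0 ?addr0 //; exact: rectbleZ.
have -> : e * (2 * (b - a + (d - c)) ^+ 2) =
  (e * (b - a + (d - c))) * (2 * (b - a + (d - c))) by ring.
apply: normc_rect_bound; [exact: ltW|exact: ltW| |].
  by apply: rectbleD => //; exact: rectbleZ.
move=> x y xI yI _.
set h := (x +i* y) - z.
have hs : normc h <= b - a + (d - c).
  apply: (le_trans (normc_leD _)); rewrite /h; case: (z) za zc => u v /= uI vI.
  by apply: lerD; rewrite ler_norml; apply/andP; split; lra.
have -> : g (x +i* y) + -1 * A (x +i* y) = g (z + h) - g z - l * h.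
  by rewrite /A /h [z + _]addrC subrK; ring.
apply: (le_trans (H _ _)); first exact: le_lt_trans hs br.
by rewrite ler_wpM2l.
Qed.

(** In repeated quartering the contour integral loses at most a factor 4 at each
   step.  Around the common point of the nested rectangles [rect_small] gains the
   same factor 4, with an arbitrarily small constant in front. *)
Theorem goursat g a b c d : a < b -> c < d ->
  (forall x y, a <= x <= b -> c <= y <= d -> cderivable g (x +i* y)) ->
  rect g a b c d = 0.
Proof.
move=> ab cd H.
pose L := b - a; pose h := d - c; pose e n : R := 2^-1 ^+ n.
have e0 n : 0 < e n by rewrite exprn_gt0 // invr_gt0.
have eS n : e n = 2 * e n.+1 by rewrite /e exprS mulrA mulfV // mul1r.
have L0 : 0 < L by rewrite subr_gt0.
have h0 : 0 < h by rewrite subr_gt0.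
pose inside n (q : R * R) := [/\ a <= q.1, q.1 + L * e n <= b, c <= q.2 & q.2 + h * e n <= d].
pose N n (q : R * R) := normc (rect g q.1 (q.1 + L * e n) q.2 (q.2 + h * e n)).
have /choice[F HF] (nq : nat * (R * R)) : exists q' : R * R, inside nq.1 nq.2 ->
    [/\ inside nq.1.+1 q',
        nq.2.1 <= q'.1, q'.1 + L * e nq.1.+1 <= nq.2.1 + L * e nq.1,
        nq.2.2 <= q'.2 /\ q'.2 + h * e nq.1.+1 <= nq.2.2 + h * e nq.1
      & N nq.1 nq.2 <= 4 * N nq.1.+1 q'].
  case: nq => n q /=.
  have [qI|] := pselect (inside n q); last by exists q.
  case: qI => q1 q2 q3 q4.
  have l0 : 0 <= L * e n.+1 by rewrite mulr_ge0 // ltW.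
  have k0 : 0 <= h * e n.+1 by rewrite mulr_ge0 // ltW.
  have EL : L * e n = 2 * (L * e n.+1) by rewrite eS mulrCA.
  have Eh : h * e n = 2 * (h * e n.+1) by rewrite eS mulrCA.
  have [x y xI yI|q' [i1 i2 i3]] := @rect_quarter g q.1 q.2 _ _ l0 k0.
    by apply: H; lra.
  exists q' => _; rewrite /inside /N EL Eh; split => //; try split; lra.
pose s := fix s n : R * R := if n is m.+1 then F (m, s m) else (a, c).
have sI n : inside n (s n).
  elim: n => [|n IH] /=; last by case: (HF (n, s n) IH).
  by rewrite /inside /e /= expr0 !mulr1 /L /h; split; lra.
have sN n : normc (rect g a b c d) <= 4 ^+ n * N n (s n).
  elim: n => [|n IH].
    by rewrite expr0 mul1r /N /e /= expr0 !mulr1 /L /h [a + _]addrC [c + _]addrC !subrK.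
  apply: (le_trans IH); rewrite exprS -mulrA mulrCA ler_wpM2l ?exprn_ge0 //.
  by case: (HF (n, s n) (sI n)).
have s1 n m : (s n).1 <= (s (n + m)%N).1 /\ (s (n + m)%N).1 + L * e (n + m)%N <= (s n).1 + L * e n.
  elim: m => [|m IH]; first by rewrite addn0.
  by rewrite addnS /=; case: (HF (_, s (n + m)%N) (sI _)) => /= _ ? ? _ _; lra.
have s2 n m : (s n).2 <= (s (n + m)%N).2 /\ (s (n + m)%N).2 + h * e (n + m)%N <= (s n).2 + h * e n.
  elim: m => [|m IH]; first by rewrite addn0.
  by rewrite addnS /=; case: (HF (_, s (n + m)%N) (sI _)) => /= _ _ _ [? ?] _; lra.
have lim (u : nat -> R) (l : R) : 0 < l ->
    (forall n m, u n <= u (n + m)%N /\ u (n + m)%N + l * e (n + m)%N <= u n + l * e n) ->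
    exists x, forall n, u n <= x <= u n + l * e n.
  move=> l0 uu.
  have ub n : ubound (range u) (u n + l * e n).
    move=> _ [m _ <-].
    have [nm|mn] := leqP n m.
      have := uu n (m - n)%N; rewrite subnKC //.
      by have := mulr_gt0 l0 (e0 m); lra.
    have := uu m (n - m)%N; rewrite subnKC ?(ltnW mn) //.
    by have := mulr_gt0 l0 (e0 n); lra.
  have hs : has_sup (range u).
    by split; [exists (u 0%N), 0%N|exists (u 0%N + l * e 0%N); exact: ub].
  exists (sup (range u)) => n; apply/andP; split.
    by apply: ub_le_sup; [case: hs|exists n].
  by apply: ge_sup; [case: hs|exact: ub].
have [x xI] := lim (fun n => (s n).1) L L0 s1.
have [y yI] := lim (fun n => (s n).2) h h0 s2.
have [l Hl] : cderivable g (x +i* y).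
  apply: H; have := xI 0%N; have := yI 0%N; rewrite /e /= expr0 !mulr1 /L /h; lra.
apply: eq0_normc; apply: le_anti; rewrite normc_ge0 andbT.
apply/ler_addgt0Pr => eps eps0; rewrite add0r.
pose E := eps / (2 * (L + h) ^+ 2).
have Lh : 0 < 2 * (L + h) ^+ 2 by rewrite mulr_gt0 // exprn_gt0 // addr_gt0.
have E0 : 0 < E by rewrite divr_gt0.
have [r r0 Hr] := Hl _ E0.
have [n nr] : exists n, (L + h) * e n < r.
  have /cvgr_lt/(_ r) : (L + h) * e n @[n --> \oo] --> (0 : R).
    rewrite -(mulr0 (L + h)); apply: cvgM; first exact: cvg_cst.
    by apply: cvg_expr; rewrite ger0_norm ?invr_ge0 // invf_lt1 // ltr1n.
  by move=> /(_ r0)[n _ Hn]; exists n; apply: Hn => /=.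
apply: (le_trans (sN n)).
have Len : 0 < L * e n by rewrite mulr_gt0.
have hen : 0 < h * e n by rewrite mulr_gt0.
have := @rect_small g (x +i* y) l E r (s n).1 ((s n).1 + L * e n) (s n).2 ((s n).2 + h * e n).
rewrite !ltrDl Len hen => /(_ isT isT).
have [i1 i2 i3 i4] := sI n.
have gi : rectble g (s n).1 ((s n).1 + L * e n) (s n).2 ((s n).2 + h * e n).
  by apply: rectble_cderivable => [| |u v uI vI]; [lra|lra|apply: H; lra].
move=> /(_ gi (xI n) (yI n)).
have -> : (s n).1 + L * e n - (s n).1 + ((s n).2 + h * e n - (s n).2) = (L + h) * e n by ring.
move=> /(_ nr (ltW E0) Hr) K.
have -> : eps = 4 ^+ n * (E * (2 * ((L + h) * e n) ^+ 2)).
  have -> : 4 ^+ n * (E * (2 * ((L + h) * e n) ^+ 2)) = (E * (2 * (L + h) ^+ 2)) * (4 ^+ n * e n ^+ 2) by ring.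
  rewrite /E divfK ?gt_eqF // /e -exprM mulnC exprM -exprMn.
  have -> : 4 * (2^-1 ^+ 2) = 1 :> R by field.
  by rewrite expr1n mulr1.
by rewrite ler_wpM2l // exprn_ge0.
Qed.

End Goursat.

(** * The complex exponential and the hyperbolic sine *)

Section Kernel.
Context {R : realType}.
Implicit Types (f g : R[i] -> R[i]) (a b c d x y k : R).

Lemma is_derive_expansion (f : R -> R) x l : is_derive x 1 f l <->
  forall e : R, 0 < e -> exists2 d : R, 0 < d & forall h : R, `|h| < d ->
    `|f (x + h) - f x - l * h| <= e * `|h|.
Proof.
split.
  move=> [/cvg_ex[/= l' fl'] <-] e e0.
  have -> : 'D_1 f x = l' by exact: cvg_lim fl'.
  move: fl' => /cvgrPdist_le /(_ e e0) /nbhs_ballP[d d0 H].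
  exists d => // h hd; have [->|h0] := eqVneq h 0.
    by rewrite addr0 mulr0 subrr subr0 normr0 mulr0.
  have := H h; rewrite /ball /= sub0r normrN => /(_ hd h0).
  rewrite /GRing.scale /= mulr1 => K.
  have -> : f (x + h) - f x - l' * h = - ((l' - h^-1 * (f (h + x) - f x)) * h).
    by rewrite [x + h]addrC; field.
  by rewrite normrN normrM ler_wpM2r.
move=> H; have L : h^-1 *: (f (h *: 1 + x) - f x) @[h --> 0^'] --> l.
  apply/cvgrPdist_le => e e0; have [d d0 Hd] := H e e0.
  apply/nbhs_ballP; exists d => // h /=; rewrite /ball /= sub0r normrN => hd h0.
  rewrite -(ler_pM2r (_ : 0 < `|h|)) ?normr_gt0 // -normrM.
  rewrite /GRing.scale /= mulr1.
  have -> : (l - h^-1 * (f (h + x) - f x)) * h = - (f (x + h) - f x - l * h).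
    by rewrite [x + h]addrC; field.
  by rewrite normrN; exact: Hd.
split; first by apply/cvg_ex; exists l.
exact: cvg_lim L.
Qed.

Definition cexp (z : R[i]) : R[i] :=
  (expR (complex.Re z) * cos (complex.Im z)) +i* (expR (complex.Re z) * sin (complex.Im z)).

Lemma cexpD z w : cexp (z + w) = cexp z * cexp w.
Proof.
case: z => a b; case: w => c d; rewrite /cexp /=.
by apply: eqcP => /=; rewrite expRD ?cosD ?sinD; ring.
Qed.

Lemma normc_cexp z : normc (cexp z) = expR (complex.Re z).
Proof.
case: z => a b; rewrite /cexp /= !exprMn -mulrDr cos2Dsin2 mulr1 sqrtr_sqr.
by rewrite ger0_norm ?expR_ge0.
Qed.

Lemma cexp0 : cexp 0 = 1.
Proof. by rewrite /cexp /= expR0 cos0 sin0; apply: eqcP => /=; ring. Qed.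

Lemma cderiv_cexp0 : cderiv cexp 0 1.
Proof.
move=> e e0.
have e8 : 0 < Num.min 1 (e / 8) by rewrite lt_min ltr01 divr_gt0.
set E := Num.min 1 (e / 8) in e8 *.
have E1 : E <= 1 by rewrite ge_min lexx.
have E8 : E <= e / 8 by rewrite ge_min lexx orbT.
have [d1 d10 H1] : exists2 d : R, 0 < d & forall h : R, `|h| < d ->
    `|expR h - 1 - h| <= E * `|h|.
  have /is_derive_expansion/(_ E e8) : is_derive (0 : R) (1 : R) expR 1.
    by apply: is_derive_eq; rewrite expR0.
  by case=> d d0 H; exists d => // h /H; rewrite add0r expR0 mul1r.
have [d2 d20 H2] : exists2 d : R, 0 < d & forall h : R, `|h| < d ->
    `|sin h - h| <= E * `|h|.
  have /is_derive_expansion/(_ E e8) : is_derive (0 : R) (1 : R) sin 1.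
    by apply: is_derive_eq; rewrite cos0.
  by case=> d d0 H; exists d => // h /H; rewrite add0r sin0 mul1r subr0.
have [d3 d30 H3] : exists2 d : R, 0 < d & forall h : R, `|h| < d ->
    `|cos h - 1| <= E * `|h|.
  have /is_derive_expansion/(_ E e8) : is_derive (0 : R) (1 : R) cos 0.
    by apply: is_derive_eq; rewrite sin0 oppr0.
  by case=> d d0 H; exists d => // h /H; rewrite add0r cos0 mul0r subr0.
exists (Num.min (Num.min d1 d2) (Num.min d3 (E / 2))).
  by rewrite !lt_min d10 d20 d30 divr_gt0.
move=> h; rewrite !lt_min => /andP[/andP[h1 h2] /andP[h3 h4]].
have hx : `|complex.Re h| <= normc h by exact: normRe_le.
have hy : `|complex.Im h| <= normc h by exact: normIm_le.
have := H1 _ (le_lt_trans hx h1).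
have := H2 _ (le_lt_trans hy h2).
have := H3 _ (le_lt_trans hy h3).
rewrite add0r cexp0 mul1r; move: hx hy; set x := complex.Re h; set y := complex.Im h.
move=> hx hy K3 K2 K1; set n := normc h in hx hy h1 h2 h3 h4 *.
have n0 : 0 <= n by exact: normc_ge0.
have X0 : 0 < expR x by exact: expR_gt0.
have EX : E * `|x| <= E * n by rewrite ler_pM2l.
have EY : E * `|y| <= E * n by rewrite ler_pM2l.
have En : E * n <= n by rewrite ler_piMl.
have Xn : `|expR x - 1| <= E.
  have -> : expR x - 1 = (expR x - 1 - x) + x by ring.
  by apply: (le_trans (ler_normD _ _)); lra.
have X3 : expR x <= 2 by move: Xn; rewrite ler_norml; lra.
apply: (le_trans (normc_leD _)).
have -> : complex.Re (cexp h - 1 - h) = expR x * (cos y - 1) + (expR x - 1 - x).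
  by rewrite /cexp -/x -/y /x /y; case: (h) => u v /=; ring.
have -> : complex.Im (cexp h - 1 - h) = expR x * (sin y - y) + (expR x - 1) * y.
  by rewrite /cexp -/x -/y /x /y; case: (h) => u v /=; ring.
have t1 : `|expR x * (cos y - 1)| <= 2 * (E * n).
  by rewrite normrM (gtr0_norm X0) ler_pM // ?(ltW X0) //; exact: le_trans K3 _.
have t2 : `|expR x * (sin y - y)| <= 2 * (E * n).
  by rewrite normrM (gtr0_norm X0) ler_pM // ?(ltW X0) //; exact: le_trans K2 _.
have t3 : `|(expR x - 1) * y| <= E * n by rewrite normrM ler_pM.
have En8 : E * n <= e / 8 * n by rewrite ler_wpM2r.
have en0 : 0 <= e * n by rewrite mulr_ge0 // ltW.
have := ler_normD (expR x * (cos y - 1)) (expR x - 1 - x).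
have := ler_normD (expR x * (sin y - y)) ((expR x - 1) * y).
lra.
Qed.

Lemma cderivable_cexpM (k z : R[i]) : cderivable (fun u => cexp (k * u)) z.
Proof.
exists (k * cexp (k * z)) => e e0.
have k0 := normc_ge0 k; have c0 := normc_ge0 (cexp (k * z)).
pose E := e / ((normc (cexp (k * z)) + 1) * (normc k + 1)).
have P0 : 0 < (normc (cexp (k * z)) + 1) * (normc k + 1).
  by rewrite mulr_gt0 // ltr_wpDl.
have E0 : 0 < E by rewrite divr_gt0.
have [d d0 H] := cderiv_cexp0 E0.
exists (d / (normc k + 1)) => [|h hd]; first by rewrite divr_gt0 // ltr_wpDl.
have n0 := normc_ge0 h.
have hkd : normc (k * h) < d.
  move: hd; rewrite ltr_pdivlMr ?ltr_wpDl // => hd; rewrite normcM.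
  by apply: le_lt_trans hd; rewrite mulrC ler_wpM2l // lerDl.
have := H _ hkd; rewrite add0r cexp0 mul1r => K.
have -> : cexp (k * (z + h)) - cexp (k * z) - k * cexp (k * z) * h =
    cexp (k * z) * (cexp (k * h) - 1 - k * h).
  by rewrite mulrDr cexpD; ring.
rewrite normcM.
have -> : e * normc h = (normc (cexp (k * z)) + 1) * (E * ((normc k + 1) * normc h)).
  by rewrite /E; field; apply/andP; split; rewrite gt_eqF // ltr_wpDl.
apply: ler_pM => //; [exact: normc_ge0|by rewrite lerDl|].
apply: (le_trans K); rewrite normcM ler_pM2l // ler_wpM2r // lerDl //.
Qed.

Lemma cderivableB f g z : cderivable f z -> cderivable g z ->
  cderivable (fun u => f u - g u) z.
Proof. by move=> /derivable_cderiv fz /derivable_cderiv gz; apply/derivable_cderiv; exact: derivableB. Qed.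

Lemma cderivableM f g z : cderivable f z -> cderivable g z ->
  cderivable (fun u => f u * g u) z.
Proof. by move=> [l fl] [m gm]; exact: cderivM fl gm. Qed.

Lemma cderivableV g z : cderivable g z -> g z != 0 -> cderivable (fun u => (g u)^-1) z.
Proof. by move=> [l gl] g0; exact: cderivV gl g0. Qed.

Lemma cderivable_cst (k : R[i]) z : cderivable (fun=> k) z.
Proof. by apply/derivable_cderiv; exact: derivable_cst. Qed.

Lemma cderivable_shift g (w z : R[i]) : cderivable g (z - w) -> cderivable (fun u => g (u - w)) z.
Proof.
move=> [l gl]; exists l => e /gl[d d0 H]; exists d => // h /H.
by have -> : z - w + h = z + h - w by ring.
Qed.

Definition sinhR (t : R) := (expR t - expR (- t)) / 2.
Definition coshR (t : R) := (expR t + expR (- t)) / 2.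

Lemma coshR2 t : coshR t ^+ 2 = 1 + sinhR t ^+ 2.
Proof.
rewrite /coshR /sinhR; have := expRxMexpNx_1 t; set p := expR t; set q := expR (- t) => h.
apply/eqP; rewrite -subr_eq0.
have -> : ((p + q) / 2) ^+ 2 - (1 + ((p - q) / 2) ^+ 2) = p * q - 1 by field.
by rewrite h subrr.
Qed.

Lemma coshR_ge1 t : 1 <= coshR t.
Proof.
have c0 : 0 <= coshR t by rewrite divr_ge0 // addr_ge0 // expR_ge0.
have : 1 <= coshR t ^+ 2 by rewrite coshR2 lerDl sqr_ge0.
by move=> h; rewrite -(@ler_pXn2r _ 2) ?nnegrE // expr1n.
Qed.

Lemma coshR_gt0 t : 0 < coshR t. Proof. exact: lt_le_trans ltr01 (coshR_ge1 t). Qed.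

Definition csinh k (z : R[i]) : R[i] := 2^-1 * (cexp (k%:C * z) - cexp ((- k)%:C * z)).

Lemma csinhE k x y : csinh k (x +i* y) =
  (sinhR (k * x) * cos (k * y)) +i* (coshR (k * x) * sin (k * y)).
Proof.
rewrite /csinh /cexp /sinhR /coshR.
have -> : 2^-1 = (2^-1)%:C :> R[i].
  by apply: (mulfI (_ : 2%:C != 0)); rewrite ?eq_complex /= ?pnatr_eq0 // -rmorphM /= mulfV ?pnatr_eq0 // rmorph_nat mulfV // pnatr_eq0.
have -> : (- k)%:C * (x +i* y) = (- (k * x)) +i* (- (k * y)) by apply: eqcP => /=; ring.
have -> : k%:C * (x +i* y) = (k * x) +i* (k * y) by apply: eqcP => /=; ring.
by apply: eqcP => /=; rewrite cosN sinN; field.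
Qed.

Lemma sqr_normc_csinh k x y :
  normc (csinh k (x +i* y)) ^+ 2 = sinhR (k * x) ^+ 2 + sin (k * y) ^+ 2.
Proof.
rewrite csinhE /normc sqr_sqrtr ?addr_ge0 ?sqr_ge0 //.
rewrite [(sinhR _ * _) ^+ 2]exprMn [(coshR _ * _) ^+ 2]exprMn coshR2.
transitivity (sinhR (k * x) ^+ 2 * (cos (k * y) ^+ 2 + sin (k * y) ^+ 2) + sin (k * y) ^+ 2).
  by ring.
by rewrite cos2Dsin2 mulr1.
Qed.

Lemma cderivable_csinh k z : cderivable (csinh k) z.
Proof.
apply: (cderivableM (cderivable_cst _ _)).
by apply: cderivableB; exact: cderivable_cexpM.
Qed.

Lemma is_derive_sinhR0 : is_derive (0 : R) (1 : R) sinhR 1.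
Proof.
by rewrite /sinhR; apply: is_derive_eq; rewrite /GRing.scale /= oppr0 expR0; field.
Qed.

Lemma norm_half_le (s t : R) : `|s - t| <= 2^-1 * `|t| -> `|t / 2| <= `|s|.
Proof.
move=> st; have := lerB_normD t (s - t).
rewrite [t + _]addrC subrK normrM [`|2^-1|]gtr0_norm ?invr_gt0 //; lra.
Qed.

(** So 1 / sinh has at most a simple pole at the origin. *)
Lemma csinh_lower k : 0 < k -> exists2 d : R, 0 < d &
  forall z, normc z < d -> k / 2 * normc z <= normc (csinh k z).
Proof.
move=> k0.
have h2 : 0 < 2^-1 :> R by rewrite invr_gt0.
have /is_derive_expansion/(_ _ h2)[d1 d10 H1] := is_derive_sinhR0.
have /is_derive_expansion/(_ _ h2)[d2 d20 H2] : is_derive (0 : R) (1 : R) sin 1.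
  by apply: is_derive_eq; rewrite cos0.
exists (Num.min (d1 / k) (d2 / k)) => [|z]; first by rewrite lt_min !divr_gt0.
rewrite lt_min => /andP[z1 z2].
rewrite -(ler_pXn2r (_ : 0 < 2)%N) ?nnegrE ?normc_ge0 ?mulr_ge0 ?normc_ge0 ?divr_ge0 ?(ltW k0) //.
case: z z1 z2 => x y z1 z2; rewrite sqr_normc_csinh.
have := normRe_le (x +i* y); rewrite [complex.Re _]/= => nx.
have := normIm_le (x +i* y); rewrite [complex.Im _]/= => ny.
have s0 : sinhR 0 = 0 by rewrite /sinhR oppr0 subrr mul0r.
have K1 : `|k * x / 2| <= `|sinhR (k * x)|.
  apply: norm_half_le; have := H1 (k * x); rewrite add0r s0 mul1r subr0; apply.
  by rewrite normrM (gtr0_norm k0) mulrC -ltr_pdivlMr //; exact: le_lt_trans nx z1.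
have K2 : `|k * y / 2| <= `|sin (k * y)|.
  apply: norm_half_le; have := H2 (k * y); rewrite add0r sin0 mul1r subr0; apply.
  by rewrite normrM (gtr0_norm k0) mulrC -ltr_pdivlMr //; exact: le_lt_trans ny z2.
have -> : (k / 2 * normc (x +i* y)) ^+ 2 = (k * x / 2) ^+ 2 + (k * y / 2) ^+ 2.
  by rewrite exprMn /= sqr_sqrtr ?addr_ge0 ?sqr_ge0 //; field.
by apply: lerD; rewrite -[leLHS]real_normK ?num_real // -[leRHS]real_normK ?num_real // lerXn2r ?nnegrE.
Qed.

Lemma csinh_neq0 k x y : 0 < k -> (x +i* y) != 0 -> `|k * y| < pi -> csinh k (x +i* y) != 0.
Proof.
move=> k0 z0 ypi.
have : 0 < normc (csinh k (x +i* y)) ^+ 2.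
  rewrite sqr_normc_csinh.
  have [yE|y0] := eqVneq y 0; last first.
    rewrite ltr_wpDl ?sqr_ge0 // exprn_even_gt0 //=.
    have [yp|yn] := ltP 0 (k * y).
      by rewrite gt_eqF // sin_gt0_pi // yp; move: ypi; rewrite ltr_norml => /andP[].
    have yn' : k * y < 0 by rewrite lt_neqAle yn andbT mulf_neq0 // gt_eqF.
    rewrite -oppr_eq0 -sinN gt_eqF // sin_gt0_pi // oppr_gt0 yn' /=.
    by move: ypi; rewrite ltr_norml => /andP[]; lra.
  rewrite yE in z0 *; rewrite mulr0 sin0 expr0n addr0 exprn_even_gt0 //= /sinhR mulf_neq0 ?invr_neq0 ?pnatr_eq0 //.
  rewrite subr_eq0 (inj_eq (@expR_inj R)).
  have x0 : x != 0 by apply: contra_neq z0 => ->.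
  have kx : k * x != 0 by rewrite mulf_neq0 // gt_eqF.
  by rewrite -subr_eq0 opprK -mulr2n mulrn_eq0.
by apply: contraTneq => ->; rewrite normc0 expr0n ltxx.
Qed.

End Kernel.

(** * Cauchy's formula in a strip *)

Section Punctured.
Context {R : realType}.
Notation mu := (@lebesgue_measure R).
Implicit Types (f g : R[i] -> R[i]) (a b c d x y k : R).

Lemma complex_neq (x y u v : R) : (x != u) || (y != v) -> x +i* y != u +i* v.
Proof. by rewrite eq_complex /= negb_and. Qed.

(** Around the exceptional point g is bounded, so its integral over a small square
   is at most a multiple of the perimeter of that square. *)
Lemma rect_removable g (u v : R) (C r : R) a b c d :
  a < u < b -> c < v < d -> 0 < r ->
  (forall x y, a <= x <= b -> c <= y <= d -> x +i* y != u +i* v -> cderivable g (x +i* y)) ->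
  (forall z, z != u +i* v -> normc (z - (u +i* v)) < r -> normc (g z) <= C) ->
  rect g a b c d = 0.
Proof.
move=> /andP[au ub] /andP[cv vd] r0 H HC.
have C0 : 0 <= C.
  have r2 : 0 < r / 2 by rewrite divr_gt0.
  apply: (le_trans (normc_ge0 (g ((u + r / 2) +i* v)))); apply: HC.
    by apply: complex_neq; rewrite gt_eqF // ltrDl.
  have -> : (u + r / 2) +i* v - (u +i* v) = (r / 2)%:C by apply: eqcP => /=; ring.
  rewrite normcR gtr0_norm //; lra.
apply: eq0_normc; apply: le_anti; rewrite normc_ge0 andbT.
apply/ler_addgt0Pr => e e0; rewrite add0r.
pose m := Num.min (Num.min (u - a) (b - u)) (Num.min (v - c) (d - v)).
pose n := Num.min (Num.min (m / 2) (r / 4)) (e / (8 * (C + 1))).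
have m0 : 0 < m by rewrite !lt_min !subr_gt0 au ub cv vd.
have C1 : 0 < 8 * (C + 1) by rewrite mulr_gt0 // ltr_wpDl.
have n0 : 0 < n by rewrite !lt_min !divr_gt0.
have nm : n <= m / 2 by rewrite !ge_min lexx.
have nr : n <= r / 4 by rewrite !ge_min lexx orbT.
have ne : n <= e / (8 * (C + 1)) by rewrite !ge_min lexx orbT.
have [m1 m2 m3 m4] : [/\ m <= u - a, m <= b - u, m <= v - c & m <= d - v].
  by rewrite /m !ge_min !lexx !orbT.
have [a0 a2] : a < u - n /\ u - n < u by clear -n0 m0 nm m1; lra.
have [b0 b2] : u + n < b /\ u < u + n by clear -n0 m0 nm m2; lra.
have [c0 c2] : c < v - n /\ v - n < v by clear -n0 m0 nm m3; lra.
have [d0 d2] : v + n < d /\ v < v + n by clear -n0 m0 nm m4; lra.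
have a1 := ltW a0; have b1 := ltW b0; have c1 := ltW c0; have d1 := ltW d0.
have ab0 := lt_trans au ub; have ab := ltW ab0.
have cd := ltW (lt_trans cv vd).
have uu0 := lt_trans a2 b2; have uu := ltW uu0.
have vv0 := lt_trans c2 d2; have vv := ltW vv0.
have au' : a <= u + n := le_trans a1 uu.
have cv' : c <= v + n := le_trans c1 vv.
have bu' : u - n <= b := le_trans uu b1.
have dv' : v - n <= d := le_trans vv d1.
have sub (p q p' q' y : R) : p' <= p -> q <= q' -> p <= y <= q -> p' <= y <= q'.
  by move=> pp qq /andP[py yq]; rewrite (le_trans pp py) (le_trans yq qq).
have Hh y p q : a <= p -> q <= b -> c <= y <= d -> y != v -> cintble (fun x => g (x +i* y)) p q.
  move=> ap qb yI yv; apply: cintble_horizontal => x xI; apply: H => //; first exact: sub xI.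
  by apply: complex_neq; rewrite yv orbT.
have Hv x p q : c <= p -> q <= d -> a <= x <= b -> x != u -> cintble (fun y => g (x +i* y)) p q.
  move=> cp qd xI xu; apply: cintble_vertical => y yI; apply: H => //; first exact: sub yI.
  by apply: complex_neq; rewrite xu.
(* The square of half-side n around the exceptional point is cut out of the rectangle by
   two horizontal and two vertical cuts, which all miss that point. *)
rewrite (@rect_splity _ g a b c (v - n)) //; last first.
  by split; [apply: Hh|apply: Hh|apply: Hv|apply: Hv]; rewrite ?lexx ?ab ?cd ?(lt_eqF cv) ?(gt_eqF vd) ?(lt_eqF au) ?(gt_eqF ub).
rewrite (goursat ab0 c0); last first.
  move=> x y xI yI; apply: H => //; first exact: sub yI.
  by case/andP: yI => _ yn; apply: complex_neq; rewrite orbC (lt_eqF (le_lt_trans yn c2)).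
rewrite (@rect_splity _ g a b (v - n) (v + n)) //; last first.
  by split; [apply: Hh|apply: Hh|apply: Hv|apply: Hv]; rewrite ?lexx ?ab ?c1 ?dv' ?(lt_eqF c2) ?cd ?(gt_eqF vd) ?(lt_eqF au) ?(gt_eqF ub).
rewrite (goursat ab0 d0); last first.
  move=> x y xI yI; apply: H => //; first exact: sub yI.
  by case/andP: yI => yn _; apply: complex_neq; rewrite orbC (gt_eqF (lt_le_trans d2 yn)).
rewrite (@rect_splitx _ g a (u - n)) //; last first.
  by split; [apply: Hh|apply: Hh|apply: Hv|apply: Hv]; rewrite ?lexx ?ab ?c1 ?dv' ?cv' ?d1 ?(lt_eqF c2) ?(gt_eqF d2) ?(lt_eqF au) ?(gt_eqF ub).
rewrite (goursat a0 vv0); last first.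
  move=> x y xI yI; apply: H; [exact: sub xI|exact: sub yI|].
  by case/andP: xI => _ xn; apply: complex_neq; rewrite (lt_eqF (le_lt_trans xn a2)).
rewrite (@rect_splitx _ g (u - n) (u + n)) //; last first.
  by split; [apply: Hh|apply: Hh|apply: Hv|apply: Hv]; rewrite ?lexx ?ab ?a1 ?bu' ?c1 ?dv' ?cv' ?d1 ?(lt_eqF c2) ?(gt_eqF d2) ?(lt_eqF a2) ?(gt_eqF ub).
rewrite (goursat b0 vv0); last first.
  move=> x y xI yI; apply: H; [exact: sub xI|exact: sub yI|].
  by case/andP: xI => xn _; apply: complex_neq; rewrite (gt_eqF (lt_le_trans b2 xn)).
rewrite !add0r !addr0.
have gi : rectble g (u - n) (u + n) (v - n) (v + n).
  by split; [apply: Hh|apply: Hh|apply: Hv|apply: Hv]; rewrite ?a1 ?au' ?b1 ?bu' ?c1 ?dv' ?cv' ?d1 ?(lt_eqF c2) ?(gt_eqF d2) ?(lt_eqF a2) ?(gt_eqF b2).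
apply: (@le_trans _ _ (C * (2 * ((u + n - (u - n)) + (v + n - (v - n)))))).
  apply: normc_rect_bound => //; [move=> x y xI yI bd; apply: HC].
    apply: complex_neq; rewrite -negb_and; apply/negP => /andP[/eqP xu /eqP yv].
    by move: bd; rewrite xu yv (gt_eqF a2) (lt_eqF b2) (gt_eqF c2) (lt_eqF d2).
  apply: (le_lt_trans (normc_leD _)) => /=.
  apply: (@le_lt_trans _ _ (n + n)); last by clear -nr n0; lra.
  by clear -xI yI; apply: lerD; rewrite ler_norml; lra.
have -> : C * (2 * (u + n - (u - n) + (v + n - (v - n)))) = 8 * C * n by ring.
have : (8 * (C + 1)) * n <= e by rewrite mulrC -ler_pdivlMr.
by clear -n0; lra.
Qed.

(** [skernel k (z - w)] is the Cauchy kernel of a horizontal strip. *)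
Definition skernel k (z : R[i]) : R[i] := (csinh k z)^-1.

Lemma cderivable_skernel k w z : 0 < k -> z != w ->
  `|k * (complex.Im z - complex.Im w)| < pi -> cderivable (fun z => skernel k (z - w)) z.
Proof.
move=> k0 zw kz; apply: cderivable_shift; apply: cderivableV; first exact: cderivable_csinh.
have : z - w != 0 by rewrite subr_eq0.
have -> : z - w = (complex.Re z - complex.Re w) +i* (complex.Im z - complex.Im w).
  by case: z {kz zw} => ? ?; case: w.
by move=> ?; exact: csinh_neq0.
Qed.

Lemma normc_skernel_vertical k x y : 0 < k -> x != 0 ->
  normc (skernel k (x +i* y)) <= `|sinhR (k * x)|^-1.
Proof.
move=> k0 x0.
have s0 : sinhR (k * x) != 0.
  have := csinh_neq0 k0 (_ : x +i* 0 != 0) _; rewrite mulr0 normr0 => /(_ _ (pi_gt0 _)).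
  rewrite csinhE mulr0 sin0 cos0 mulr0 mulr1 => H.
  apply: contra_neq (H _) => [->//|].
  by rewrite eq_complex /= eqxx andbT.
rewrite /skernel normcV lef_pV2 ?posrE ?normr_gt0 //.
  rewrite -(@ler_pXn2r _ 2) ?nnegrE ?normc_ge0 // real_normK ?num_real //.
  by rewrite sqr_normc_csinh lerDl sqr_ge0.
rewrite lt_neqAle normc_ge0 andbT eq_sym.
have : normc (csinh k (x +i* y)) ^+ 2 != 0.
  by rewrite sqr_normc_csinh gt_eqF // ltr_wpDr ?sqr_ge0 // exprn_even_gt0.
by rewrite expf_eq0.
Qed.

Definition line_kernel k w (c T' T : R) := cint (fun s => skernel k ((s +i* c) - w)) T' T.
Definition line_transform f k w (c T' T : R) :=
  cint (fun s => f (s +i* c) * skernel k ((s +i* c) - w)) T' T.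

(** Bounds the contribution of the vertical side at abscissa t to the contour
   integral of (f - f w) times the kernel: on that side the kernel is at most
   1 / |sinh (k (t - Re w))|. *)
Definition side_error f k w a b t :=
  (\int[mu]_(y in `[a, b]) normc (f (t +i* y)) + normc (f w) * (b - a))
  / `|sinhR (k * (t - complex.Re w))|.

(** The function (f - f w) times the kernel has a removable singularity at w, so
   its contour integral vanishes.  Subtracting f w replaces the computation of a
   residue by that of the integrals of the kernel itself. *)
Lemma strip_formula f k (u v : R) a b T' T :
  0 < k -> a < v < b -> k * (b - a) <= pi -> T' < u < T ->
  (forall x y, T' <= x <= T -> a <= y <= b -> cderivable f (x +i* y)) ->
  normc (f (u +i* v) * (line_kernel k (u +i* v) a T' T - line_kernel k (u +i* v) b T' T)
         - (line_transform f k (u +i* v) a T' T - line_transform f k (u +i* v) b T' T))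
  <= side_error f k (u +i* v) a b T + side_error f k (u +i* v) a b T'.
Proof.
move=> k0 /andP[av vb] kab /andP[T'u uT] Hf; set w := u +i* v.
have T'T : T' < T by exact: lt_trans uT.
have ab : a < b by exact: lt_trans vb.
pose K z := skernel k (z - w).
have HK x y : T' <= x <= T -> a <= y <= b -> x +i* y != w -> cderivable K (x +i* y).
  move=> xI yI zw; apply: cderivable_skernel => //=.
  rewrite normrM (gtr0_norm k0); apply: lt_le_trans kab; rewrite ltr_pM2l //.
  by rewrite ltr_norml; lra.
pose g z := (f z - f w) * K z.
have Hg x y : T' <= x <= T -> a <= y <= b -> x +i* y != w -> cderivable g (x +i* y).
  move=> xI yI zw; apply: cderivableM; last exact: HK.
  by apply: cderivableB; [exact: Hf|exact: cderivable_cst].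
have [l /cderiv_lip[d1 d10 H1]] : cderivable f w by apply: Hf; lra.
have [d2 d20 H2] := csinh_lower k0.
have g0 : rect g T' T a b = 0.
  apply: (@rect_removable g u v ((normc l + 1) * (2 / k)) (Num.min d1 d2)) => //; rewrite ?T'u ?av //.
    by rewrite lt_min d10.
  move=> z zw; rewrite lt_min => /andP[z1 z2].
  have n0 : 0 < normc (z - w).
    rewrite lt_neqAle normc_ge0 andbT eq_sym; apply: contra_neq zw => /eq0_normc/eqP.
    by rewrite subr_eq0 => /eqP.
  have k2 : 0 < k / 2 * normc (z - w) by rewrite mulr_gt0 // divr_gt0.
  have := H1 _ z1; rewrite [w + _]addrC subrK => fz.
  have := H2 _ z2 => sz.
  rewrite /g /K /skernel normcM normcV.
  have -> : (normc l + 1) * (2 / k) = ((normc l + 1) * normc (z - w)) * (k / 2 * normc (z - w))^-1.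
    by field; rewrite !gt_eqF.
  apply: ler_pM; rewrite ?normc_ge0 ?invr_ge0 ?normc_ge0 //.
  by rewrite lef_pV2 ?posrE //; exact: lt_le_trans sz.
have line c : a <= c <= b -> c != v ->
    cint (fun s => g (s +i* c)) T' T = line_transform f k w c T' T - f w * line_kernel k w c T' T.
  move=> cI cv; rewrite /line_transform /line_kernel.
  have zw x : x +i* c != w by apply: complex_neq; rewrite cv orbT.
  have Ki : cintble (fun s => K (s +i* c)) T' T.
    by apply: cintble_horizontal => x xI; apply: HK.
  have fKi : cintble (fun s => f (s +i* c) * K (s +i* c)) T' T.
    apply: (@cintble_horizontal _ (fun z => f z * K z)) => x xI.
    by apply: cderivableM; [exact: Hf|exact: HK].
  rewrite -mulNr -cintZ // -cintD //; last exact: cintbleZ.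
  by apply: eq_cint => x _; rewrite /g /K; ring.
move: g0; rewrite /rect !line; [|lra|by rewrite gt_eqF|lra|by rewrite lt_eqF].
set V := cint _ a b; set V' := cint _ a b => g0.
have -> : f w * (line_kernel k w a T' T - line_kernel k w b T' T)
         - (line_transform f k w a T' T - line_transform f k w b T' T) = 'i * V - 'i * V'.
  by apply/eqP; rewrite -subr_eq0 -oppr_eq0 -[X in _ == X]g0; apply/eqP; ring.
have side t : T' <= t <= T -> t != u -> normc (cint (fun y => g (t +i* y)) a b) <= side_error f k w a b t.
  move=> tI tu.
  have zw y : t +i* y != w by apply: complex_neq; rewrite tu.
  have gi : cintble (fun y => g (t +i* y)) a b by apply: cintble_vertical => y yI; exact: Hg.
  have fi : cintble (fun y => f (t +i* y)) a b by apply: cintble_vertical => y yI; exact: Hf.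
  apply: (le_trans (normc_cint_le gi)); rewrite /side_error.
  have nfi := integrable_normc fi.
  have ci := integrable_cst_itv (normc (f w)) a b.
  have -> : \int[mu]_(y in `[a, b]) normc (f (t +i* y)) + normc (f w) * (b - a) =
      \int[mu]_(y in `[a, b]) (normc (f (t +i* y)) + normc (f w)).
    by rewrite RintegralD // Rintegral_cst_itv // ltW.
  rewrite mulrC -RintegralZl //; last exact: integrable_EFinD.
  apply: le_Rintegral => //; first exact: integrable_normc.
    by apply: integrable_EFinZ => //; exact: integrable_EFinD.
  move=> y _; rewrite /g normcM mulrC; apply: ler_pM; rewrite ?normc_ge0 //.
    rewrite /K /w; have -> : t +i* y - (u +i* v) = (t - u) +i* (y - v) by [].
    by apply: normc_skernel_vertical; rewrite ?subr_eq0.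
  by apply: (le_trans (le_normcD _ _)); rewrite normcN.
apply: (le_trans (le_normcD _ _)); rewrite normcN !normcM normc_i !mul1r.
by apply: lerD; apply: side; rewrite ?(gt_eqF uT) ?(lt_eqF T'u) //; lra.
Qed.

End Punctured.

(** * The hyperbolic secant *)

Section Sech.
Context {R : realType}.
Notation mu := (@lebesgue_measure R).
Implicit Types (k s u t : R).

Definition sechk k s := (coshR (k * s))^-1.

Lemma sechk_gt0 k s : 0 < sechk k s.
Proof. by rewrite invr_gt0 coshR_gt0. Qed.

Lemma sechk_le1 k s : sechk k s <= 1.
Proof. by rewrite invf_le1 ?coshR_gt0 // coshR_ge1. Qed.

Lemma sechkN k s : sechk k (- s) = sechk k s.
Proof. by rewrite /sechk /coshR mulrN opprK addrC. Qed.

Lemma is_derive_sech_primitive k u s : k != 0 ->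
  is_derive s 1 (fun s => 2 / k * atan (expR (k * (s - u)))) (sechk k (s - u)).
Proof.
move=> k0; apply: is_derive_eq.
rewrite /GRing.scale /= /sechk /coshR expRN; set E := expR _.
have E0 : 0 < E by exact: expR_gt0.
by field; rewrite k0 !gt_eqF // addr_gt0 // mulr_gt0.
Qed.

Lemma continuous_sechk k u : continuous (fun s => sechk k (s - u)).
Proof.
have cc : continuous (fun s => coshR (k * (s - u))).
  move=> s; rewrite /coshR; apply: differentiable_continuous.
  by apply/derivable1_diffP; exact: ex_derive.
by move=> s; apply: cvgV; [rewrite gt_eqF // coshR_gt0|exact: cc].
Qed.

Lemma sechk_int_itv k u (p q : R) : 0 < k -> p < q ->
  (\int[mu]_(s in `[p, q]) (sechk k (s - u))%:E)%E =
  (2 / k * atan (expR (k * (q - u))) - 2 / k * atan (expR (k * (p - u))))%:E.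
Proof.
move=> k0 pq; have dF s := is_derive_sech_primitive u s (lt0r_neq0 k0).
have cF : continuous (fun s => 2 / k * atan (expR (k * (s - u)))).
  by move=> s; apply/differentiable_continuous/derivable1_diffP; case: (dF s).
rewrite (continuous_FTC2 pq (F := fun s => 2 / k * atan (expR (k * (s - u))))) //.
- by apply: continuous_subspaceT; exact: continuous_sechk.
- split.
  + by move=> s _; case: (dF s).
  + by apply: cvg_at_right_filter; exact: cF.
  + by apply: cvg_at_left_filter; exact: cF.
- by move=> s _; rewrite derive1E; case: (dF s).
Qed.

Lemma sechk_int_cvg k u : 0 < k ->
  (\int[mu]_(s in `[(u - n%:R)%R, (u + n%:R)%R]) (sechk k (s - u))%:E)%E
    @[n --> \oo] --> (pi / k)%:E.
Proof.
move=> k0; rewrite -(cvg_shiftS _).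
have -> : (fun n => \int[mu]_(s in `[(u - n.+1%:R)%R, (u + n.+1%:R)%R]) (sechk k (s - u))%:E)%E
   = (fun n => (2 / k * atan (expR (k * n.+1%:R)) - 2 / k * atan (expR (- (k * n.+1%:R))))%:E).
  apply/funext => n; rewrite sechk_int_itv //; last first.
    by rewrite ltrBlDr -addrA ltrDl addr_gt0.
  have -> : u + n.+1%:R - u = n.+1%:R by ring.
  by have -> : k * (u - n.+1%:R - u) = - (k * n.+1%:R) by ring.
apply: cvg_EFin; first exact: nearW.
have nn : (n.+1%:R : R) @[n --> \oo] --> +oo%R.
  by rewrite (cvg_shiftS (fun n => n%:R : R)); exact: cvgr_idn.
have kn : k * (n.+1%:R : R) @[n --> \oo] --> +oo%R.
  apply: (@cvg_comp _ _ _ (fun n : nat => n.+1%:R : R) ( *%R k) _ _ _ nn).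
  by apply: gt0_cvgMry => //; exact: cvg_id.
have -> : pi / k = 2 / k * (pi / 2) - 2 / k * 0 by rewrite mulr0 subr0; field; rewrite gt_eqF.
apply: cvgB; apply: cvgM; try exact: cvg_cst.
  have cE : expR (k * n.+1%:R) @[n --> \oo] --> +oo%R.
    apply: ger_cvgy kn; apply: nearW => n.
    by apply: le_trans (expR_ge1Dx _); rewrite lerDr.
  exact: (@cvg_comp _ _ _ _ (@atan R) _ _ _ cE (@cvgy_atan R)).
have cE : expR (- (k * n.+1%:R)) @[n --> \oo] --> (0 : R).
  exact: (@cvg_comp _ _ _ _ (fun x => expR (- x)) _ _ _ kn (@cvgr_expR R)).
have := @cvg_comp _ _ _ _ (@atan R) _ _ _ cE (@continuous_atan R 0).
by rewrite atan0; apply.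
Qed.

Lemma ge0_Rintegral_subset (A B : set (measurableTypeR R)) (f : R -> R) :
  measurable A -> measurable B -> A `<=` B -> mu.-integrable B (EFin \o f) ->
  (forall x, B x -> 0 <= f x) ->
  \int[mu]_(x in A) f x <= \int[mu]_(x in B) f x.
Proof.
move=> mA mB AB fi f0; rewrite /Rintegral; apply: fine_le.
- by apply: integrable_fin_num => //; exact: (@integrableS _ _ _ mu _ _ _ mB mA AB fi).
- exact: integrable_fin_num.
- have mf : measurable_fun B (EFin \o f) by move/integrableP : fi => [].
  apply: ge0_subset_integral; [exact: mA|exact: mB|exact: mf| |exact: AB].
  by move=> x Bx; rewrite lee_fin; exact: f0.
Qed.

Lemma sechk_integral k u : 0 < k ->
  (\int[mu]_s (sechk k (s - u))%:E)%E = (pi / k)%:E.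
Proof.
move=> k0; have mf : measurable_fun setT (fun s => (sechk k (s - u))%:E).
  by apply/measurable_EFinP; apply: continuous_measurable_fun; exact: continuous_sechk.
have := @ge0_nondecreasing_set_cvg_integral _ _ _
  (fun n => `[(u - n%:R)%R, (u + n%:R)%R] : set (measurableTypeR R))
  (fun s => (sechk k (s - u))%:E) mu.
have -> : \bigcup_n (`[(u - n%:R)%R, (u + n%:R)%R] : set (measurableTypeR R)) = setT.
  apply/seteqP; split => // s _.
  have [m hm] : exists m : nat, `|s - u| <= m%:R.
    by exists (Num.truncn `|s - u|).+1; apply: ltW; rewrite truncnS_gt.
  exists m => //=; rewrite in_itv /=; move: hm; rewrite ler_norml; lra.
move=> H; rewrite -(cvg_lim (@ereal_hausdorff R) (sechk_int_cvg u k0)).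
apply/esym; apply: cvg_lim; [exact: ereal_hausdorff|apply: H].
- move=> m n mn; rewrite subsetEset; apply: subset_itv; rewrite bnd_simp.
    by rewrite lerD2l lerN2 ler_nat.
  by rewrite lerD2l ler_nat.
- by [].
- by move=> i; apply: measurable_funTS.
- by move=> i x _; rewrite lee_fin ltW // sechk_gt0.
Qed.

Lemma integrable_sechk k u : 0 < k ->
  mu.-integrable setT (EFin \o (fun s => sechk k (s - u))).
Proof.
move=> k0; apply/integrableP; split.
  by apply/measurable_EFinP; apply: continuous_measurable_fun; exact: continuous_sechk.
under eq_integral do rewrite /= ger0_norm ?(ltW (sechk_gt0 _ _)) //.
by rewrite sechk_integral // ltry.
Qed.

Lemma sechk_Rintegral k u : 0 < k -> \int[mu]_s sechk k (s - u) = pi / k.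
Proof. by move=> k0; rewrite /Rintegral sechk_integral. Qed.

Lemma sechk_tail k u (e : R) : 0 < k -> 0 < e -> exists N : R, forall T' T,
  T' <= u - N -> u + N <= T -> pi / k - e <= \int[mu]_(s in `[T', T]) sechk k (s - u).
Proof.
move=> k0 e0.
have : \int[mu]_(s in `[u - n%:R, u + n%:R]) sechk k (s - u) @[n --> \oo] --> pi / k.
  exact: fine_cvg (sechk_int_cvg u k0).
move=> /cvgrPdist_le/(_ e e0)[n _ /(_ n (leqnn n))].
rewrite /= => H; exists n%:R => T' T hT' hT.
apply: le_trans (_ : _ <= \int[mu]_(s in `[(u - n%:R)%R, (u + n%:R)%R]) sechk k (s - u)) _.
  by move: H; rewrite ler_norml /Rintegral; lra.
apply: ge0_Rintegral_subset => //.
- by apply: subset_itv; rewrite bnd_simp.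
- have := @integrableS _ _ _ mu setT `[T', T] _ _ _ _ (integrable_sechk u k0); exact.
- by move=> x _; rewrite ltW // sechk_gt0.
Qed.

Lemma sinhR_ge t : `|t| / 2 <= `|sinhR t|.
Proof.
wlog t0 : t / 0 <= t => [H|].
  have [|t0] := leP 0 t; first exact: H.
  rewrite -normrN; have -> : `|sinhR t| = `|sinhR (- t)|.
    by rewrite -normrN /sinhR opprK; congr (`|_|); ring.
  by apply: H; rewrite oppr_ge0 ltW.
have h1 := expR_ge1Dx t; have h2 : expR (- t) <= 1 by rewrite expR_le1 oppr_le0.
by rewrite /sinhR (ger0_norm t0) ger0_norm; lra.
Qed.

(** Makes the side errors small. *)
Lemma sinhR_large k u (C e : R) : 0 < k -> 0 < e -> exists N : R, forall t,
  N <= `|t - u| -> C / `|sinhR (k * (t - u))| <= e.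
Proof.
move=> k0 e0; exists (2 * `|C| / (k * e) + 1) => t ht.
have h := sinhR_ge (k * (t - u)); move: h; rewrite normrM (gtr0_norm k0) => h.
have N0 : 0 <= 2 * `|C| / (k * e) by rewrite divr_ge0 // mulr_ge0 // ltW.
have d0 : 0 < `|t - u| by lra.
have s0 : 0 < `|sinhR (k * (t - u))|.
  by apply: lt_le_trans h; rewrite divr_gt0 // mulr_gt0.
rewrite ler_pdivrMr //; apply: (le_trans (ler_norm C)).
apply: (@le_trans _ _ (e * (k * `|t - u| / 2))); last by rewrite ler_pM2l.
have -> : `|C| = e * (k * (2 * `|C| / (k * e)) / 2) by field; rewrite !gt_eqF.
by rewrite ler_pM2l // ler_pM2r ?invr_gt0 // ler_pM2l //; lra.
Qed.

End Sech.

(** * The strip kernel on the edges of the strip *)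

Section StripBounds.
Context {R : realType}.
Notation mu := (@lebesgue_measure R).
Implicit Types (f : R[i] -> R[i]) (k s u v t : R).

Lemma lipschitz_derive (g dg : R -> R) (x y C : R) :
  (forall z : R, is_derive z (1 : R) g (dg z)) -> (forall z, `|dg z| <= C) ->
  `|g x - g y| <= C * `|x - y|.
Proof.
move=> dgE dgC; wlog xy : x y / y <= x => [H|].
  by have [|/ltW] := leP y x; [exact: H|rewrite distrC [`|x - y|]distrC; exact: H].
move: xy; rewrite le_eqVlt => /orP[/eqP ->|yx]; first by rewrite !subrr normr0 mulr0.
have cg : {within `[y, x], continuous g}.
  apply: continuous_subspaceT => z; apply: differentiable_continuous.
  by apply/derivable1_diffP; case: (dgE z).
have [c _ ->] := @MVT R g dg y x yx (fun z _ => dgE z) cg.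
by rewrite normrM ler_wpM2r.
Qed.

Lemma cos_lipschitz x y : `|cos x - cos y| <= `|x - y| :> R.
Proof.
rewrite -[leRHS]mul1r; apply: (@lipschitz_derive _ (fun x => - sin x)) => z.
by rewrite normrN ler_norml sin_geN1 sin_le1.
Qed.

Lemma sin_lipschitz x y : `|sin x - sin y| <= `|x - y| :> R.
Proof.
rewrite -[leRHS]mul1r; apply: (@lipschitz_derive _ cos) => z.
by rewrite ler_norml cos_geN1 cos_le1.
Qed.

Lemma cos_small t : `|t| <= 4^-1 -> 2^-1 <= cos t.
Proof.
move=> ht; have := cos_lipschitz t 0; rewrite cos0 subr0 ler_norml => /andP[h _].
by lra.
Qed.

(** On the edges of the strip of half-height pi / (2 k) the shift by i pi / 2 turns
   sinh into a multiple of cosh, up to the angle t = k (y0 - v) by which the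
   height v of the evaluation point deviates from the centre y0.  At t = 0 the
   denominator is - i cosh s. *)
Definition tden t s : R[i] := (sinhR s * sin t) -i* (coshR s * cos t).
Definition tker t s : R[i] := (tden t s)^-1.

Lemma tker_bound t s : `|t| <= 4^-1 -> normc (tker t s) <= 2 / coshR s.
Proof.
move=> /cos_small ct; have c0 := coshR_gt0 s.
have ct0 : 0 < cos t by apply: lt_le_trans ct; rewrite invr_gt0.
have -> : 2 / coshR s = (coshR s * 2^-1)^-1 by field; rewrite gt_eqF.
have h : coshR s * 2^-1 <= normc (tden t s).
  apply: le_trans (normIm_le _); rewrite [complex.Im _]/= normrN gtr0_norm.
    by rewrite ler_pM2l.
  exact: mulr_gt0.
have p0 : 0 < coshR s * 2^-1 by apply: mulr_gt0; rewrite // invr_gt0.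
by rewrite /tker normcV lef_pV2 ?posrE // (lt_le_trans p0).
Qed.

Lemma tden_neq0 t s : `|t| <= 4^-1 -> tden t s != 0.
Proof.
move=> /cos_small ct; have c0 := coshR_gt0 s.
have ct0 : 0 < cos t by apply: lt_le_trans ct; rewrite invr_gt0.
have h : coshR s * cos t != 0 by apply: mulf_neq0; rewrite gt_eqF.
by rewrite /tden eq_complex negb_and [complex.Im _]/= oppr_eq0 h orbT.
Qed.

Lemma Im_tker_ge t s : `|t| <= 4^-1 -> 2^-1 / coshR s <= complex.Im (tker t s).
Proof.
move=> ht; have ct := cos_small ht; have c0 := coshR_gt0 s.
have ct0 : 0 < cos t by apply: lt_le_trans ct; rewrite invr_gt0.
set d := (sinhR s * sin t) ^+ 2 + (coshR s * cos t) ^+ 2.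
have -> : complex.Im (tker t s) = coshR s * cos t / d by rewrite /tker /tden /= sqrrN mulNr opprK.
have dle : d <= coshR s ^+ 2.
  rewrite /d; have := coshR2 s; set S := sinhR s; set C := coshR s => CS.
  have -> : (S * sin t) ^+ 2 + (C * cos t) ^+ 2 = S ^+ 2 * sin t ^+ 2 + C ^+ 2 * cos t ^+ 2 by ring.
  have -> : cos t ^+ 2 = 1 - sin t ^+ 2 by rewrite -(cos2Dsin2 t) addrK.
  have := sqr_ge0 (sin t); rewrite CS; nra.
have d0 : 0 < d by rewrite ltr_wpDl ?sqr_ge0 // exprn_gt0 //; apply: mulr_gt0.
apply: (@le_trans _ _ (coshR s * cos t / coshR s ^+ 2)).
  have -> : coshR s * cos t / coshR s ^+ 2 = cos t / coshR s by field; rewrite gt_eqF.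
  by rewrite ler_pM2r // invr_gt0.
have n0 : 0 < coshR s * cos t by apply: mulr_gt0.
by rewrite ler_pM2l // lef_pV2 ?posrE // exprn_gt0.
Qed.

Lemma normc_tker0 s : normc (tker 0 s) = (coshR s)^-1.
Proof.
rewrite /tker normcV /tden sin0 cos0 mulr0 mulr1 /normc expr0n add0r sqrrN sqrtr_sqr.
by rewrite gtr0_norm // coshR_gt0.
Qed.

Lemma Im_tker0 s : complex.Im (tker 0 s) = (coshR s)^-1.
Proof.
have c0 := coshR_gt0 s.
rewrite /tker /tden sin0 cos0 mulr0 mulr1 /= expr0n add0r sqrrN mulNr opprK.
by field; rewrite gt_eqF.
Qed.

Lemma tker_lipschitz t t' s : `|t| <= 4^-1 -> `|t'| <= 4^-1 ->
  normc (tker t s - tker t' s) <= 8 * `|t - t'| / coshR s.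
Proof.
move=> ht ht'; have c0 := coshR_gt0 s.
have d0 := tden_neq0 s ht; have d0' := tden_neq0 s ht'.
have -> : tker t s - tker t' s = (tden t' s - tden t s) * (tker t s * tker t' s).
  by rewrite /tker; field; rewrite d0 d0'.
have sc : `|sinhR s| <= coshR s.
  rewrite -(@ler_pXn2r _ 2) ?nnegrE ?(ltW c0) // real_normK ?num_real // coshR2.
  by rewrite lerDr.
rewrite !normcM.
have dd : normc (tden t' s - tden t s) <= 2 * coshR s * `|t - t'|.
  apply: (le_trans (normc_leD _)).
  have -> : complex.Re (tden t' s - tden t s) = sinhR s * (sin t' - sin t).
    by rewrite /tden [complex.Re _]/=; ring.
  have -> : complex.Im (tden t' s - tden t s) = - (coshR s * (cos t' - cos t)).
    by rewrite /tden [complex.Im _]/=; ring.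
  rewrite normrN [`|sinhR s * _|]normrM [`|coshR s * _|]normrM (gtr0_norm c0) -mulrA mulr_natl mulr2n.
  have h1 : `|sin t' - sin t| <= `|t - t'| by rewrite distrC; exact: sin_lipschitz.
  have h2 : `|cos t' - cos t| <= `|t - t'| by rewrite distrC; exact: cos_lipschitz.
  by apply: lerD; apply: ler_pM => //; exact: ltW.
have -> : 8 * `|t - t'| / coshR s = (2 * coshR s * `|t - t'|) * ((2 / coshR s) * (2 / coshR s)).
  by field; rewrite gt_eqF.
apply: ler_pM => //; [exact: normc_ge0|apply: mulr_ge0; exact: normc_ge0|].
by apply: ler_pM; [exact: normc_ge0|exact: normc_ge0|exact: tker_bound|exact: tker_bound].
Qed.

Lemma skernel_lower k s u v y0 : k != 0 ->
  skernel k ((s +i* (y0 - pi / (2 * k))) - (u +i* v)) = tker (k * (y0 - v)) (k * (s - u)).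
Proof.
move=> k0; rewrite /skernel /tker; congr (_^-1).
have -> : (s +i* (y0 - pi / (2 * k))) - (u +i* v) =
  (s - u) +i* (y0 - pi / (2 * k) - v) by [].
rewrite csinhE /tden.
have -> : k * (y0 - pi / (2 * k) - v) = k * (y0 - v) - pi / 2 by field.
by rewrite cosBpihalf sinBpihalf mulrN.
Qed.

Lemma skernel_upper k s u v y0 : k != 0 ->
  skernel k ((s +i* (y0 + pi / (2 * k))) - (u +i* v)) = - tker (k * (y0 - v)) (k * (s - u)).
Proof.
move=> k0; rewrite /skernel /tker -invrN; congr (_^-1).
have -> : (s +i* (y0 + pi / (2 * k))) - (u +i* v) =
  (s - u) +i* (y0 + pi / (2 * k) - v) by [].
rewrite csinhE /tden.
have -> : k * (y0 + pi / (2 * k) - v) = k * (y0 - v) + pi / 2 by field.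
by rewrite cosDpihalf sinDpihalf; apply: eqcP => /=; ring.
Qed.

End StripBounds.

(** * Pointwise inequalities in a strip *)

Section StripInequalities.
Context {R : realType}.
Notation mu := (@lebesgue_measure R).
Implicit Types (f : R[i] -> R[i]) (k s u v t e : R).

(** Along these abscissas the side errors tend to 0, as [sinhR_large] shows. *)
Definition vertical_bounded f (a b : R) := exists C : R, forall N : R,
  exists T' T : R, [/\ T' <= - N, N <= T,
    \int[mu]_(y in `[a, b]) normc (f (T' +i* y)) <= C &
    \int[mu]_(y in `[a, b]) normc (f (T +i* y)) <= C].

Definition edges f k (y0 : R) s : R :=
  normc (f (s +i* (y0 - pi / (2 * k)))) + normc (f (s +i* (y0 + pi / (2 * k)))).

Variables (f : R[i] -> R[i]) (k y0 : R).
Hypothesis k0 : 0 < k.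
Let a := y0 - pi / (2 * k).
Let b := y0 + pi / (2 * k).
Hypothesis Hf : forall x y, a <= y <= b -> cderivable f (x +i* y).
Hypothesis Hv : vertical_bounded f a b.
Hypothesis Hi : forall u, mu.-integrable setT (EFin \o (fun s => edges f k y0 s * sechk k (s - u))).

Definition edge_mean u := \int[mu]_s (edges f k y0 s * sechk k (s - u)).

Let I u t T' T := cint (fun s => tker t (k * (s - u))) T' T.
Let J u t T' T := cint (fun s => (f (s +i* a) + f (s +i* b)) * tker t (k * (s - u))) T' T.

Let r0 : 0 < pi / (2 * k).
Proof. by rewrite divr_gt0 ?pi_gt0 // mulr_gt0. Qed.

Lemma angle_small v : `|v - y0| <= (4 * k)^-1 -> `|k * (y0 - v)| <= 4^-1.
Proof.
move=> h; rewrite normrM (gtr0_norm k0) distrC.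
have -> : 4^-1 = k * (4 * k)^-1 by field; rewrite gt_eqF.
by rewrite ler_pM2l.
Qed.

Lemma near_centre v : `|v - y0| <= (4 * k)^-1 -> a < v < b.
Proof.
move=> h; have : (4 * k)^-1 < pi / (2 * k).
  have -> : (4 * k)^-1 = 2^-1 / (2 * k) by field; rewrite gt_eqF.
  rewrite ltr_pM2r ?invr_gt0 ?mulr_gt0 //; have := pihalf_ge1 R; lra.
by move: h; rewrite ler_norml /a /b; lra.
Qed.

Lemma cintble_tker u t (T' T : R) : `|t| <= 4^-1 -> cintble (fun s => tker t (k * (s - u))) T' T.
Proof.
move=> ht; pose v := y0 - t / k.
have vt : k * (y0 - v) = t by rewrite /v; field; rewrite gt_eqF.
have := @cintble_horizontal _ (fun z => skernel k (z - (u +i* v))) T' T a.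
have E s : skernel k (s +i* a - (u +i* v)) = tker t (k * (s - u)).
  by rewrite skernel_lower ?gt_eqF // vt.
move=> H; apply: eq_cintble (H _) => [s _|s _]; first exact: E.
have tk : `|t / k| < pi / (2 * k).
  rewrite normrM [`|k^-1|]gtr0_norm ?invr_gt0 // invfM mulrA ltr_pM2r ?invr_gt0 //.
  by have := pihalf_ge1 R; lra.
have [h1 h2] : - (pi / (2 * k)) < t / k /\ t / k < pi / (2 * k).
  by move: tk; rewrite ltr_norml => /andP.
apply: cderivable_skernel => //=.
  have av : a < v by rewrite /a /v; lra.
  by apply: complex_neq; rewrite (lt_eqF av) orbT.
have -> : k * (a - v) = t - pi / 2 by rewrite /a /v; field; rewrite gt_eqF.
by have := pihalf_ge1 R; move: ht; rewrite ler_norml ltr_norml; lra.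
Qed.

Lemma cintble_edge_tker u t (T' T : R) : `|t| <= 4^-1 ->
  cintble (fun s => (f (s +i* a) + f (s +i* b)) * tker t (k * (s - u))) T' T.
Proof.
move=> ht; pose v := y0 - t / k.
have vt : k * (y0 - v) = t by rewrite /v; field; rewrite gt_eqF.
have tk : `|v - y0| <= (4 * k)^-1.
  have -> : v - y0 = - (t / k) by rewrite /v; ring.
  rewrite normrN normrM [`|k^-1|]gtr0_norm ?invr_gt0 // invfM ler_pM2r ?invr_gt0 //.
have /andP[av vb] := near_centre tk.
have ker c : a <= c <= b -> c != v -> forall s, cderivable (fun z => skernel k (z - (u +i* v))) (s +i* c).
  move=> /andP[ac cb] cv s; apply: cderivable_skernel => //=.
    by apply: complex_neq; rewrite cv orbT.
  rewrite normrM (gtr0_norm k0).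
  have -> : pi = k * (b - a) by rewrite /a /b; field; rewrite gt_eqF.
  by rewrite ltr_pM2l // ltr_norml; apply/andP; split; lra.
have Ha : cintble (fun s => f (s +i* a) * tker t (k * (s - u))) T' T.
  have := @cintble_horizontal _ (fun z => f z * skernel k (z - (u +i* v))) T' T a.
  move=> H; apply: eq_cintble (H _) => [s _|s _].
    by rewrite skernel_lower ?gt_eqF // vt.
  by apply: cderivableM; [apply: Hf; lra|apply: ker; [lra|rewrite lt_eqF]].
have Hb : cintble (fun s => f (s +i* b) * tker t (k * (s - u))) T' T.
  have := @cintble_horizontal _ (fun z => (-1 * f z) * skernel k (z - (u +i* v))) T' T b.
  move=> H; apply: eq_cintble (H _) => [s _|s _].
    by rewrite skernel_upper ?gt_eqF // vt; ring.
  apply: cderivableM; last by apply: ker; [lra|rewrite gt_eqF].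
  by apply: cderivableM; [exact: cderivable_cst|apply: Hf; lra].
by apply: eq_cintble (cintbleD Ha Hb) => s _; ring.
Qed.

(** The kernel takes opposite values on the two edges, and the edges are run in
   opposite directions, so only the sum of the edge values of f remains. *)
Lemma strip_formula_angle u v (T' T : R) : `|v - y0| <= (4 * k)^-1 -> T' < u < T ->
  normc (2 * f (u +i* v) * I u (k * (y0 - v)) T' T - J u (k * (y0 - v)) T' T)
  <= side_error f k (u +i* v) a b T + side_error f k (u +i* v) a b T'.
Proof.
move=> hv uI; have vI := near_centre hv; have ht := angle_small hv.
have kab : k * (b - a) <= pi.
  by have -> : k * (b - a) = pi by rewrite /a /b; field; rewrite gt_eqF.
have := strip_formula k0 vI kab uI (fun x y _ yI => Hf x yI).
have -> : line_kernel k (u +i* v) a T' T = I u (k * (y0 - v)) T' T.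
  by apply: eq_cint => s _; rewrite skernel_lower ?gt_eqF.
have -> : line_kernel k (u +i* v) b T' T = -1 * I u (k * (y0 - v)) T' T.
  rewrite /I -cintZ; last exact: cintble_tker.
  by apply: eq_cint => s _; rewrite skernel_upper ?gt_eqF // mulN1r.
have Ji := cintble_edge_tker u T' T ht.
have Ia : cintble (fun s => f (s +i* a) * skernel k (s +i* a - (u +i* v))) T' T.
  apply: (@cintble_horizontal _ (fun z => f z * skernel k (z - (u +i* v)))) => s _.
  apply: cderivableM; first by apply: Hf; move: vI; lra.
  apply: cderivable_skernel => //=.
    by apply: complex_neq; case/andP: vI => av _; rewrite (lt_eqF av) orbT.
  rewrite normrM (gtr0_norm k0); apply: lt_le_trans kab; rewrite ltr_pM2l //.
  by move: vI; rewrite ltr_norml; lra.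
have Ib : cintble (fun s => f (s +i* b) * skernel k (s +i* b - (u +i* v))) T' T.
  apply: (@cintble_horizontal _ (fun z => f z * skernel k (z - (u +i* v)))) => s _.
  apply: cderivableM; first by apply: Hf; move: vI; lra.
  apply: cderivable_skernel => //=.
    by apply: complex_neq; case/andP: vI => _ vb; rewrite (gt_eqF vb) orbT.
  rewrite normrM (gtr0_norm k0); apply: lt_le_trans kab; rewrite ltr_pM2l //.
  by move: vI; rewrite ltr_norml; lra.
have -> : line_transform f k (u +i* v) a T' T - line_transform f k (u +i* v) b T' T =
    J u (k * (y0 - v)) T' T.
  rewrite -[- line_transform _ _ _ b _ _]mulN1r /line_transform -cintZ // -cintD //; last exact: cintbleZ.
  by apply: eq_cint => s _; rewrite skernel_lower ?gt_eqF // skernel_upper ?gt_eqF //; ring.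
by congr (normc _ <= _); ring.
Qed.

Lemma tker_mass_ge u t (T' T : R) : T' <= T -> `|t| <= 4^-1 ->
  2^-1 * \int[mu]_(s in `[T', T]) sechk k (s - u) <= normc (I u t T' T).
Proof.
move=> TT ht; have [_ Im_int] := cintble_tker u T' T ht.
have Ki : mu.-integrable `[T', T] (EFin \o (fun s => sechk k (s - u))).
  have := @integrableS _ _ _ mu setT `[T', T] _ _ _ _ (integrable_sechk u k0); exact.
apply: le_trans (normIm_le _); apply: le_trans (ler_norm _).
rewrite -RintegralZl //; apply: le_Rintegral => //; first exact: integrable_EFinZ.
by move=> s _; apply: Im_tker_ge.
Qed.

Lemma tker0_mass u (T' T : R) : T' <= T ->
  \int[mu]_(s in `[T', T]) sechk k (s - u) <= normc (I u 0 T' T).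
Proof.
move=> TT; apply: le_trans (normIm_le _); apply: le_trans (ler_norm _).
by rewrite le_eqVlt; apply/orP; left; apply/eqP; apply: eq_Rintegral => s _; rewrite Im_tker0.
Qed.

Lemma edge_integral_le u (T' T : R) (g : R -> R[i]) (C : R) : 0 <= C -> cintble g T' T ->
  (forall s, normc (g s) <= C * (edges f k y0 s * sechk k (s - u))) ->
  normc (cint g T' T) <= C * edge_mean u.
Proof.
move=> C0 gi gle.
have Ki : mu.-integrable `[T', T] (EFin \o (fun s => edges f k y0 s * sechk k (s - u))).
  have := @integrableS _ _ _ mu setT `[T', T] _ _ _ _ (Hi u); exact.
apply: (le_trans (normc_cint_le gi)).
apply: (@le_trans _ _ (C * \int[mu]_(s in `[T', T]) (edges f k y0 s * sechk k (s - u)))).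
  rewrite -RintegralZl //; apply: le_Rintegral => //; first exact: integrable_normc.
  exact: integrable_EFinZ.
rewrite ler_wpM2l //; apply: ge0_Rintegral_subset => //.
by move=> s _; rewrite mulr_ge0 ?addr_ge0 ?normc_ge0 // ltW // sechk_gt0.
Qed.

Lemma edges_ge s : normc (f (s +i* a) + f (s +i* b)) <= edges f k y0 s.
Proof. exact: le_normcD. Qed.

Lemma sechk_int_le u (T' T : R) : \int[mu]_(s in `[T', T]) sechk k (s - u) <= pi / k.
Proof.
rewrite -(sechk_Rintegral u k0); apply: ge0_Rintegral_subset => //.
  exact: integrable_sechk.
by move=> s _; rewrite ltW // sechk_gt0.
Qed.

(** Both truncation errors are made small at the same time. *)
Lemma strip_exhaustion u (L e : R) : 0 < e -> exists T' T : R,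
  [/\ T' < u < T, pi / k - e <= \int[mu]_(s in `[T', T]) sechk k (s - u) &
   forall v, normc (f (u +i* v)) <= L ->
   side_error f k (u +i* v) a b T <= e /\ side_error f k (u +i* v) a b T' <= e].
Proof.
move=> e0; have [C HC] := Hv.
have [N1 H1] := sechk_tail u k0 e0.
have [N2 H2] := sinhR_large u (C + L * (b - a)) k0 e0.
pose N := `|N1| + `|N2| + `|u| + 1.
have [T' [T [hT' hT cT' cT]]] := HC N.
have n1 := ler_norm N1; have n2 := ler_norm N2; have n3 := ler_norm u.
have n4 := ler_norm (- u); rewrite normrN in n4.
have p1 := normr_ge0 N1; have p2 := normr_ge0 N2.
have ba : 0 <= b - a by rewrite /a /b; have := r0; lra.
have uI : T' < u < T by rewrite /N in hT hT'; apply/andP; split; lra.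
exists T', T; split => //; first by apply: H1; rewrite /N in hT hT'; lra.
move=> v vL.
have side t : N2 <= `|t - u| -> \int[mu]_(y in `[a, b]) normc (f (t +i* y)) <= C ->
    side_error f k (u +i* v) a b t <= e.
  move=> tN tC; apply: le_trans (H2 t tN); rewrite /side_error /=.
  rewrite ler_wpM2r ?invr_ge0 //; apply: lerD => //; exact: ler_wpM2r.
split; apply: side => //.
  by apply: le_trans (ler_norm _); rewrite /N in hT; lra.
by rewrite distrC; apply: le_trans (ler_norm _); rewrite /N in hT'; lra.
Qed.

Lemma le_small_error (X Y C : R) : 0 <= C -> (forall e, 0 < e -> X <= Y + C * e) -> X <= Y.
Proof.
move=> C0 H; apply/ler_addgt0Pr => e e0.
have C1 : 0 < C + 1 by rewrite ltr_wpDl.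
apply: (le_trans (H (e / (C + 1)) _)); first exact: divr_gt0.
rewrite lerD2l mulrA ler_pdivrMr // mulrC ler_pM2l // lerDl //.
Qed.

(** For t = 0 the kernel is i / cosh: its argument is constant, so the norm of its
   integral is the full mass pi / k, and the constant is the one that Jensen's
   inequality needs. *)
Theorem strip_centre u : 2 * (pi / k) * normc (f (u +i* y0)) <= edge_mean u.
Proof.
set F := normc _; have F0 : 0 <= F := normc_ge0 _.
apply: (@le_small_error _ _ (2 + 2 * F)); first by rewrite addr_ge0 // mulr_ge0.
move=> e e0; have [T' [T [uI mass err]]] := strip_exhaustion u F e0.
have h0 : `|y0 - y0| <= (4 * k)^-1 by rewrite subrr normr0 invr_ge0 mulr_ge0 // ltW.
have := strip_formula_angle h0 uI; rewrite subrr mulr0 => sf.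
have [e1 e2] := err y0 (lexx _).
have TT : T' <= T by move: uI => /andP[h /(lt_trans h)/ltW].
have m0 := tker0_mass u TT.
have z0 : `|0 : R| <= 4^-1 by rewrite normr0 invr_ge0.
have Jle : normc (J u 0 T' T) <= edge_mean u.
  rewrite -[leRHS]mul1r; apply: edge_integral_le => //; first exact: cintble_edge_tker.
  move=> s; rewrite mul1r normcM normc_tker0; apply: ler_wpM2r; last exact: edges_ge.
  by rewrite ltW // sechk_gt0.
have := le_normcD (2 * f (u +i* y0) * I u 0 T' T - J u 0 T' T) (J u 0 T' T).
rewrite subrK !normcM.
have -> : normc (2 : R[i]) = 2 by rewrite -[2 : R[i]](rmorph_nat (real_complex R)) normcR ger0_norm.
rewrite -/F => h.
have h2 : 2 * F * (pi / k - e) <= 2 * F * normc (I u 0 T' T).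
  by rewrite ler_wpM2l ?mulr_ge0 //; exact: le_trans m0.
lra.
Qed.

(** Off the centre the kernel has at least half of the mass and at most twice the
   size that it has at the centre. *)
Theorem strip_bound u v : `|v - y0| <= (4 * k)^-1 ->
  pi / k * normc (f (u +i* v)) <= 2 * edge_mean u.
Proof.
move=> hv; set F := normc _; have F0 : 0 <= F := normc_ge0 _.
apply: (@le_small_error _ _ (2 + F)); first by rewrite addr_ge0.
move=> e e0; have [T' [T [uI mass err]]] := strip_exhaustion u F e0.
have sf := strip_formula_angle hv uI; have ht := angle_small hv.
have [e1 e2] := err v (lexx _).
have TT : T' <= T by move: uI => /andP[h /(lt_trans h)/ltW].
set t := k * (y0 - v) in sf ht.
have m0 := tker_mass_ge u TT ht.
have Jle : normc (J u t T' T) <= 2 * edge_mean u.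
  apply: edge_integral_le => //; first exact: cintble_edge_tker.
  move=> s; rewrite normcM mulrCA; apply: ler_pM; rewrite ?normc_ge0 //; first exact: edges_ge.
  exact: tker_bound.
have := le_normcD (2 * f (u +i* v) * I u t T' T - J u t T' T) (J u t T' T).
rewrite subrK !normcM.
have -> : normc (2 : R[i]) = 2 by rewrite -[2 : R[i]](rmorph_nat (real_complex R)) normcR ger0_norm.
rewrite -/F => h.
have h2 : 2 * F * (2^-1 * (pi / k - e)) <= 2 * F * normc (I u t T' T).
  by rewrite ler_wpM2l ?mulr_ge0 //; apply: le_trans m0; rewrite ler_pM2l // invr_gt0.
lra.
Qed.

(** Subtract the formulas at v and v'.  Each kernel integral has Lipschitz constant
   8 k in v, and f at v' is bounded by [strip_bound]: 40 = 8 + 16 * 2. *)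
Theorem strip_lipschitz u v v' : `|v - y0| <= (4 * k)^-1 -> `|v' - y0| <= (4 * k)^-1 ->
  pi / k * normc (f (u +i* v) - f (u +i* v')) <= 40 * k * `|v - v'| * edge_mean u.
Proof.
move=> hv hv'; set F := f (u +i* v); set F' := f (u +i* v').
have S0 : 0 <= edge_mean u.
  apply: Rintegral_ge0 => s _; rewrite mulr_ge0 ?addr_ge0 ?normc_ge0 //.
  by rewrite ltW // sechk_gt0.
have D0 := normc_ge0 (F - F').
have FS := strip_bound u hv'; rewrite -/F' in FS.
apply: (@le_small_error _ _ (4 + normc (F - F'))); first by rewrite addr_ge0.
move=> e e0; have [T' [T [uI mass err]]] := strip_exhaustion u (Num.max (normc F) (normc F')) e0.
have sf := strip_formula_angle hv uI; have ht := angle_small hv.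
have sf' := strip_formula_angle hv' uI; have ht' := angle_small hv'.
have hF : normc F <= Num.max (normc F) (normc F') by rewrite le_max lexx.
have [e1 e2] := err v hF.
have hF' : normc F' <= Num.max (normc F) (normc F') by rewrite le_max lexx orbT.
have [e1' e2'] := err v' hF'.
have TT : T' <= T by move: uI => /andP[h /(lt_trans h)/ltW].
have tt : `|k * (y0 - v) - k * (y0 - v')| = k * `|v - v'|.
  have -> : k * (y0 - v) - k * (y0 - v') = - (k * (v - v')) by ring.
  by rewrite normrN normrM gtr0_norm.
rewrite -/F in sf; rewrite -/F' in sf'.
set t := k * (y0 - v) in sf ht tt; set t' := k * (y0 - v') in sf' ht' tt.
have m0 := tker_mass_ge u TT ht.
set d := k * `|v - v'| in tt.
have d0 : 0 <= d by rewrite mulr_ge0 // ltW.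
have Jle : normc (J u t T' T - J u t' T' T) <= (8 * d) * edge_mean u.
  rewrite -[- J u t' T' T]mulN1r /J -cintZ; last exact: cintble_edge_tker.
  rewrite -cintD; [|exact: cintble_edge_tker|by apply: cintbleZ; exact: cintble_edge_tker].
  apply: edge_integral_le; first by rewrite mulr_ge0.
    by apply: cintbleD; [|apply: cintbleZ]; exact: cintble_edge_tker.
  move=> s.
  have -> : (f (s +i* a) + f (s +i* b)) * tker t (k * (s - u)) +
     -1 * ((f (s +i* a) + f (s +i* b)) * tker t' (k * (s - u))) =
     (f (s +i* a) + f (s +i* b)) * (tker t (k * (s - u)) - tker t' (k * (s - u))) by ring.
  rewrite normcM mulrCA; apply: ler_pM; rewrite ?normc_ge0 //; first exact: edges_ge.
  by have := tker_lipschitz (k * (s - u)) ht ht'; rewrite tt.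
have Ile : normc (I u t T' T - I u t' T' T) <= (8 * d) * (pi / k).
  rewrite -[- I u t' T' T]mulN1r /I -cintZ; last exact: cintble_tker.
  have Di : cintble (fun s => tker t (k * (s - u)) + -1 * tker t' (k * (s - u))) T' T.
    by apply: cintbleD; [|apply: cintbleZ]; exact: cintble_tker.
  rewrite -cintD; [|exact: cintble_tker|by apply: cintbleZ; exact: cintble_tker].
  apply: (le_trans (normc_cint_le Di)).
  have Ki : mu.-integrable `[T', T] (EFin \o (fun s => sechk k (s - u))).
    have := @integrableS _ _ _ mu setT `[T', T] _ _ _ _ (integrable_sechk u k0); exact.
  apply: (@le_trans _ _ ((8 * d) * \int[mu]_(s in `[T', T]) sechk k (s - u))); last first.
    by apply: ler_wpM2l; [rewrite mulr_ge0|exact: sechk_int_le].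
  rewrite -RintegralZl //; apply: le_Rintegral => //; [exact: integrable_normc|exact: integrable_EFinZ|].
  move=> s _; rewrite mulN1r.
  by have := tker_lipschitz (k * (s - u)) ht ht'; rewrite tt.
have n2 : normc (2 : R[i]) = 2.
  by rewrite -[2 : R[i]](rmorph_nat (real_complex R)) normcR ger0_norm.
have E : 2 * (F - F') * I u t T' T =
    (2 * F * I u t T' T - J u t T' T) - (2 * F' * I u t' T' T - J u t' T' T)
    + ((J u t T' T - J u t' T' T) - 2 * F' * (I u t T' T - I u t' T' T)) by ring.
have := congr1 (@normc R) E; rewrite !normcM n2 => E'.
have h1 := le_normcD ((2 * F * I u t T' T - J u t T' T) - (2 * F' * I u t' T' T - J u t' T' T))
    ((J u t T' T - J u t' T' T) - 2 * F' * (I u t T' T - I u t' T' T)).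
rewrite -E' in h1.
have h2 := le_normcD (2 * F * I u t T' T - J u t T' T) (- (2 * F' * I u t' T' T - J u t' T' T)).
have h3 := le_normcD (J u t T' T - J u t' T' T) (- (2 * F' * (I u t T' T - I u t' T' T))).
rewrite normcN in h2; rewrite normcN !normcM n2 in h3.
have h4 : 2 * normc F' * normc (I u t T' T - I u t' T' T) <= 2 * normc F' * (8 * d * (pi / k)).
  by rewrite ler_wpM2l ?mulr_ge0 ?normc_ge0.
have h5 : 2 * normc F' * (8 * d * (pi / k)) <= 32 * d * edge_mean u.
  have -> : 2 * normc F' * (8 * d * (pi / k)) = 16 * d * (pi / k * normc F') by ring.
  have -> : 32 * d * edge_mean u = 16 * d * (2 * edge_mean u) by ring.
  by rewrite ler_wpM2l // mulr_ge0.
have h6 : 2 * normc (F - F') * (2^-1 * (pi / k - e)) <= 2 * normc (F - F') * normc (I u t T' T).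
  by rewrite ler_wpM2l ?mulr_ge0 //; apply: le_trans m0; rewrite ler_pM2l // invr_gt0.
have -> : 40 * k * `|v - v'| * edge_mean u = 40 * d * edge_mean u by rewrite /d; ring.
clear - h1 h2 h3 h4 h5 h6 sf sf' e1 e2 e1' e2' Jle; lra.
Qed.

End StripInequalities.

(** * Joint measurability *)

Section Caratheodory.
Context {R : realType} {d : measure_display} {T : measurableType d}.

(** Approximate the first variable from below by multiples of 1/(n+1). *)
Lemma measurable_fun_caratheodory (F : R -> T -> R) :
  (forall x, measurable_fun setT (F x)) -> (forall t, continuous (F ^~ t)) ->
  measurable_fun setT (fun z : measurableTypeR R * T => F z.1 z.2).
Proof.
move=> mF cF; pose c n : R := n.+1%:R.
have c0 n : 0 < c n by rewrite ltr0n.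
pose q n (x : R) : R := (Num.floor (x * c n))%:~R / c n.
apply: (@measurable_fun_cvg _ _ _ _ (fun n z => F (q n z.1) z.2)); last first.
  move=> [x t] _ /=.
  apply: (@cvg_comp _ _ _ (q ^~ x) (F ^~ t)); last exact: cF.
  apply/cvgrPdist_le => e e0; near=> n.
  have /andP[f1 f2] := Num.Theory.floor_itv (x * c n).
  have -> : x - q n x = (x * c n - (Num.floor (x * c n))%:~R) / c n.
    by rewrite /q; field; rewrite gt_eqF.
  rewrite ger0_norm; last by rewrite divr_ge0 ?subr_ge0 // ltW.
  rewrite ler_pdivrMr //; apply: (@le_trans _ _ 1).
    by move: f2; rewrite intrD; lra.
  rewrite -ler_pdivrMl // mulr1 ltW //; near: n.
  exists (Num.truncn e^-1) => // m /= hm.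
  by rewrite (lt_le_trans (truncnS_gt _)) // ler_nat ltnS.
move=> n _ B mB; rewrite setTI.
have -> : (fun z : measurableTypeR R * T => F (q n z.1) z.2) @^-1` B =
    \bigcup_(j : int) (`[j%:~R / c n, (j + 1)%:~R / c n[ `*` (F (j%:~R / c n) @^-1` B)).
  apply/seteqP; split => [[x t] /= Bx|[x t] [j _ [/= xj Bj]]].
    exists (Num.floor (x * c n)) => //; split => //=.
    by rewrite in_itv /= ler_pdivrMr // ltr_pdivlMr // Num.Theory.floor_itv.
  have -> // : q n x = j%:~R / c n.
  rewrite /q; congr (_%:~R / _); apply: Num.Theory.floor_def.
  by move: xj; rewrite in_itv /= ler_pdivrMr // ltr_pdivlMr.
apply: countable_bigcupT_measurable; first exact: countableP.
move=> j; apply: measurableX; first exact: measurable_itv.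
by rewrite -[X in measurable X]setTI; exact: mF.
Unshelve. all: end_near. Qed.

End Caratheodory.

(** * Local Hardy classes *)

(** Otherwise the integral over this interval alone would exceed K. *)
Lemma small_value {R : realType} (Phi : R -> \bar R) (K c : R) :
  measurable_fun setT Phi -> (forall x, 0 <= Phi x)%E ->
  (\int[@lebesgue_measure R]_x Phi x <= K%:E)%E ->
  exists2 x : R, c <= x <= c + `|K| + 1 & (Phi x <= 1)%E.
Proof.
move=> mPhi Phi0 PhiK; apply: contrapT => H.
have {}H x : c <= x <= c + `|K| + 1 -> (1 <= Phi x)%E.
  by move=> xI; rewrite leNgt; apply/negP => /ltW h; apply: H; exists x.
have cK : c <= c + `|K| + 1 by rewrite -addrA lerDl addr_ge0.
have : ((`|K| + 1)%:E <= K%:E)%E.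
  apply: le_trans PhiK.
  apply: (@le_trans _ _ (\int[@lebesgue_measure R]_(x in `[c, (c + `|K| + 1)%R]) Phi x)%E).
    have -> : (`|K| + 1)%:E = (\int[@lebesgue_measure R]_(x in `[c, (c + `|K| + 1)%R]) (cst 1 x))%E.
      rewrite integral_cst // mul1e; have := lebesgue_itvcc cK; move=> /= ->.
      by congr (_%:E); ring.
    by apply: ge0_le_integral => //; exact: measurable_funTS.
  by apply: ge0_subset_integral.
by rewrite lee_fin leNgt => /negP; apply; rewrite (le_lt_trans (ler_norm K)) // ltrDl.
Qed.

Section LocallyHardy.
Context {R : realType}.
Notation mu := (@lebesgue_measure R).
Implicit Types (f : R[i] -> R[i]) (p a b x y : R).

(** Unlike the Hardy class itself, this class is stable under multiplication by
   exp (i t z) for every real t. *)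
Definition locally_hardy p f := holomorphic_upper f /\
  forall a b, 0 < a -> exists C : R, forall y, a <= y <= b -> (hardy_mean p f y <= C%:E)%E.

Lemma hardy_locally_hardy p f : hardy p f -> locally_hardy p f.
Proof.
move=> [hf Mf]; split => // a b a0.
have nn (y : R) : (0 <= hardy_mean p f y)%E.
  by apply: integral_ge0 => x _; rewrite lee_fin powR_ge0.
set s := ereal_sup _ in Mf.
have sub y : 0 < y -> (hardy_mean p f y <= s)%E.
  by move=> y0; apply: ereal_sup_ubound; exists y => //=; rewrite in_itv /= andbT.
have s0 : (0 <= s)%E by apply: le_trans (sub 1 ltr01).
exists (fine s) => y /andP[ay _]; rewrite fineK; last by rewrite ge0_fin_numE.
by apply: sub; exact: lt_le_trans ay.
Qed.

Lemma holomorphic_cderivable f x y : holomorphic_upper f -> 0 < y -> cderivable f (x +i* y).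
Proof. by move=> hf y0; apply/derivable_cderiv; exact: hf. Qed.

Lemma continuous_normc (g : R -> R[i]) (x : R) :
  {for x, continuous (fun u => complex.Re (g u))} ->
  {for x, continuous (fun u => complex.Im (g u))} ->
  {for x, continuous (fun u => normc (g u))}.
Proof.
move=> cr ci.
have -> : (fun u => normc (g u)) =
   (fun u => Num.sqrt (complex.Re (g u) ^+ 2 + complex.Im (g u) ^+ 2)).
  by apply/funext => u; case: (g u).
apply: (@continuous_comp _ _ _ (fun u => complex.Re (g u) ^+ 2 + complex.Im (g u) ^+ 2) Num.sqrt).
  by apply: cvgD; rewrite !expr2; [apply: cvgM|apply: cvgM].
exact: sqrt_continuous.
Qed.

Lemma continuous_normc_horizontal f y : (forall x, cderivable f (x +i* y)) ->
  continuous (fun x => normc (f (x +i* y))).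
Proof.
move=> H x; have [l Hl] := H x.
have [|cr ci] := @cderiv_continuous_line _ f 1 (fun x => x +i* y) x l _ Hl.
  by move=> t; apply: eqcP => /=; ring.
exact: continuous_normc.
Qed.

Lemma continuous_normc_vertical f x y : cderivable f (x +i* y) ->
  {for y, continuous (fun y => normc (f (x +i* y)))}.
Proof.
move=> [l Hl].
have [|cr ci] := @cderiv_continuous_line _ f 'i (fun y => x +i* y) y l _ Hl.
  by move=> t; apply: eqcP => /=; ring.
exact: continuous_normc.
Qed.

Section FixedFunction.
Variables (p : R) (f : R[i] -> R[i]).
Hypothesis p1 : 1 < p.
Hypothesis hf : locally_hardy p f.
Let p0 : 0 < p. Proof. exact: lt_trans p1. Qed.
Let fd x y : 0 < y -> cderivable f (x +i* y).
Proof. by move=> y0; apply: holomorphic_cderivable => //; case: hf. Qed.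

Lemma measurable_normc_line y : 0 < y -> measurable_fun setT (fun x => normc (f (x +i* y))).
Proof.
move=> y0; apply: continuous_measurable_fun; apply: continuous_normc_horizontal => x.
exact: fd.
Qed.

Lemma measurable_pow_line y : 0 < y -> measurable_fun setT (fun x => normc (f (x +i* y)) `^ p).
Proof. by move=> /measurable_normc_line h; exact: (measurableT_comp (measurable_powR p) h). Qed.

Lemma integrable_pow_line y : 0 < y ->
  mu.-integrable setT (EFin \o (fun x => normc (f (x +i* y)) `^ p)).
Proof.
move=> y0; apply/integrableP; split.
  by apply/measurable_EFinP; exact: measurable_pow_line.
under eq_integral do rewrite /= ger0_norm ?powR_ge0 //.
have [C HC] := hf.2 y y y0.
by apply: (le_lt_trans (HC y _)); rewrite ?lexx ?ltry.
Qed.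

Definition hmean y := \int[mu]_x (normc (f (x +i* y)) `^ p).

Lemma hmeanE y : 0 < y -> hardy_mean p f y = (hmean y)%:E.
Proof.
move=> y0; rewrite /hmean /Rintegral fineK //.
exact: integrable_fin_num (integrable_pow_line y0).
Qed.

Lemma le_1Dpow (t : R) : 0 <= t -> t <= 1 + t `^ p.
Proof.
move=> t0; have [t1|t1] := leP t 1; first by rewrite (le_trans t1) // lerDl powR_ge0.
by apply: (@le_trans _ _ (t `^ p)); [exact: le1r_powR (ltW t1) (ltW p1)|rewrite lerDr].
Qed.

Lemma integrable_normc_sech k u y : 0 < k -> 0 < y ->
  mu.-integrable setT (EFin \o (fun s => normc (f (s +i* y)) * sechk k (s - u))).
Proof.
move=> k0 y0.
apply: (@le_integrable _ _ _ mu setT _ _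
  (EFin \o (fun s => sechk k (s - u) + normc (f (s +i* y)) `^ p))) => //.
- apply/measurable_EFinP; apply: measurable_funM; first exact: measurable_normc_line.
  by apply: continuous_measurable_fun; exact: continuous_sechk.
- move=> s _ /=; rewrite lee_fin.
  have K0 := sechk_gt0 k (s - u); have K1 := sechk_le1 k (s - u).
  rewrite ger0_norm ?mulr_ge0 ?normc_ge0 ?(ltW K0) // ger0_norm ?addr_ge0 ?powR_ge0 ?(ltW K0) //.
  apply: (@le_trans _ _ ((1 + normc (f (s +i* y)) `^ p) * sechk k (s - u))).
    by rewrite ler_wpM2r ?(ltW K0) // le_1Dpow // normc_ge0.
  by rewrite mulrDl mul1r lerD2l ler_piMr // powR_ge0.
- by apply: integrable_EFinD => //; [exact: integrable_sechk|exact: integrable_pow_line].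
Qed.

Lemma integrable_pow_sech k u y : 0 < k -> 0 < y ->
  mu.-integrable setT (EFin \o (fun s => normc (f (s +i* y)) `^ p * sechk k (s - u))).
Proof.
move=> k0 y0.
apply: (@le_integrable _ _ _ mu setT _ _
  (EFin \o (fun s => normc (f (s +i* y)) `^ p))) => //.
- apply/measurable_EFinP; apply: measurable_funM; first exact: measurable_pow_line.
  by apply: continuous_measurable_fun; exact: continuous_sechk.
- move=> s _ /=; rewrite lee_fin.
  have K0 := sechk_gt0 k (s - u); have K1 := sechk_le1 k (s - u).
  rewrite ger0_norm ?mulr_ge0 ?powR_ge0 ?(ltW K0) // ger0_norm ?powR_ge0 //.
  by rewrite ler_piMr // powR_ge0.
- exact: integrable_pow_line.
Qed.

(** By Tonelli the integrals of |f|^p over vertical segments are integrable in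
   the abscissa, so they are at most 1 for arbitrarily large abscissas. *)
Lemma locally_hardy_vertical_bounded a b : 0 < a -> a < b -> vertical_bounded f a b.
Proof.
move=> a0 ab.
pose G (x y : R) : R := if a <= y <= b then normc (f (x +i* y)) else 0.
pose F (x y : R) : R := G x y `^ p.
have F0 x y : 0 <= F x y by exact: powR_ge0.
have mab : measurable (`[a, b] : set (measurableTypeR R)) by exact: measurable_itv.
have mN x : measurable_fun (`[a, b] : set (measurableTypeR R)) (fun y => normc (f (x +i* y))).
  apply: subspace_continuous_measurable_fun => //.
  apply: continuous_in_subspaceT => y /set_mem /=; rewrite in_itv /= => /andP[ay _].
  by apply: continuous_normc_vertical; apply: fd; exact: lt_le_trans ay.
have GE x : G x = (fun y => normc (f (x +i* y))) \_ `[a, b].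
  by apply/funext => y; rewrite patchE /G mem_setE in_itv.
have mG : measurable_fun setT (fun z : measurableTypeR R * measurableTypeR R => G z.1 z.2).
  apply: (@measurable_fun_caratheodory R _ (measurableTypeR R) G).
    by move=> x; rewrite GE; exact: ((measurable_restrictT _ mab).1 (mN x)).
  move=> y; rewrite /G; have [/andP[ay yb]|yI] := boolP (a <= y <= b).
    apply: continuous_normc_horizontal => x.
    by apply: fd; exact: lt_le_trans ay.
  by move=> x; exact: cst_continuous.
have mF : measurable_fun setT
    (fun z : measurableTypeR R * measurableTypeR R => (F z.1 z.2)%:E).
  by apply/measurable_EFinP; exact: (measurableT_comp (measurable_powR p) mG).
have [C HC] := hf.2 a b a0.
pose Phi (x : R) := (\int[mu]_y (F x y)%:E)%E.
have F0' (z : measurableTypeR R * measurableTypeR R) : (0 <= (F z.1 z.2)%:E)%E.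
  by rewrite lee_fin.
have mPhi : measurable_fun setT Phi.
  exact: (@measurable_fun_fubini_tonelli_F _ _ _ _ R mu _ mF F0').
have PhiI : (\int[mu]_x Phi x <= (C * (b - a))%:E)%E.
  rewrite (@fubini_tonelli _ _ _ _ R mu mu _ mF F0') /=.
  apply: (@le_trans _ _ (\int[mu]_(y in `[a, b]) (cst C%:E) y)%E); last first.
    rewrite integral_cst //= EFinM; have := lebesgue_itvcc (ltW ab); move=> /= ->.
    exact: lexx.
  rewrite [leRHS]integral_mkcond; apply: (@ge0_le_integral _ _ _ mu setT measurableT).
  - by move=> y _; apply: integral_ge0 => x _; rewrite lee_fin.
  - exact: (@measurable_fun_fubini_tonelli_G _ _ _ _ R mu _ mF F0').
  - by apply: ((measurable_restrictT _ mab).1 _); exact: measurable_cst.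
  move=> y _; rewrite patchE mem_setE in_itv /= /F /G.
  case: ifP => [yI|_]; first exact: HC.
  by under eq_integral do rewrite powR0 ?gt_eqF //; rewrite integral0.
have PhiE x : Phi x = (\int[mu]_(y in `[a, b]) (normc (f (x +i* y)) `^ p)%:E)%E.
  rewrite /Phi [RHS]integral_mkcond; apply: eq_integral => y _.
  by rewrite patchE mem_setE in_itv /= /F /G; case: ifP => // _; rewrite powR0 ?gt_eqF.
have Phi0 x : (0 <= Phi x)%E by apply: integral_ge0 => y _; rewrite lee_fin.
have small x : (Phi x <= 1)%E ->
    \int[mu]_(y in `[a, b]) normc (f (x +i* y)) <= (b - a) + 1.
  move=> Phi1.
  have ip : mu.-integrable `[a, b] (EFin \o (fun y => normc (f (x +i* y)) `^ p)).
    apply/integrableP; split.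
      by apply/measurable_EFinP; exact: (measurableT_comp (measurable_powR p) (mN x)).
    under eq_integral do rewrite /= ger0_norm ?powR_ge0 //.
    by rewrite -PhiE (le_lt_trans Phi1) // ltry.
  have -> : b - a = \int[mu]_(y in `[a, b]) (1 : R) by rewrite Rintegral_cst_itv ?mul1r // ltW.
  apply: (@le_trans _ _ (\int[mu]_(y in `[a, b]) (1 : R) +
      \int[mu]_(y in `[a, b]) normc (f (x +i* y)) `^ p)); last first.
    have fin : Phi x \is a fin_num by rewrite ge0_fin_numE // (le_lt_trans Phi1) // ltry.
    by rewrite lerD2l /Rintegral -PhiE -[1]/(fine 1%:E); exact: fine_le.
  have i1 := @integrable_cst_itv R 1 a b.
  rewrite -RintegralD //; apply: le_Rintegral => //.
  - apply: integrable_normc; apply: cintble_vertical => y /andP[ay _].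
    by apply: fd; exact: lt_le_trans ay.
  - exact: integrable_EFinD.
  - by move=> y _; apply: le_1Dpow; exact: normc_ge0.
exists ((b - a) + 1) => N.
have [T' T'I P1] := small_value (- N - `|C * (b - a)| - 1) mPhi Phi0 PhiI.
have [T TI P2] := small_value N mPhi Phi0 PhiI.
have E : - N - `|C * (b - a)| - 1 + `|C * (b - a)| + 1 = - N by ring.
move: T'I; rewrite E => /andP[_ T'N]; case/andP: TI => NT _.
by exists T', T; split; [exact: T'N|exact: NT|exact: small P1|exact: small P2].
Qed.

End FixedFunction.
End LocallyHardy.

(** * Jensen's inequality for powers and its defect *)

Section PowerGap.
Context {R : realType}.
Implicit Types (p t m : R).

(** The amount by which the convex function t^p exceeds its tangent at m. *)
Definition pgap p m t := t `^ p - m `^ p - p * m `^ (p - 1) * (t - m).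

Lemma pgap_gt0 p m t : 1 < p -> 0 <= m -> 0 <= t -> t != m -> 0 < pgap p m t.
Proof.
move=> p1; have p0 : 0 < p by exact: lt_trans p1.
have q0 : p - 1 != 0 by rewrite subr_eq0 gt_eqF.
rewrite /pgap [0 <= m]le_eqVlt => /orP[/eqP <-|m0].
  move=> t0 tm; rewrite (powR0 (lt0r_neq0 p0)) (powR0 q0) mulr0 mul0r !subr0 powR_gt0 //.
  by rewrite lt_neqAle eq_sym tm.
rewrite le_eqVlt => /orP[/eqP <-|t0] tm.
  rewrite powR0 ?gt_eqF // !sub0r mulrN opprK -mulrA [_ * m]mulrC.
  rewrite mulr_powRB1 ?(ltW m0) //.
  have -> : - m `^ p + p * m `^ p = (p - 1) * m `^ p by ring.
  by rewrite mulr_gt0 ?powR_gt0 // subr_gt0.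
pose l := ln t - ln m.
have l0 : l != 0.
  by rewrite subr_eq0; apply: contra_neq tm => /ln_inj -> //; rewrite posrE.
have tE : t = m * expR l by rewrite /l expRB !lnK ?posrE //; field; rewrite gt_eqF.
have e1 := @expR_gt1Dx R ((p - 1) * l) (mulf_neq0 q0 l0).
have e2 := @expR_gt1Dx R (- l); rewrite oppr_eq0 in e2; have {}e2 := e2 l0.
have E0 := expR_gt0 l.
have -> : t `^ p - m `^ p - p * m `^ (p - 1) * (t - m) =
    m `^ p * (expR l * (expR ((p - 1) * l) + (p - 1) * expR (- l) - p)).
  rewrite tE powRM ?(ltW m0) ?(ltW E0) //.
  have -> : expR l `^ p = expR l * expR ((p - 1) * l).
    by rewrite -expRM -expRD; congr expR; ring.
  have -> : p * m `^ (p - 1) * (m * expR l - m) = p * (m * m `^ (p - 1)) * (expR l - 1) by ring.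
  rewrite mulr_powRB1 ?(ltW m0) //.
  have h : expR l * expR (- l) = 1 by exact: expRxMexpNx_1.
  have -> : expR l * (expR ((p - 1) * l) + (p - 1) * expR (- l) - p) =
    expR l * expR ((p - 1) * l) + (p - 1) * (expR l * expR (- l)) - p * expR l by ring.
  by rewrite h; ring.
rewrite mulr_gt0 ?powR_gt0 // mulr_gt0 // subr_gt0.
have h : (p - 1) * (1 + - l) < (p - 1) * expR (- l) by rewrite ltr_pM2l ?subr_gt0.
by clear -e1 h; lra.
Qed.

Lemma pgap_ge0 p m t : 1 < p -> 0 <= m -> 0 <= t -> 0 <= pgap p m t.
Proof.
move=> p1 m0 t0; have [->|tm] := eqVneq t m; first by rewrite /pgap !subrr mulr0 subr0.
by rewrite ltW // pgap_gt0.
Qed.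

Lemma powR_lipschitz p (B s t : R) : 1 < p -> 0 <= s <= B -> 0 <= t <= B ->
  `|s `^ p - t `^ p| <= p * B `^ (p - 1) * `|s - t|.
Proof.
move=> p1; wlog ts : s t / t <= s => [H sI tI|/andP[s0 sB] /andP[t0 tB]].
  have [|/ltW] := leP t s; first by move=> ?; exact: H.
  by move=> ?; rewrite distrC [`|s - t|]distrC; exact: H.
have p0 : 0 < p by exact: lt_trans p1.
have := pgap_ge0 p1 s0 t0; rewrite /pgap.
have mono : t `^ p <= s `^ p by apply: (ge0_ler_powR (ltW p0)) => //; rewrite nnegrE.
rewrite !ger0_norm ?subr_ge0 // => h.
have h2 : s `^ (p - 1) <= B `^ (p - 1).
  by apply: ge0_ler_powR; rewrite ?nnegrE ?subr_ge0 ?(ltW p1) // (le_trans s0).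
have h3 : p * s `^ (p - 1) * (s - t) <= p * B `^ (p - 1) * (s - t).
  by rewrite ler_wpM2r ?subr_ge0 // ler_pM2l.
by clear -h h3; lra.
Qed.

End PowerGap.

Section Jensen.
Context d (T : measurableType d) (R : realType) (mu : {measure set T -> \bar R}).

Lemma Rintegral_ge0_eq0_ae (g : T -> R) : (forall x, 0 <= g x) ->
  mu.-integrable setT (EFin \o g) -> \int[mu]_x g x = 0 -> \forall x \ae mu, g x = 0.
Proof.
move=> g0 gi gI; have mg : measurable_fun setT (EFin \o g) by move/integrableP : gi => [].
have /(ae_eq_integral_abs mu measurableT mg) : (\int[mu]_x `|(EFin \o g) x| = 0)%E.
  under eq_integral do rewrite /= ger0_norm //.
  by rewrite -[LHS]fineK ?[fine _]gI //; exact: integrable_fin_num gi.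
by apply: filterS => x /(_ I) /= [].
Qed.

Variables (p : R) (g1 g2 K : T -> R) (A : R).
Hypothesis p1 : 1 < p.
Hypothesis A0 : 0 < A.
Hypothesis iK : mu.-integrable setT (EFin \o K).
Hypothesis i1 : mu.-integrable setT (EFin \o (fun s => g1 s * K s)).
Hypothesis i2 : mu.-integrable setT (EFin \o (fun s => g2 s * K s)).
Hypothesis j1 : mu.-integrable setT (EFin \o (fun s => g1 s `^ p * K s)).
Hypothesis j2 : mu.-integrable setT (EFin \o (fun s => g2 s `^ p * K s)).
Hypothesis KA : \int[mu]_s K s = A.

Let m := (\int[mu]_s ((g1 s + g2 s) * K s)) / (2 * A).

Lemma integrable_jensen_gap :
  mu.-integrable setT (EFin \o (fun s => (pgap p m (g1 s) + pgap p m (g2 s)) * K s)).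
Proof.
have -> : (fun s => (pgap p m (g1 s) + pgap p m (g2 s)) * K s) =
  (fun s => (g1 s `^ p * K s + g2 s `^ p * K s) -
     ((p * m `^ (p - 1)) * (g1 s * K s + g2 s * K s) +
      (2 * (m `^ p - p * m `^ (p - 1) * m)) * K s)).
  by apply/funext => s; rewrite /pgap; ring.
by apply: integrable_EFinB => //; apply: integrable_EFinD => //; apply: integrable_EFinZ => //; exact: integrable_EFinD.
Qed.

(** As m is the weighted mean of g1 and g2, the linear terms of the tangent at m
   cancel.  In this form Jensen's inequality comes with its equality case. *)
Lemma jensen_gap : 0 <= m ->
  \int[mu]_s ((pgap p m (g1 s) + pgap p m (g2 s)) * K s) =
  \int[mu]_s ((g1 s `^ p + g2 s `^ p) * K s) - 2 * A * m `^ p.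
Proof.
move=> m0; have p0 : 0 < p by exact: lt_trans p1.
have -> : (fun s => (pgap p m (g1 s) + pgap p m (g2 s)) * K s) =
  (fun s => (g1 s `^ p * K s + g2 s `^ p * K s) -
     ((p * m `^ (p - 1)) * (g1 s * K s + g2 s * K s) +
      (2 * (m `^ p - p * m `^ (p - 1) * m)) * K s)).
  by apply/funext => s; rewrite /pgap; ring.
have ij : mu.-integrable setT (EFin \o (fun s => g1 s `^ p * K s + g2 s `^ p * K s)) by exact: integrable_EFinD.
have ii : mu.-integrable setT (EFin \o (fun s => g1 s * K s + g2 s * K s)) by exact: integrable_EFinD.
have e1 : \int[mu]_s ((g1 s `^ p + g2 s `^ p) * K s) =
    \int[mu]_s (g1 s `^ p * K s + g2 s `^ p * K s).
  by apply: eq_Rintegral => s _; rewrite mulrDl.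
have e2 : \int[mu]_s (g1 s * K s + g2 s * K s) = 2 * A * m.
  transitivity (\int[mu]_s ((g1 s + g2 s) * K s)).
    by apply: eq_Rintegral => s _; rewrite mulrDl.
  by rewrite /m; field; rewrite gt_eqF.
rewrite RintegralB //; last by apply: integrable_EFinD => //; exact: integrable_EFinZ.
rewrite -e1 RintegralD //; [|exact: integrable_EFinZ|exact: integrable_EFinZ].
rewrite !RintegralZl // KA e2.
have -> : p * m `^ (p - 1) * (2 * A * m) = 2 * A * p * (m * m `^ (p - 1)) by ring.
have -> : 2 * (m `^ p - p * m `^ (p - 1) * m) * A =
  2 * A * m `^ p - 2 * A * p * (m * m `^ (p - 1)) by ring.
ring.
Qed.

End Jensen.

(** * Midpoint convexity of the means *)

Lemma lebesgue_measure_setT (R : realType) : @lebesgue_measure R setT = +oo%E.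
Proof. by have := @lebesgue_measure_itv R `]-oo, +oo[%R; rewrite set_itvNyy /= => ->. Qed.

Section MeanConvexity.
Context {R : realType}.
Notation mu := (@lebesgue_measure R).
Variables (p : R) (f : R[i] -> R[i]) (k y0 : R).
Hypothesis p1 : 1 < p.
Hypothesis hf : locally_hardy p f.
Hypothesis k0 : 0 < k.
Let r := pi / (2 * k).
Hypothesis ry : r < y0.
Let a := y0 - r.
Let b := y0 + r.
Let p0 : 0 < p. Proof. exact: lt_trans p1. Qed.
Let r0 : 0 < r. Proof. by rewrite divr_gt0 ?pi_gt0 // mulr_gt0. Qed.
Let a0 : 0 < a. Proof. by rewrite subr_gt0. Qed.
Let b0 : 0 < b. Proof. by rewrite addr_gt0 // (lt_trans r0). Qed.
Let y00 : 0 < y0. Proof. exact: lt_trans ry. Qed.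
Let A : R := pi / k.
Let A0 : 0 < A. Proof. by rewrite divr_gt0 // pi_gt0. Qed.
Let A2 : 0 < 2 * A. Proof. by apply: mulr_gt0 => //; exact: A0. Qed.
Let fa s := normc (f (s +i* a)).
Let fb s := normc (f (s +i* b)).

Let Hf x y : a <= y <= b -> cderivable f (x +i* y).
Proof.
by move=> /andP[ay _]; apply: holomorphic_cderivable; [case: hf|exact: lt_le_trans ay].
Qed.

Let Hv : vertical_bounded f a b.
Proof. by apply: (locally_hardy_vertical_bounded p1 hf); rewrite // /a /b; have := r0; lra. Qed.

Let Hi u : mu.-integrable setT (EFin \o (fun s => edges f k y0 s * sechk k (s - u))).
Proof.
have -> : (fun s => edges f k y0 s * sechk k (s - u)) =
    (fun s => fa s * sechk k (s - u) + fb s * sechk k (s - u)).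
  by apply/funext => s; rewrite /edges mulrDl.
by apply: integrable_EFinD => //; apply: (integrable_normc_sech p1 hf).
Qed.

Definition edge_average u := edge_mean f k y0 u / (2 * (pi / k)).
Definition edge_power_mean u :=
  \int[mu]_s ((normc (f (s +i* (y0 - pi / (2 * k)))) `^ p +
               normc (f (s +i* (y0 + pi / (2 * k)))) `^ p) * sechk k (s - u)).

Lemma edge_average_ge0 u : 0 <= edge_average u.
Proof.
apply: divr_ge0; last by apply: mulr_ge0 => //; exact: ltW A0.
rewrite /edge_mean; apply: Rintegral_ge0 => s _.
by rewrite mulr_ge0 ?addr_ge0 ?normc_ge0 // ltW // sechk_gt0.
Qed.

Lemma normc_le_edge_average u : normc (f (u +i* y0)) <= edge_average u.
Proof.
rewrite /edge_average ler_pdivlMr; last by apply: mulr_gt0 => //; exact: A0.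
rewrite mulrC; exact: strip_centre k0 Hf Hv Hi u.
Qed.

Lemma edge_power_gap u :
  \int[mu]_s ((pgap p (edge_average u) (fa s) + pgap p (edge_average u) (fb s)) * sechk k (s - u))
  = edge_power_mean u - 2 * A * edge_average u `^ p.
Proof.
rewrite /edge_power_mean -/r -/a -/b.
apply: (jensen_gap p1 A0 (integrable_sechk u k0)).
- exact: (integrable_normc_sech p1 hf).
- exact: (integrable_normc_sech p1 hf).
- exact: (integrable_pow_sech hf).
- exact: (integrable_pow_sech hf).
- exact: sechk_Rintegral.
- exact: edge_average_ge0.
Qed.

Lemma edge_average_pow_le u : 2 * A * edge_average u `^ p <= edge_power_mean u.
Proof.
rewrite -subr_ge0 -edge_power_gap; apply: Rintegral_ge0 => s _.
apply: mulr_ge0; last exact: ltW (sechk_gt0 _ _).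
by apply: addr_ge0; apply: pgap_ge0 => //; first [exact: normc_ge0|exact: edge_average_ge0].
Qed.

Lemma normc_pow_le u : 2 * A * normc (f (u +i* y0)) `^ p <= edge_power_mean u.
Proof.
apply: le_trans (edge_average_pow_le u); rewrite (ler_pM2l A2).
by apply: ge0_ler_powR (normc_le_edge_average u); rewrite ?nnegrE ?normc_ge0 ?edge_average_ge0 ?(ltW p0) //.
Qed.

Let g s := fa s `^ p + fb s `^ p.
Let gi : mu.-integrable setT (EFin \o g).
Proof. by apply: integrable_EFinD => //; exact: (integrable_pow_line hf). Qed.
Let g0 s : 0 <= g s. Proof. by rewrite addr_ge0 ?powR_ge0. Qed.

Let gKi u : mu.-integrable setT (EFin \o (fun s => g s * sechk k (s - u))).
Proof.
have -> : (fun s => g s * sechk k (s - u)) =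
    (fun s => fa s `^ p * sechk k (s - u) + fb s `^ p * sechk k (s - u)).
  by apply/funext => s; rewrite /g mulrDl.
by apply: integrable_EFinD => //; exact: (integrable_pow_sech hf).
Qed.

Lemma edge_power_meanE u :
  (edge_power_mean u)%:E = (\int[mu]_s (g s * sechk k (s - u))%:E)%E.
Proof. by rewrite /edge_power_mean /Rintegral fineK //; exact: integrable_fin_num (gKi u). Qed.

Let F (u s : R) : R := g s * sechk k (s - u).
Let F0 (z : measurableTypeR R * measurableTypeR R) : (0 <= (F z.1 z.2)%:E)%E.
Proof. by rewrite lee_fin mulr_ge0 // ltW // sechk_gt0. Qed.
Let mF : measurable_fun setT (fun z : measurableTypeR R * measurableTypeR R => (F z.1 z.2)%:E).
Proof.
apply/measurable_EFinP; apply: (@measurable_fun_caratheodory R _ (measurableTypeR R) F).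
  by move=> u; move/integrableP : (gKi u) => [/measurable_EFinP].
move=> s.
have cs : continuous (fun u => sechk k (s - u)).
  have -> : (fun u => sechk k (s - u)) = (fun u => sechk k (u - s)).
    by apply/funext => v; rewrite -sechkN opprB.
  exact: continuous_sechk.
by move=> u; apply: cvgM; [exact: cvg_cst|exact: cs].
Qed.

(** Tonelli's theorem: sech is even, so as a function of u the kernel has the same
   mass A. *)
Lemma edge_power_mean_total :
  (\int[mu]_u (edge_power_mean u)%:E = (A * (hmean p f a + hmean p f b))%:E)%E.
Proof.
have -> : (\int[mu]_u (edge_power_mean u)%:E = \int[mu]_u \int[mu]_s (F u s)%:E)%E.
  by apply: eq_integral => u _; rewrite edge_power_meanE.
rewrite (@fubini_tonelli _ _ _ _ R mu mu _ mF F0) /=.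
have gi0 : (\int[mu]_s (g s)%:E)%E = (hmean p f a + hmean p f b)%:E.
  rewrite -[LHS]fineK; last exact: integrable_fin_num gi.
  by congr (_%:E); rewrite -/(Rintegral mu setT g) RintegralD //; exact: (integrable_pow_line hf).
rewrite EFinM -gi0 -ge0_integralZl_EFin //; last 3 first.
- by move=> s _; rewrite lee_fin.
- by move/integrableP : gi => [].
- exact: ltW A0.
apply: eq_integral => s _; rewrite /F muleC.
have -> : (fun x => (g s * sechk k (s - x))%:E) = (fun x => (g s)%:E * (sechk k (x - s))%:E)%E.
  by apply/funext => v; rewrite -sechkN opprB.
rewrite ge0_integralZl_EFin //; last 2 first.
- by move=> v _; rewrite lee_fin ltW // sechk_gt0.
- by move/integrableP : (integrable_sechk s k0) => [].
by rewrite sechk_integral.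
Qed.

Lemma integrable_edge_power_mean : mu.-integrable setT (EFin \o edge_power_mean).
Proof.
have mW : measurable_fun setT (fun u => (edge_power_mean u)%:E).
  have -> : (fun u => (edge_power_mean u)%:E) = (fun u => \int[mu]_s (F u s)%:E)%E.
    by apply/funext => u; rewrite edge_power_meanE.
  exact: (@measurable_fun_fubini_tonelli_F _ _ _ _ R mu _ mF F0).
apply/integrableP; split => //.
have W0 u : 0 <= edge_power_mean u.
  apply: Rintegral_ge0 => s _.
  by rewrite mulr_ge0 ?addr_ge0 ?powR_ge0 // ltW // sechk_gt0.
under eq_integral do rewrite /= ger0_norm //.
by rewrite edge_power_mean_total ltry.
Qed.

Let gap_int : mu.-integrable setT
  (EFin \o (fun u => edge_power_mean u - 2 * A * normc (f (u +i* y0)) `^ p)).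
Proof.
apply: integrable_EFinB => //; first exact: integrable_edge_power_mean.
by apply: integrable_EFinZ => //; exact: (integrable_pow_line hf).
Qed.

Let gap_integral :
  \int[mu]_u (edge_power_mean u - 2 * A * normc (f (u +i* y0)) `^ p) =
  A * (hmean p f a + hmean p f b - 2 * hmean p f y0).
Proof.
rewrite RintegralB //; first last.
- by apply: integrable_EFinZ => //; exact: (integrable_pow_line hf).
- exact: integrable_edge_power_mean.
rewrite RintegralZl //; last exact: (integrable_pow_line hf).
have -> : \int[mu]_u edge_power_mean u = A * (hmean p f a + hmean p f b).
  by rewrite [LHS]/Rintegral edge_power_mean_total.
have -> : \int[mu]_u (normc (f (u +i* y0)) `^ p) = hmean p f y0 by [].
move: (hmean p f a + hmean p f b) (hmean p f y0) => X Y. clearbody A; ring.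
Qed.

Lemma hmean_midpoint_strip : 2 * hmean p f y0 <= hmean p f a + hmean p f b.
Proof.
rewrite -subr_ge0 -(pmulr_rge0 _ A0) -gap_integral; apply: Rintegral_ge0 => u _.
by rewrite subr_ge0 normc_pow_le.
Qed.

(** Equality forces equality in Jensen's inequality at some point, hence |f| is
   almost everywhere constant on the lower edge; only zero is integrable. *)
Lemma hmean_midpoint_eq_strip : 2 * hmean p f y0 = hmean p f a + hmean p f b -> hmean p f a = 0.
Proof.
move=> E.
have pr : ProperFilter (almost_everywhere mu).
  apply: ae_properfilter_algebraOfSetsType.
  by have := lebesgue_measure_setT R; move=> /= ->; rewrite ltry.
have ge v : 0 <= edge_power_mean v - 2 * A * normc (f (v +i* y0)) `^ p.
  by rewrite subr_ge0 normc_pow_le.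
have I0 : \int[mu]_u (edge_power_mean u - 2 * A * normc (f (u +i* y0)) `^ p) = 0.
  by rewrite gap_integral E subrr mulr0.
have [u Hu] := @filter_ex _ _ pr _ (Rintegral_ge0_eq0_ae (mu := mu) ge gap_int I0).
have W0 : edge_power_mean u - 2 * A * edge_average u `^ p = 0.
  apply/eqP; rewrite eq_le; apply/andP; split.
    rewrite -Hu lerD2l lerN2 (ler_pM2l A2).
    by apply: ge0_ler_powR (normc_le_edge_average u); rewrite ?nnegrE ?normc_ge0 ?edge_average_ge0 ?(ltW p0) //.
  by rewrite subr_ge0 edge_average_pow_le.
set c := edge_average u in W0.
have c0 : 0 <= c by exact: edge_average_ge0.
have G0 s : 0 <= (pgap p c (fa s) + pgap p c (fb s)) * sechk k (s - u).
  apply: mulr_ge0; last exact: ltW (sechk_gt0 _ _).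
  by apply: addr_ge0; (apply: pgap_ge0; [exact: p1|exact: c0|exact: normc_ge0]).
have Gi : mu.-integrable setT (EFin \o (fun s => (pgap p c (fa s) + pgap p c (fb s)) * sechk k (s - u))).
  apply: (integrable_jensen_gap A (integrable_sechk u k0)).
  - exact: (integrable_normc_sech p1 hf).
  - exact: (integrable_normc_sech p1 hf).
  - exact: (integrable_pow_sech hf).
  - exact: (integrable_pow_sech hf).
have := Rintegral_ge0_eq0_ae (mu := mu) G0 Gi; rewrite edge_power_gap W0 => /(_ erefl) H.
clear Gi G0 W0; clearbody c.
(* A vanishing gap forces |f| = c on the lower edge. *)
have {}H : \forall s \ae mu, fa s = c.
  apply: filterS H => s /eqP; rewrite mulf_eq0 (gt_eqF (sechk_gt0 _ _)) orbF => /eqP.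
  move: (normc_ge0 (f (s +i* a))) (normc_ge0 (f (s +i* b))); rewrite -/(fa s) -/(fb s).
  move: (fa s) (fb s) => x y x0 y1 h; apply/eqP; apply: contraT => xc.
  have g1 := pgap_gt0 p1 c0 x0 xc; have g2 := pgap_ge0 p1 c0 y1.
  by have := ltr_wpDr g2 g1; rewrite h ltxx.
have I := hmeanE hf a0; rewrite /hardy_mean in I.
have I2 : (\int[mu]_s (c `^ p)%:E = (hmean p f a)%:E)%E.
  rewrite -I; apply: ae_eq_integral.
  - exact: measurableT.
  - exact: measurable_cst.
  - by apply/measurable_EFinP; exact: (measurable_pow_line hf).
  - by apply: filterS H => s h _; rewrite -h.
move: I2; rewrite integral_cst; last exact: measurableT.
have := lebesgue_measure_setT R; move=> /= ->.
have [cp|cp] := eqVneq (c `^ p) 0; first by rewrite cp mul0e => -[].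
have cp0 : (0 < (c `^ p)%:E)%E by rewrite lte_fin lt_neqAle eq_sym cp powR_ge0.
by rewrite gt0_muley.
Qed.

End MeanConvexity.

(** * Differentiability of the means *)

Section PointwiseDerivative.
Context {R : realType}.
Implicit Types (f : R[i] -> R[i]) (x y p : R).

Lemma is_derive_bounded (F : R -> R) (x l L d : R) : 0 < d -> is_derive x 1 F l ->
  (forall h, `|h| < d -> `|F (x + h) - F x| <= L * `|h|) -> `|l| <= L.
Proof.
move=> d0 /is_derive_expansion H HL; apply/ler_addgt0Pr => e e0.
have [r r0 Hr] := H _ e0.
pose h := Num.min r d / 2.
have m0 : 0 < Num.min r d by rewrite lt_min r0.
have h0 : 0 < h by rewrite divr_gt0.
have hm : h < Num.min r d by rewrite /h; lra.
have [hr hd] : h < r /\ h < d by move: hm; rewrite lt_min => /andP.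
have := Hr h; rewrite gtr0_norm // => /(_ hr).
have := HL h; rewrite gtr0_norm // => /(_ hd).
have := ler_normB (F (x + h) - F x) (F (x + h) - F x - l * h).
have -> : F (x + h) - F x - (F (x + h) - F x - l * h) = l * h by ring.
rewrite normrM (gtr0_norm h0) => h1 h2 h3.
by rewrite -(ler_pM2r h0) mulrDl; lra.
Qed.

(** Away from the zeros of f this is the chain rule; at a zero, |f| is O(h), and
   the exponent p >= 2 makes |f|^p = O(h^2). *)
Lemma derivable_normc_pow f x y p : 2 <= p -> cderivable f (x +i* y) ->
  derivable (fun v => normc (f (x +i* v)) `^ p) y 1.
Proof.
move=> p2 [l Hl]; have p0 : 0 < p by lra.
have [f0|f0] := eqVneq (f (x +i* y)) 0.
  have [d d0 H] := cderiv_lip Hl.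
  pose C := normc l + 1; have C0 : 0 < C by rewrite ltr_wpDl // normc_ge0.
  suff D : is_derive y 1 (fun v => normc (f (x +i* v)) `^ p) 0 by case: D.
  apply/is_derive_expansion => e e0.
  exists (Num.min d (Num.min C^-1 (e / C ^+ 2))) => [|h].
    by rewrite !lt_min d0 invr_gt0 C0 divr_gt0 // exprn_gt0.
  rewrite !lt_min => /and3P[hd hC he].
  rewrite f0 normc0 powR0 ?gt_eqF // mul0r !subr0 ger0_norm ?powR_ge0 //.
  have := H (0 +i* h); rewrite normc_iR => /(_ hd).
  have -> : x +i* y + 0 +i* h = x +i* (y + h) by apply: eqcP => /=; ring.
  rewrite f0 subr0 => fh.
  have Ch1 : C * `|h| <= 1.
    by rewrite mulrC -ler_pdivlMr // div1r ltW.
  apply: (@le_trans _ _ ((C * `|h|) `^ p)).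
    by apply: ge0_ler_powR; rewrite ?nnegrE ?normc_ge0 ?mulr_ge0 ?(ltW p0) ?(ltW C0).
  have [->|h0] := eqVneq h 0.
    by rewrite normr0 mulr0 powR0 ?gt_eqF // mulr0.
  apply: (@le_trans _ _ ((C * `|h|) `^ 2)).
    by apply: ger_powR => //; rewrite Ch1 mulr_gt0 ?normr_gt0.
  rewrite (powR_mulrn 2) ?mulr_ge0 ?(ltW C0) // exprMn.
  have -> : C ^+ 2 * `|h| ^+ 2 = (C ^+ 2 * `|h|) * `|h| by ring.
  by rewrite ler_wpM2r // mulrC -ler_pdivlMr ?exprn_gt0 // ltW.
have dRe : is_derive y 1 (fun v => complex.Re (f (x +i* v))) (complex.Re (l * 'i)).
  apply/is_derive_expansion => e /Hl[d d0 H]; exists d => // h hd.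
  have := H (0 +i* h); rewrite normc_iR => /(_ hd).
  have -> : x +i* y + 0 +i* h = x +i* (y + h) by apply: eqcP => /=; ring.
  apply: le_trans; apply: le_trans (normRe_le _); rewrite le_eqVlt; apply/orP; left.
  apply/eqP; congr (`|_|); case: (f (x +i* (y + h))) => ? ?.
  by case: (f (x +i* y)) => ? ?; case: (l) => ? ? /=; ring.
have dIm : is_derive y 1 (fun v => complex.Im (f (x +i* v))) (complex.Im (l * 'i)).
  apply/is_derive_expansion => e /Hl[d d0 H]; exists d => // h hd.
  have := H (0 +i* h); rewrite normc_iR => /(_ hd).
  have -> : x +i* y + 0 +i* h = x +i* (y + h) by apply: eqcP => /=; ring.
  apply: le_trans; apply: le_trans (normIm_le _); rewrite le_eqVlt; apply/orP; left.
  apply/eqP; congr (`|_|); case: (f (x +i* (y + h))) => ? ?.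
  by case: (f (x +i* y)) => ? ?; case: (l) => ? ? /=; ring.
pose N v := complex.Re (f (x +i* v)) ^+ 2 + complex.Im (f (x +i* v)) ^+ 2.
have N0 v : 0 <= N v by rewrite addr_ge0 ?sqr_ge0.
have -> : (fun v => normc (f (x +i* v)) `^ p) = (@powR R ^~ (p / 2)) \o N.
  apply/funext => v /=.
  have -> : normc (f (x +i* v)) = Num.sqrt (N v) by rewrite /N; case: (f _).
  by rewrite -powR12_sqrt // -powRrM mulrC.
have Ny : 0 < N y.
  rewrite lt_neqAle N0 andbT eq_sym; apply: contra_neq f0 => Ny.
  by apply: eq0_normc; rewrite -[LHS]/(normc (f _)); move: Ny; rewrite /N; case: (f _) => u v /= ->; rewrite sqrtr0.
have dN : derivable N y 1.
  case: dRe => dr _; case: dIm => di _.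
  have -> : N = (fun v => complex.Re (f (x +i* v))) * (fun v => complex.Re (f (x +i* v))) +
                (fun v => complex.Im (f (x +i* v))) * (fun v => complex.Im (f (x +i* v))).
    by apply/funext => v; rewrite /N !expr2.
  exact: (derivableD (derivableM dr dr) (derivableM di di)).
apply/derivable1_diffP; apply: differentiable_comp; first exact/derivable1_diffP.
by apply/derivable1_diffP; apply: derivable_powR; rewrite in_itv /= Ny.
Qed.

End PointwiseDerivative.

Section MeanDerivable.
Context {R : realType}.
Notation mu := (@lebesgue_measure R).

(** Differentiation under the integral sign.  By [strip_bound] and
   [strip_lipschitz] the derivative of |f|^p at heights near y0 is at most a
   multiple of the p-th power of the edge average, and by Jensen's inequality that
   power is at most a multiple of [edge_power_mean], which is integrable. *)
Lemma derivable_hmean (p : R) (f : R[i] -> R[i]) (y0 : R) :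
  2 <= p -> locally_hardy p f -> 0 < y0 -> derivable (hmean p f) y0 1.
Proof.
move=> p2 hf y00; have p1 : 1 < p by lra.
have p0 : 0 < p by lra.
(* The strip of half-height y0 / 2. *)
pose k := pi / y0; have k0 : 0 < k by rewrite divr_gt0 // pi_gt0.
have rE : pi / (2 * k) = y0 / 2.
  have gen (P : R) : P != 0 -> P / (2 * (P / y0)) = y0 / 2.
    by move=> P0; field; rewrite P0 gt_eqF.
  exact: gen (lt0r_neq0 (pi_gt0 R)).
clearbody k; have ry : pi / (2 * k) < y0 by rewrite rE; lra.
have A0 : 0 < pi / k by rewrite divr_gt0 // pi_gt0.
pose d := (4 * k)^-1; have d0 : 0 < d by rewrite invr_gt0; apply: mulr_gt0.
have dy : d <= y0 / 2.
  rewrite -rE /d; have -> : (4 * k)^-1 = 2^-1 / (2 * k) by field; rewrite gt_eqF.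
  have k2 : 0 < (2 * k)^-1 by rewrite invr_gt0; apply: mulr_gt0.
  by rewrite (ler_pM2r k2); have := pihalf_ge1 R; lra.
have pos v : `|v - y0| <= d -> 0 < v by rewrite ler_norml; lra.
have fd x v : 0 < v -> cderivable f (x +i* v).
  by move=> v0; apply: holomorphic_cderivable => //; case: hf.
pose m := edge_average f k y0.
have m0 x : 0 <= m x by exact: edge_average_ge0.
pose W := edge_power_mean p f k y0.
pose C := p * 4 `^ (p - 1) * (80 * k).
have C0 : 0 <= C.
  apply: mulr_ge0; last by apply: mulr_ge0 => //; exact: ltW.
  by apply: mulr_ge0; [exact: ltW|exact: powR_ge0].
pose G x := C / (2 * (pi / k)) * W x.
have mW x : m x `^ p <= (2 * (pi / k))^-1 * W x.
  have B0 : 0 < 2 * (pi / k) by apply: mulr_gt0.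
  by rewrite (ler_pdivlMl _ _ B0); exact: (edge_average_pow_le p1 hf k0 ry).
have Hf x v : y0 - pi / (2 * k) <= v <= y0 + pi / (2 * k) -> cderivable f (x +i* v).
  by move=> vI; apply: fd; rewrite rE in vI; lra.
have Hv : vertical_bounded f (y0 - pi / (2 * k)) (y0 + pi / (2 * k)).
  by apply: (locally_hardy_vertical_bounded p1 hf); rewrite rE; lra.
have Hi u : mu.-integrable setT (EFin \o (fun s => edges f k y0 s * sechk k (s - u))).
  have -> : (fun s => edges f k y0 s * sechk k (s - u)) =
      (fun s => normc (f (s +i* (y0 - pi / (2 * k)))) * sechk k (s - u)
              + normc (f (s +i* (y0 + pi / (2 * k)))) * sechk k (s - u)).
    by apply/funext => s; rewrite /edges mulrDl.
  by apply: integrable_EFinD => //; apply: (integrable_normc_sech p1 hf) => //; rewrite rE; lra.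
have Em x : edge_mean f k y0 x = 2 * (pi / k) * m x.
  by rewrite /m /edge_average mulrC divfK // gt_eqF // mulr_gt0.
have bnd x v : `|v - y0| <= d -> normc (f (x +i* v)) <= 4 * m x.
  move=> vd; have := strip_bound k0 Hf Hv Hi x vd; rewrite Em.
  have -> : 2 * (2 * (pi / k) * m x) = pi / k * (4 * m x) by ring.
  by rewrite ler_pM2l.
have lip x v v' : `|v - y0| <= d -> `|v' - y0| <= d ->
    normc (f (x +i* v) - f (x +i* v')) <= 80 * k * m x * `|v - v'|.
  move=> vd vd'; have := strip_lipschitz k0 Hf Hv Hi x vd vd'; rewrite Em.
  have -> : 40 * k * `|v - v'| * (2 * (pi / k) * m x) = pi / k * (80 * k * m x * `|v - v'|) by ring.
  by rewrite ler_pM2l.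
pose U v x := normc (f (x +i* v)) `^ p.
have Ulip x v v' : `|v - y0| <= d -> `|v' - y0| <= d -> `|U v x - U v' x| <= G x * `|v - v'|.
  move=> vd vd'.
  have mx4 : 0 <= 4 * m x by rewrite mulr_ge0.
  have := @powR_lipschitz R p (4 * m x) (normc (f (x +i* v))) (normc (f (x +i* v'))) p1.
  rewrite !normc_ge0 !bnd // => /(_ isT isT) h; apply: (le_trans h).
  have h1 : `|normc (f (x +i* v)) - normc (f (x +i* v'))| <= 80 * k * m x * `|v - v'|.
    apply: le_trans (lip x v v' vd vd').
    have t1 := le_normcD (f (x +i* v) - f (x +i* v')) (f (x +i* v')).
    have t2 := le_normcD (f (x +i* v') - f (x +i* v)) (f (x +i* v)).
    by rewrite !subrK in t1 t2; rewrite normcB in t2; rewrite ler_norml; lra.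
  apply: (@le_trans _ _ (p * (4 * m x) `^ (p - 1) * (80 * k * m x * `|v - v'|))).
    by rewrite ler_wpM2l // mulr_ge0 ?powR_ge0 ?(ltW p0).
  rewrite powRM //.
  have -> : p * (4 `^ (p - 1) * m x `^ (p - 1)) * (80 * k * m x * `|v - v'|) =
     C * (m x * m x `^ (p - 1)) * `|v - v'| by rewrite /C; ring.
  rewrite mulr_powRB1 // ler_wpM2r // /G -mulrA ler_wpM2l //.
have nearI v : v \in `](y0 - d)%R, (y0 + d)%R[%R -> `|v - y0| < d.
  by rewrite in_itv /= ltr_norml; lra.
have dU v x : `|v - y0| < d -> derivable (U ^~ x) v 1.
  by move=> vd; apply: derivable_normc_pow => //; apply: fd; apply: pos; exact: ltW.
apply: (@derivable_under_integral R _ _ mu U setT measurableT y0 (y0 - d) (y0 + d) _ _ _ G) => //.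
- by rewrite /= in_itv /=; lra.
- by move=> v /nearI vd; apply: integrable_pow_line hf _ _; apply: pos; exact: ltW.
- by move=> v x /nearI vd _; exact: dU.
- move=> x; rewrite /G; apply: mulr_ge0.
    by apply: divr_ge0 => //; apply: mulr_ge0 => //; exact: ltW.
  rewrite /W /edge_power_mean; apply: Rintegral_ge0 => s _.
  by rewrite mulr_ge0 ?addr_ge0 ?powR_ge0 // ltW // sechk_gt0.
- by apply: integrable_EFinZ => //; exact: (integrable_edge_power_mean hf k0 ry).
- move=> v x /nearI vd _; rewrite partial1of2E.
  have e0 : 0 < d - `|v - y0| by rewrite subr_gt0.
  have dd : is_derive v 1 (U ^~ x) ('D_1 (U ^~ x) v) by split => //; exact: dU.
  apply: (is_derive_bounded e0 dd) => h hh.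
  have -> : `|h| = `|v + h - v| by congr (`|_|); ring.
  apply: Ulip; last exact: ltW.
  have -> : v + h - y0 = (v - y0) + h by ring.
  by apply: (le_trans (ler_normD _ _)); lra.
Qed.

End MeanDerivable.

(** * Logarithmic convexity of the means *)

Section LogConvexity.
Context {R : realType}.
Notation mu := (@lebesgue_measure R).
Implicit Types (f : R[i] -> R[i]) (p c r : R).

Lemma half_height (r : R) : 0 < r -> pi / (2 * (pi / (2 * r))) = r.
Proof.
move=> r0; have gen (P : R) : P != 0 -> P / (2 * (P / (2 * r))) = r.
  by move=> P0; field; rewrite P0 gt_eqF.
exact: gen (lt0r_neq0 (pi_gt0 R)).
Qed.

Lemma hmean_midpoint p f c r : 1 < p -> locally_hardy p f -> 0 < r < c ->
  2 * hmean p f c <= hmean p f (c - r) + hmean p f (c + r).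
Proof.
move=> p1 hf /andP[r0 rc].
have k0 : 0 < pi / (2 * r) by rewrite divr_gt0 ?pi_gt0 // mulr_gt0.
have := @hmean_midpoint_strip R p f (pi / (2 * r)) c p1 hf k0.
by rewrite (half_height r0) => H; exact: (H rc).
Qed.

Lemma hmean_midpoint_eq p f c r : 1 < p -> locally_hardy p f -> 0 < r < c ->
  2 * hmean p f c = hmean p f (c - r) + hmean p f (c + r) -> hmean p f (c - r) = 0.
Proof.
move=> p1 hf /andP[r0 rc].
have k0 : 0 < pi / (2 * r) by rewrite divr_gt0 ?pi_gt0 // mulr_gt0.
have := @hmean_midpoint_eq_strip R p f (pi / (2 * r)) c p1 hf k0.
by rewrite (half_height r0) => H; exact: (H rc).
Qed.

Lemma hmean_ge0 p f y : 0 <= hmean p f y.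
Proof. by apply: Rintegral_ge0 => x _; exact: powR_ge0. Qed.

(** [normc_pow_le] bounds |f|^p at a point by weighted integrals over two edges. *)
Lemma hmean_eq0_normc p f (u c : R) : 1 < p -> locally_hardy p f -> 0 < c ->
  (forall y, 0 < y -> hmean p f y = 0) -> f (u +i* c) = 0.
Proof.
move=> p1 hf c0 M0; have p0 : 0 < p by lra.
pose r := c / 2; have r0 : 0 < r by rewrite divr_gt0.
have rc : r < c by rewrite /r; lra.
pose k := pi / (2 * r); have k0 : 0 < k by rewrite divr_gt0 ?pi_gt0 // mulr_gt0.
have ry : pi / (2 * k) < c by rewrite half_height.
have := normc_pow_le p1 hf k0 ry u.
have : edge_power_mean p f k c u <= 0.
  rewrite /edge_power_mean half_height //.
  have i1 := @integrable_pow_line R p f hf (c - r) _; have {}i1 := i1 (ltac:(by rewrite subr_gt0)).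
  have i2 := @integrable_pow_line R p f hf (c + r) _; have {}i2 := i2 (ltac:(by rewrite addr_gt0)).
  have <- : hmean p f (c - r) + hmean p f (c + r) = 0.
    by rewrite !M0 ?addr0 ?subr_gt0 ?addr_gt0.
  have ij : mu.-integrable setT (EFin \o (fun s => normc (f (s +i* (c - r))) `^ p + normc (f (s +i* (c + r))) `^ p)).
    exact: integrable_EFinD.
  rewrite /hmean -RintegralD //; apply: le_Rintegral => //.
    have := @integrable_pow_sech R p f hf k u (c - r) k0.
    have := @integrable_pow_sech R p f hf k u (c + r) k0.
    rewrite addr_gt0 // subr_gt0 => /(_ isT) j2 /(_ rc) j1.
    have -> : (fun s => (normc (f (s +i* (c - r))) `^ p + normc (f (s +i* (c + r))) `^ p) * sechk k (s - u))
      = (fun s => normc (f (s +i* (c - r))) `^ p * sechk k (s - u) + normc (f (s +i* (c + r))) `^ p * sechk k (s - u)).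
      by apply/funext => s; rewrite mulrDl.
    exact: integrable_EFinD.
  by move=> s _; rewrite ler_piMr ?sechk_le1 // addr_ge0 ?powR_ge0.
move=> h1 h2; have h3 := le_trans h2 h1.
have A0 : 0 < 2 * (pi / k) by apply: mulr_gt0 => //; rewrite divr_gt0 ?pi_gt0.
move: h3; rewrite (pmulr_rle0 _ A0) => h3.
have : normc (f (u +i* c)) `^ p = 0 by apply/le_anti; rewrite h3 powR_ge0.
by move=> /powR_eq0_eq0/eq0_normc.
Qed.

(** As the mean of the twisted function at height y is exp (- p t y) M y, midpoint
   convexity for all t amounts to midpoint convexity of log M. *)
Definition twist (t : R) f (z : R[i]) : R[i] := cexp ((0 +i* t) * z) * f z.

Lemma normc_twist t f (x y : R) : normc (twist t f (x +i* y)) = expR (- (t * y)) * normc (f (x +i* y)).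
Proof. by rewrite /twist normcM normc_cexp /= mul0r sub0r. Qed.

Lemma hardy_mean_twist p t f y : 1 < p -> locally_hardy p f -> 0 < y ->
  hardy_mean p (twist t f) y = ((expR (- (p * t * y)))%:E * hardy_mean p f y)%E.
Proof.
move=> p1 hf y0.
have E x : (normc (twist t f (x +i* y)) `^ p)%:E =
    ((expR (- (p * t * y)))%:E * (normc (f (x +i* y)) `^ p)%:E)%E.
  rewrite normc_twist powRM ?expR_ge0 ?normc_ge0 // -expRM EFinM.
  by congr ((expR _)%:E * _)%E; ring.
rewrite /hardy_mean; under eq_integral do rewrite E.
apply: ge0_integralZl_EFin => //; rewrite ?expR_ge0 //.
- by move=> x _; rewrite lee_fin powR_ge0.
- by apply/measurable_EFinP; exact: measurable_pow_line.
Qed.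

Lemma locally_hardy_twist p t f : 1 < p -> locally_hardy p f -> locally_hardy p (twist t f).
Proof.
move=> p1 lf; have [hf Mf] := lf; split.
  move=> z z0; apply/derivable_cderiv; apply: cderivableM; first exact: cderivable_cexpM.
  by apply/derivable_cderiv; exact: hf.
move=> a b a0; have [C HC] := Mf a b a0.
exists (expR (`|p * t| * `|b|) * C) => y yI; have /andP[ay yb] := yI.
have y0 : 0 < y by exact: lt_le_trans ay.
rewrite hardy_mean_twist // EFinM; apply: lee_pmul; [| |rewrite lee_fin ler_expR|exact: HC].
- by rewrite lee_fin expR_ge0.
- by apply: integral_ge0 => x _; rewrite lee_fin powR_ge0.
apply: le_trans (ler_norm _) _; rewrite normrN normrM ler_wpM2l // gtr0_norm //.
exact: le_trans (ler_norm b).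
Qed.

(** The right-hand side is minimal at t = sqrt (be / al), with value twice the
   geometric mean; for al = 0 or be = 0 the infimum is approached as t tends to
   infinity or to 0. *)
Lemma le_geom_mean (x al be : R) : 0 <= x -> 0 <= al -> 0 <= be ->
  (forall t, 0 < t -> 2 * x <= t * al + t^-1 * be) -> x ^+ 2 <= al * be.
Proof.
move=> x0; rewrite [0 <= al]le_eqVlt => /orP[/eqP <-|al0] be0 H.
  rewrite mul0r; suff -> : x = 0 by rewrite expr0n.
  apply/le_anti; rewrite x0 andbT; apply/ler_addgt0Pr => e e0; rewrite add0r.
  have t0 : 0 < (be + 1) / (2 * e) by rewrite divr_gt0 ?mulr_gt0 // ltr_wpDl.
  have := H _ t0; rewrite mulr0 add0r invf_div => h.
  have h2 : 2 * e / (be + 1) * be <= 2 * e.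
    rewrite mulrAC ler_pdivrMr ?ltr_wpDl //.
    by rewrite ler_wpM2l ?mulr_ge0 ?(ltW e0) // lerDl.
  lra.
move: be0; rewrite le_eqVlt => /orP[/eqP be0|be0].
  rewrite -be0 mulr0; suff -> : x = 0 by rewrite expr0n.
  apply/le_anti; rewrite x0 andbT; apply/ler_addgt0Pr => e e0; rewrite add0r.
  have := H (e / al) (divr_gt0 e0 al0); rewrite -be0 mulr0 addr0 divfK ?gt_eqF //; lra.
pose s := Num.sqrt be / Num.sqrt al.
have sa : 0 < Num.sqrt al by rewrite sqrtr_gt0.
have sb : 0 < Num.sqrt be by rewrite sqrtr_gt0.
have := H s (divr_gt0 sb sa); rewrite /s invf_div.
have ea := sqr_sqrtr (ltW al0); have eb := sqr_sqrtr (ltW be0).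
rewrite -{2}ea -{3}eb => h.
have {}h : x <= Num.sqrt al * Num.sqrt be.
  have e : Num.sqrt be / Num.sqrt al * Num.sqrt al ^+ 2 + Num.sqrt al / Num.sqrt be * Num.sqrt be ^+ 2
      = 2 * (Num.sqrt al * Num.sqrt be) by field; rewrite !gt_eqF.
  by move: h; rewrite e ler_pM2l.
by rewrite -ea -eb -exprMn ler_pXn2r ?nnegrE ?mulr_ge0 ?(ltW sa) ?(ltW sb).
Qed.

Lemma hmean_log_midpoint p f c r : 1 < p -> locally_hardy p f -> 0 < r < c ->
  hmean p f c ^+ 2 <= hmean p f (c - r) * hmean p f (c + r).
Proof.
move=> p1 hf rc; apply: le_geom_mean; rewrite ?hmean_ge0 // => s s0.
have p0 : 0 < p by lra.
have /andP[r0 rc'] := rc; have c0 : 0 < c by lra.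
pose t := ln s / (p * r).
have ptr : p * t * r = ln s by rewrite /t; field; rewrite !gt_eqF.
have ht := locally_hardy_twist t p1 hf.
have E y : 0 < y -> hmean p (twist t f) y = expR (- (p * t * y)) * hmean p f y.
  move=> y0; have := hardy_mean_twist t p1 hf y0.
  by rewrite (hmeanE hf y0) (hmeanE ht y0) -EFinM => -[].
have := hmean_midpoint p1 ht rc; rewrite !E //; [|lra|lra].
have e0 : 0 < expR (p * t * c) by exact: expR_gt0.
move: (hmean p f c) (hmean p f (c - r)) (hmean p f (c + r)) => A B C.
rewrite -(ler_pM2l e0) mulrDr [_ * (2 * _)]mulrCA.
rewrite (mulrA _ _ A) (mulrA _ _ B) (mulrA _ _ C) -!expRD subrr expR0 mul1r.
have -> : p * t * c - p * t * (c - r) = ln s by rewrite -ptr; ring.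
have -> : p * t * c - p * t * (c + r) = - ln s by rewrite -ptr; ring.
by rewrite expRN lnK ?posrE.
Qed.

End LogConvexity.

(** * Bounded log-convex functions *)

Section RealFunctions.
Context {R : realType}.
Implicit Types (F dF L M : R -> R) (a b c r x y : R).

Lemma is_derive_continuous F x l : is_derive x (1 : R) F l -> {for x, continuous F}.
Proof. by case=> dF _; apply: differentiable_continuous; exact/derivable1_diffP. Qed.

Lemma mean_value F dF a b : a < b ->
  (forall x, a <= x <= b -> is_derive x (1 : R) F (dF x)) ->
  exists2 c, a < c < b & F b - F a = dF c * (b - a).
Proof.
move=> ab H.
have [|| c] := @MVT R F dF a b ab; last by rewrite in_itv /= => cab ->; exists c.
- by move=> x; rewrite in_itv /= => /andP[ax xb]; apply: H; rewrite !ltW.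
- apply: continuous_in_subspaceT => x /set_mem /=; rewrite in_itv /= => /H.
  exact: is_derive_continuous.
Qed.

(** Midpoint convexity makes the increments of L over consecutive steps of equal
   length nondecreasing.  Compare the increment that starts at a with the one that
   starts at b, as the step tends to 0. *)
Lemma midconvex_derive_le L a b la lb : a < b ->
  (forall c r, 0 < r -> a <= c - r -> 2 * L c <= L (c - r) + L (c + r)) ->
  is_derive a 1 L la -> is_derive b 1 L lb -> la <= lb.
Proof.
move=> ab mid /is_derive_expansion Ha /is_derive_expansion Hb.
apply/ler_addgt0Pr => e e0; have e2 : 0 < e / 2 by rewrite divr_gt0.
have [d1 d10 H1] := Ha _ e2; have [d2 d20 H2] := Hb _ e2.
have d0 : 0 < Num.min d1 d2 by rewrite lt_min d10.
have ba : 0 < b - a by rewrite subr_gt0.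
pose n := Num.bound ((b - a) / Num.min d1 d2).
have hn : (b - a) / Num.min d1 d2 < n%:R.
  by apply: archi_boundP; rewrite divr_ge0 // ltW.
have n0 : 0 < n%:R :> R by apply: le_lt_trans hn; rewrite divr_ge0 // ltW.
pose r := (b - a) / n%:R; have r0 : 0 < r by rewrite divr_gt0.
have rd : r < Num.min d1 d2.
  by rewrite /r ltr_pdivrMr // mulrC -ltr_pdivrMr.
have incr k : L (a + r) - L a <= L (a + k%:R * r + r) - L (a + k%:R * r).
  elim: k => [|k IH]; first by rewrite mul0r addr0.
  apply: (le_trans IH).
  have /= := mid (a + k.+1%:R * r) r r0.
  rewrite -natr1; have -> : a + (k%:R + 1) * r - r = a + k%:R * r by ring.
  have -> : a + (k%:R + 1) * r = a + k%:R * r + r by ring.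
  have k0 : 0 <= k%:R * r by rewrite mulr_ge0 // ltW.
  by rewrite lerDl => /(_ k0); lra.
have := incr n; have -> : a + n%:R * r = b by rewrite /r mulrCA mulfV ?gt_eqF // mulr1 addrC subrK.
move: rd; rewrite lt_min => /andP[rd1 rd2].
have := H1 r; have := H2 r; rewrite gtr0_norm // => /(_ rd2) + /(_ rd1).
rewrite !ler_norml => /andP[h1 h2] /andP[h3 h4] h5.
rewrite -(ler_pM2r r0) mulrDl; lra.
Qed.

Section LogConvexBounded.
Variables (M : R -> R) (B : R).
Hypothesis M_ge0 : forall y, 0 < y -> 0 <= M y.
Hypothesis dM : forall y, 0 < y -> derivable M y 1.
Hypothesis M_mid : forall c r, 0 < r < c -> M c ^+ 2 <= M (c - r) * M (c + r).
Hypothesis M_mid_eq : forall c r, 0 < r < c ->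
  2 * M c = M (c - r) + M (c + r) -> M (c - r) = 0.
Hypothesis M_bounded : forall y, 0 < y -> M y <= B.
Hypothesis M_neq0 : exists2 y : R, 0 < y & M y != 0.

(** If one of two points is a zero of M, so is their midpoint.  A zero therefore
   spreads to all larger heights and, by repeated halving, to all smaller ones. *)
Lemma logconvex_gt0 y : 0 < y -> 0 < M y.
Proof.
move=> y0; rewrite lt_neqAle M_ge0 // andbT eq_sym; apply/eqP => My.
have sq0 c : M c ^+ 2 <= 0 -> M c = 0.
  by move=> h; apply/eqP; rewrite -sqrf_eq0; apply/eqP/le_anti; rewrite h sqr_ge0.
have left0 c r : 0 < r < c -> M (c + r) = 0 -> M c = 0.
  by move=> /M_mid + E; rewrite E mulr0; exact: sq0.
have right0 c r : 0 < r < c -> M (c - r) = 0 -> M c = 0.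
  by move=> /M_mid + E; rewrite E mul0r; exact: sq0.
suff Z n : forall c, y < c * 2 ^+ n -> 0 < c -> M c = 0.
  have [c c0 /eqP] := M_neq0; apply.
  have h : y / c < (Num.bound (y / c))%:R by apply: archi_boundP; rewrite divr_ge0 // ltW.
  apply: (Z (Num.bound (y / c))) => //.
  rewrite mulrC -ltr_pdivrMr //; apply: (lt_le_trans h).
  rewrite -natrX ler_nat; apply: ltnW; exact: ltn_expl.
elim: n => [|n IH] c.
  rewrite mulr1 => yc c0; apply: (right0 c (c - y)); first by rewrite subr_gt0 yc /= gtrBl.
  by have -> : c - (c - y) = y by ring.
rewrite exprS mulrA => yc c0; have c2 : 0 < c / 2 by rewrite divr_gt0.
apply: (left0 c (c / 2)); first by rewrite c2 /=; lra.
apply: (left0 _ (c / 2)); first by rewrite c2 /=; lra.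
have -> : c + c / 2 + c / 2 = c * 2 by field.
by apply: IH => //; rewrite mulr_gt0.
Qed.

Let L y := ln (M y).
Let s y := 'D_1 M y / M y.

Lemma is_derive_logconvex y : 0 < y -> is_derive y 1 L (s y).
Proof.
move=> y0; have My := logconvex_gt0 y0.
have d1 : is_derive y 1 M ('D_1 M y) by split => //; exact: dM.
have d2 := @is_derive1_ln R _ My.
have := @is_derive1_comp R (@ln R) M y _ _ d2 d1.
by rewrite mulrC.
Qed.

Lemma logconvex_slope_le a b : 0 < a -> a < b -> s a <= s b.
Proof.
move=> a0 ab; have b0 := lt_trans a0 ab.
apply: (@midconvex_derive_le L a b) => //; try exact: is_derive_logconvex.
move=> c r r0 ac; have h0 : 0 < c - r by lra.
have h1 : 0 < c by lra. have h2 : 0 < c + r by lra.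
have [m0 m1 m2] := And3 (logconvex_gt0 h0) (logconvex_gt0 h1) (logconvex_gt0 h2).
rewrite /L -lnM ?posrE // mulr_natl -lnXn //.
by rewrite ler_ln ?posrE ?exprn_gt0 ?mulr_gt0 // M_mid // r0 /=; lra.
Qed.

(** With a positive slope M would be unbounded.  With slope 0 it would be constant on
   a half-line, which is equality in midpoint convexity. *)
Lemma logconvex_slope_lt0 y : 0 < y -> s y < 0.
Proof.
move=> y0.
have MVL a b : 0 < a -> a < b -> exists2 c, a < c < b & L b - L a = s c * (b - a).
  move=> a0 ab; apply: mean_value => // x /andP[ax _].
  by apply: is_derive_logconvex; exact: lt_le_trans ax.
have s_le0 x : 0 < x -> s x <= 0.
  move=> x0; rewrite leNgt; apply/negP => sx.
  have B0 : 0 < B by apply: lt_le_trans (M_bounded x0); exact: logconvex_gt0.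
  pose d := (`|ln B - L x| + 1) / s x; have d0 : 0 < d by rewrite divr_gt0 // ltr_wpDl.
  have xd : x < x + d by rewrite ltrDl.
  have [c /andP[xc _]] := MVL _ _ x0 xd; have := logconvex_slope_le x0 xc.
  rewrite addrAC subrr add0r => sc E.
  have h : s x * d <= s c * d by rewrite ler_pM2r.
  have e : s x * d = `|ln B - L x| + 1 by rewrite /d mulrCA mulfV ?gt_eqF // mulr1.
  have h2 : L (x + d) <= ln B.
    rewrite /L ler_ln ?posrE ?M_bounded ?logconvex_gt0 //; lra.
  have := ler_norm (ln B - L x); lra.
rewrite lt_neqAle s_le0 // andbT; apply/eqP => sy.
have cstM a b : y < a -> a < b -> M a = M b.
  move=> ya ab; have a0 := lt_trans y0 ya.
  have [c /andP[ac cb] E] := MVL _ _ a0 ab.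
  have sc : s c = 0.
    apply/le_anti; rewrite s_le0 ?(lt_trans a0 ac) //= -sy.
    by apply: logconvex_slope_le => //; exact: lt_trans ac.
  move: E; rewrite sc mul0r => /eqP; rewrite subr_eq0 => /eqP E.
  by apply: (@ln_inj R); rewrite ?posrE ?logconvex_gt0 // (lt_trans a0 ab).
have y1 : 0 < y + 2 - 1 by lra.
have := logconvex_gt0 y1.
rewrite M_mid_eq ?ltxx //; first by rewrite ltr01 /=; lra.
rewrite (cstM (y + 2 - 1) (y + 2)) ?(cstM (y + 2) (y + 2 + 1)); lra.
Qed.

Lemma logconvex_bounded_derive :
  [/\ forall y, 0 < y -> 0 < M y, forall y, 0 < y -> 'D_1 M y < 0 &
      forall a b, 0 < a -> a < b -> 'D_1 M a / M a <= 'D_1 M b / M b].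
Proof.
split; [exact: logconvex_gt0| |exact: logconvex_slope_le].
move=> y y0; have := logconvex_slope_lt0 y0; have My := logconvex_gt0 y0.
by rewrite /s pmulr_llt0 // invr_gt0.
Qed.

End LogConvexBounded.
End RealFunctions.

(** * Functions on the positive half-line *)

Section PositiveHalfLine.
Context {R : realType}.
Notation mu := (@lebesgue_measure R).
Implicit Types (F g G psi : R -> R) (a b c e x y : R).

Lemma near_pos (P : R -> Prop) y : 0 < y -> (forall x, 0 < x -> P x) -> \forall x \near y, P x.
Proof.
move=> y0 H; near=> x; apply: H; near: x.
exact: lt_nbhsr.
Unshelve. all: end_near. Qed.

Lemma classD2_pos F (F1 F2 : R -> R) : (forall y, 0 < y -> is_derive y 1 F (F1 y)) ->
  (forall y, 0 < y -> is_derive y 1 F1 (F2 y)) ->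
  [/\ classD 2 `]0, +oo[ F, forall y, 0 < y -> derive1 F y = F1 y &
      forall y, 0 < y -> derive1n 2 F y = F2 y].
Proof.
move=> H1 H2.
have E y : 0 < y -> derive1 F y = F1 y by move=> y0; rewrite derive1E; have [_ ->] := H1 y y0.
have D y : 0 < y -> is_derive y 1 (derive1 F) (F2 y).
  move=> y0; apply: (@near_eq_is_derive R R R F1) => //; last exact: H2.
  by apply: near_pos => // x x0; rewrite E.
split => //.
  move=> [|[|//]] _ y; rewrite /= in_itv /= andbT => y0.
    by case: (H1 y y0).
  by case: (D y y0).
by move=> y y0; rewrite /= derive1E; case: (D y y0).
Qed.

Lemma pos_increasing F (F1 : R -> R) a b : 0 <= a -> a < b ->
  (forall y, a < y <= b -> is_derive y 1 F (F1 y)) ->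
  (forall y, a < y < b -> 0 < F1 y) -> forall x, a < x < b -> F x < F b.
Proof.
move=> a0 ab HF H1 x /andP[ax xb].
have [y /andP[xy yb] E] : exists2 c, x < c < b & F b - F x = F1 c * (b - x).
  apply: mean_value => // y /andP[xy yb]; apply: HF; rewrite yb andbT.
  exact: lt_le_trans xy.
by rewrite -subr_gt0 E mulr_gt0 ?subr_gt0 // H1 // yb (lt_trans ax).
Qed.

(** F increases from a lower limit at 0 that is nonnegative. *)
Lemma pos_from_zero F (F1 : R -> R) y : 0 < y ->
  (forall x, 0 < x <= y -> is_derive x 1 F (F1 x)) ->
  (forall x, 0 < x < y -> 0 < F1 x) ->
  (forall e, 0 < e -> exists2 d, 0 < d & forall x, 0 < x < d -> - e <= F x) -> 0 < F y.
Proof.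
move=> y0 dF F1_gt0 F_small.
have y2 : 0 < y / 2 by rewrite divr_gt0.
have h2 : y / 2 < y by lra.
apply: (@le_lt_trans _ _ (F (y / 2))); last first.
  by apply: (@pos_increasing F F1 0 y) => //; apply/andP; split.
rewrite leNgt; apply/negP => neg.
have e0 : 0 < - F (y / 2) / 2 by rewrite divr_gt0 // oppr_gt0.
have [d d0 Hd] := F_small _ e0.
pose x := Num.min (d / 2) (y / 4).
have x0 : 0 < x by rewrite lt_min !divr_gt0.
have xd : x <= d / 2 by rewrite /x ge_min lexx.
have xy : x <= y / 4 by rewrite /x ge_min lexx orbT.
have := @pos_increasing F F1 0 (y / 2) (lexx _) y2 _ _ x; have := Hd x.
clearbody x; rewrite x0 /= => /(_ ltac:(lra)) h3 h4.
have : F x < F (y / 2).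
  apply: h4; last lra.
  - by move=> t /andP[t0 ty]; apply: dF; rewrite t0; lra.
  - by move=> t /andP[t0 ty]; apply: F1_gt0; rewrite t0; lra.
lra.
Qed.

Lemma is_derive_div F G df dg x : G x != 0 -> is_derive x (1 : R) F df ->
  is_derive x (1 : R) G dg ->
  is_derive x (1 : R) (fun y => F y / G y) ((df * G x - F x * dg) / G x ^+ 2).
Proof.
move=> Gx [dF EF] [dG EG]; split.
  exact: (@derivableM R R F (fun y => (G y)^-1) x 1 dF (derivableV Gx dG)).
rewrite (@deriveM R R F (fun y => (G y)^-1) x 1 dF (derivableV Gx dG)).
rewrite (deriveV Gx dG) EF EG /GRing.scale /=.
by move: (G x) (F x) Gx => u v u0; field.
Qed.

(** At a maximum point of psi over [x, y] the value is nonnegative, so psi decreases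
   strictly there; this leaves x as the only maximum point. *)
Lemma derive_lt0_backward psi (psi1 : R -> R) y : 0 < y ->
  (forall x, 0 < x <= y -> is_derive x 1 psi (psi1 x)) ->
  (forall x, 0 < x <= y -> 0 <= psi x -> psi1 x < 0) ->
  0 <= psi y -> forall x, 0 < x < y -> 0 < psi x.
Proof.
move=> y0 dpsi neg psiy x /andP[x0 xy].
have left c : x < c <= y -> 0 <= psi c -> exists2 t, x <= t < c & psi c < psi t.
  move=> /andP[xc cy] pc; have c0 := lt_trans x0 xc.
  have cI : 0 < c <= y by rewrite c0.
  have l0 := neg c cI pc.
  have e0 : 0 < - psi1 c / 2 by rewrite divr_gt0 ?oppr_gt0.
  have [d d0 Hd] := (is_derive_expansion _ _ _).1 (dpsi c cI) _ e0.
  pose k := Num.min (d / 2) (c - x).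
  have k0 : 0 < k by rewrite lt_min divr_gt0 // subr_gt0.
  have kd : k < d.
    by apply: (@le_lt_trans _ _ (d / 2)); [rewrite /k ge_min lexx|lra].
  have kc : k <= c - x by rewrite /k ge_min lexx orbT.
  exists (c - k); first by apply/andP; split; lra.
  have := Hd (- k); rewrite normrN gtr0_norm // => /(_ kd).
  rewrite ler_norml => /andP[h _].
  have kl : psi1 c * k < 0 by rewrite pmulr_llt0.
  have : - (- psi1 c / 2 * k) <= psi (c - k) - psi c - psi1 c * - k := h.
  nra.
have [|t tI tmax] := @EVT_max R psi x y (ltW xy).
  apply: continuous_in_subspaceT => c /set_mem /=; rewrite in_itv /= => /andP[xc cy].
  by apply: (@is_derive_continuous R psi c (psi1 c)); apply: dpsi; rewrite cy (lt_le_trans x0).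
have nleft c : c \in `[x, y]%R -> (forall s, s \in `[x, y]%R -> psi s <= psi c) -> 0 <= psi c -> c = x.
  rewrite in_itv /= => /andP[xc cy] cmax pc; apply/eqP; rewrite eq_le xc andbT leNgt.
  apply/negP => xc'; have [|s /andP[xs sc]] := left c _ pc; first by rewrite xc'.
  rewrite ltNge cmax // in_itv /= xs; exact: le_trans (ltW sc) cy.
have yI : y \in `[x, y]%R by rewrite in_itv /= lexx ltW.
have pt : 0 <= psi t by rewrite (le_trans psiy) // tmax.
have tx := nleft t tI tmax pt; rewrite tx in tmax pt.
rewrite lt_neqAle pt andbT; apply/eqP => px.
have yx : y = x.
  apply: nleft => // s /tmax h; apply: (le_trans h); rewrite -px //.
by move: xy; rewrite yx ltxx.
Qed.

(** That G y is finite makes g integrable near 0, so the fundamental theorem of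
   calculus applies and G y is small for small y. *)
Lemma primitive_pos g G : (forall t, 0 < t -> {for t, continuous g}) ->
  (forall t, 0 < t -> 0 < g t) ->
  (forall y, 0 < y -> (G y)%:E = (\int[mu]_(t in `]0%R, y[) (g t)%:E)%E) ->
  [/\ forall y, 0 < y -> is_derive y 1 G (g y), forall y, 0 < y -> 0 < G y &
      forall e, 0 < e -> exists2 d, 0 < d & forall y, 0 < y < d -> G y < e].
Proof.
move=> cg g0 HG.
have ig y : 0 < y -> mu.-integrable `]0%R, y[ (EFin \o g).
  move=> y0; have mg : measurable_fun (`]0, y[ : set (measurableTypeR R)) g.
    apply: subspace_continuous_measurable_fun => //.
    by apply: continuous_in_subspaceT => t /set_mem /=; rewrite in_itv /= => /andP[/cg].
  apply/integrableP; split; first by apply/measurable_EFinP.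
  have -> : (\int[mu]_(t in `]0%R, y[) `|(EFin \o g) t| = \int[mu]_(t in `]0%R, y[) (g t)%:E)%E.
    apply: eq_integral => t /set_mem /=; rewrite in_itv /= => /andP[t0 _].
    by rewrite gtr0_norm // g0.
  by rewrite -HG // ltry.
have igc y : 0 < y -> mu.-integrable `]0%R, y] (EFin \o g).
  move=> y0; have y2 : y < y + 1 by lra.
  apply: (@integrableS _ _ _ mu `]0%R, y + 1[) => //; last by apply: ig; lra.
  by apply: subset_itvl; rewrite bnd_simp.
have GE y : 0 < y -> G y = \int[mu]_(t in `]0%R, y]) g t.
  move=> y0; rewrite /Rintegral -(@integral_itv_bndo_bndc R (BRight 0)).
    by rewrite -HG.
  by case/integrableP: (ig y y0).
have dG y : 0 < y -> is_derive y 1 G (g y).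
  move=> y0; have y1 : y < y + 1 by lra.
  have [d E] := @continuous_FTC1 R g (BRight 0) y (y + 1) y1 (igc _ (addr_gt0 y0 ltr01))
    y0 (cg y y0).
  rewrite -E derive1E.
  apply: (@near_eq_is_derive R R R (fun x => \int[mu]_(t in `]0%R, x]) g t)).
  - by apply: near_pos => // x x0; rewrite GE.
  - by split.
have G0 y : 0 < y -> 0 < G y.
  move=> y0; apply: (@le_lt_trans _ _ (G (y / 2))).
    rewrite -lee_fin HG ?divr_gt0 //; apply: integral_ge0 => t /=.
    by rewrite in_itv /= => /andP[t0 _]; rewrite lee_fin ltW // g0.
  apply: (@pos_increasing G g 0 y) => // [t /andP[t0 _]|t /andP[t0 _]|]; [exact: dG|exact: g0|].
  by apply/andP; split; lra.
split => // e e0.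
have i01 : mu.-integrable `[0%R, 1] (EFin \o g).
  have /integrableP[m1 f1] := igc 1 ltr01; apply/integrableP; split.
    exact/emeasurable_fun_itv_obnd_cbndP.
  rewrite -(@integral_itv_obnd_cbnd R 0 (BRight 1)) //.
  exact: measurableT_comp.
have := @parameterized_integral_cvg_left R 0 1 g ltr01 i01.
move=> /cvgrPdist_lt/(_ _ e0)[d /= d0 Hd]; exists d => // y /andP[y0 yd].
have := Hd y; rewrite /ball /= sub0r normrN gtr0_norm // => /(_ yd).
rewrite sub0r normrN; apply: le_lt_trans.
apply: le_trans (ler_norm _); rewrite GE //.
by rewrite /parameterized_integral -Rintegral_itv_obnd_cbnd //; exact: igc.
Qed.

End PositiveHalfLine.

(** * The ratio of the weighted integrals *)

Section WeightedMean.
Context {R : realType}.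
Notation mu := (@lebesgue_measure R).
Implicit Types (a b c e x y : R).
Variables (M M1 phi phi1 phi2 h : R -> R).
Hypothesis M_gt0 : forall y, 0 < y -> 0 < M y.
Hypothesis dM : forall y, 0 < y -> is_derive y 1 M (M1 y).
Hypothesis M1_lt0 : forall y, 0 < y -> M1 y < 0.
Hypothesis M_log : forall a b, 0 < a -> a < b -> M1 a / M a <= M1 b / M b.
Hypothesis dphi1 : forall y, 0 < y -> is_derive y 1 phi1 (phi2 y).
Hypothesis phi1_gt0 : forall y, 0 < y -> 0 < phi1 y.
Hypothesis phiE : forall y, 0 < y -> (phi y)%:E = (\int[mu]_(t in `]0%R, y[) (phi1 t)%:E)%E.
Hypothesis hE : forall y, 0 < y -> (h y)%:E = (\int[mu]_(t in `]0%R, y[) (phi1 t * M t)%:E)%E.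
Let q y := phi2 y * phi y / phi1 y ^+ 2.
Hypothesis q_lt1 : forall y, 0 < y -> q y < 1.
Hypothesis q_noninc : forall a b, 0 < a -> a < b -> q b <= q a.

Let dphi y (y0 : 0 < y) : is_derive y 1 phi (phi1 y).
Proof.
by have [H _ _] := primitive_pos (fun t t0 => is_derive_continuous (dphi1 t0)) phi1_gt0 phiE; exact: H.
Qed.

Let phi_gt0 y (y0 : 0 < y) : 0 < phi y.
Proof.
by have [_ H _] := primitive_pos (fun t t0 => is_derive_continuous (dphi1 t0)) phi1_gt0 phiE; exact: H.
Qed.

Let hprim := @primitive_pos R (fun t => phi1 t * M t) h
  (fun t t0 => cvgM (is_derive_continuous (dphi1 t0)) (is_derive_continuous (dM t0)))
  (fun t t0 => mulr_gt0 (phi1_gt0 t0) (M_gt0 t0)) hE.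

Let dh y (y0 : 0 < y) : is_derive y 1 h (phi1 y * M y). Proof. by have [H _ _] := hprim; exact: H. Qed.
Let h_gt0 y (y0 : 0 < y) : 0 < h y. Proof. by have [_ H _] := hprim; exact: H. Qed.
Let h_small e (e0 : 0 < e) : exists2 d, 0 < d & forall y, 0 < y < d -> h y < e.
Proof. by have [_ _ H] := hprim; exact: H. Qed.

Let M_decr a b : 0 < a -> a < b -> M b < M a.
Proof.
move=> a0 ab.
have [|c /andP[ac _] E] := @mean_value R M M1 a b ab.
  by move=> x /andP[ax _]; apply: dM; exact: lt_le_trans ax.
rewrite -subr_lt0 E pmulr_llt0 ?subr_gt0 //; apply: M1_lt0; exact: lt_trans ac.
Qed.

Let N y := h y - phi y * M y.

Let N_gt0 y (y0 : 0 < y) : 0 < N y.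
Proof.
apply: (@pos_from_zero R (fun x => h x - phi x * M y) (fun x => phi1 x * M x - phi1 x * M y)) => //.
- move=> x /andP[x0 _]; have ? := dh x0; have ? := dphi x0.
  by apply: is_derive_eq; rewrite /GRing.scale /=; ring.
- move=> x /andP[x0 xy]; have := M_decr x0 xy; have := phi1_gt0 x0; nra.
- move=> e e0; have eM : 0 < e / M y by rewrite divr_gt0 ?M_gt0.
  have [_ _ small] := primitive_pos (fun t t0 => is_derive_continuous (dphi1 t0)) phi1_gt0 phiE.
  have [d d0 Hd] := small _ eM; exists d => // x xd; have := Hd x xd.
  have x0 : 0 < x by case/andP: xd.
  rewrite ltr_pdivlMr ?M_gt0 //; have := h_gt0 x0; lra.
Qed.

Let w y := phi y / phi1 y.
Let v y := 1 - q y.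
Let D y := w y * h y.
Let a y := h y / (phi y * M y).
Let m y := - (M1 y / M y).
Let g y := N y / D y.
(* The logarithmic derivative of h / phi is - g, and E has the sign of g': as
   N' / D' = m / (v a + 1), E >= 0 means g <= N' / D'. *)
Let E y := m y - g y * (v y * a y + 1).

Let w_gt0 y (y0 : 0 < y) : 0 < w y. Proof. by rewrite divr_gt0 ?phi_gt0 ?phi1_gt0. Qed.
Let a_gt0 y (y0 : 0 < y) : 0 < a y.
Proof. by rewrite divr_gt0 ?mulr_gt0 ?h_gt0 ?phi_gt0 ?M_gt0. Qed.
Let D_gt0 y (y0 : 0 < y) : 0 < D y. Proof. by rewrite mulr_gt0 ?w_gt0 ?h_gt0. Qed.
Let g_gt0 y (y0 : 0 < y) : 0 < g y. Proof. by rewrite divr_gt0 ?N_gt0 ?D_gt0. Qed.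
Let v_gt0 y (y0 : 0 < y) : 0 < v y. Proof. by rewrite subr_gt0 q_lt1. Qed.

Let dN y (y0 : 0 < y) : is_derive y 1 N (- (phi y * M1 y)).
Proof.
have ? := dh y0; have ? := dphi y0; have ? := dM y0.
apply: is_derive_eq; rewrite /GRing.scale /=; ring.
Qed.

Let dw y (y0 : 0 < y) : is_derive y 1 w (v y).
Proof.
have P1 := lt0r_neq0 (phi1_gt0 y0).
apply: is_derive_eq; first exact: (is_derive_div P1 (dphi y0) (dphi1 y0)).
by rewrite /v /q; move: (phi1 y) (phi y) (phi2 y) P1 => A B C A0; field.
Qed.

Let dD y (y0 : 0 < y) : is_derive y 1 D (v y * h y + phi y * M y).
Proof.
have ? := dw y0; have ? := dh y0; have P1 := lt0r_neq0 (phi1_gt0 y0).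
apply: is_derive_eq; rewrite /w /GRing.scale /=.
by move: (phi1 y) (phi y) (v y) (h y) (M y) P1 => A B V H m' A0; field.
Qed.

Let da y (y0 : 0 < y) : is_derive y 1 a (a y * (m y - g y)).
Proof.
have P1 := lt0r_neq0 (phi1_gt0 y0); have P0 := lt0r_neq0 (phi_gt0 y0).
have M0 := lt0r_neq0 (M_gt0 y0); have H0 := lt0r_neq0 (h_gt0 y0).
have dpM : is_derive y 1 (fun y => phi y * M y) (phi1 y * M y + phi y * M1 y).
  have ? := dphi y0; have ? := dM y0.
  by apply: is_derive_eq; rewrite /GRing.scale /=; ring.
apply: is_derive_eq; first exact: (@is_derive_div R h (fun y => phi y * M y) _ _ y (mulf_neq0 P0 M0) (dh y0) dpM).
rewrite /a /m /g /N /D /w.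
move: (phi1 y) (phi y) (M1 y) (h y) (M y) P1 P0 M0 H0 => A B V H m' A0 B0 M0 H0.
by field; rewrite A0 B0 M0 H0.
Qed.

Let dg y (y0 : 0 < y) : is_derive y 1 g (E y / (w y * a y)).
Proof.
have P1 := lt0r_neq0 (phi1_gt0 y0); have P0 := lt0r_neq0 (phi_gt0 y0).
have M0 := lt0r_neq0 (M_gt0 y0); have H0 := lt0r_neq0 (h_gt0 y0).
apply: is_derive_eq; first exact: (is_derive_div (lt0r_neq0 (D_gt0 y0)) (dN y0) (dD y0)).
rewrite /E /a /m /g /N /D /w.
move: (phi1 y) (phi y) (M1 y) (h y) (M y) (v y) P1 P0 M0 H0 => A B V H m' v' A0 B0 M0 H0.
by field; rewrite A0 B0 M0 H0.
Qed.

(** If E y0 >= 0, then going back from y0 the quotient N' / D' = m / (v a + 1)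
   increases: m and v are monotone, and a decreases backward as long as E >= 0.  Then
   N - (N' / D')(y0) D is increasing on (0, y0) and starts with a nonnegative lower
   limit, so g y0 > (N' / D')(y0), that is, E y0 < 0. *)
Lemma decay_gap_lt0 y0 : 0 < y0 -> E y0 < 0.
Proof.
move=> y00; rewrite ltNge; apply/negP => E0.
have m_ge x : 0 < x <= y0 -> m y0 <= m x.
  move=> /andP[x0]; rewrite le_eqVlt => /orP[/eqP -> //|xy].
  by rewrite lerN2 M_log.
have v_le x : 0 < x <= y0 -> v x <= v y0.
  move=> /andP[x0]; rewrite le_eqVlt => /orP[/eqP -> //|xy].
  by rewrite lerD2l lerN2 q_noninc.
(* psi freezes m and v at y0: this bounds E from below and leaves a differentiable
   function. *)
pose psi x := m y0 - g x * (v y0 * a x + 1).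
have psiE x : 0 < x <= y0 -> psi x <= E x.
  move=> xI; have x0 : 0 < x by case/andP: xI.
  rewrite /psi /E lerB ?m_ge // ler_wpM2l ?(ltW (g_gt0 x0)) // lerD2r.
  by rewrite ler_wpM2r ?v_le // ltW // a_gt0.
have m_gt_g x : 0 < x -> 0 <= E x -> g x < m x.
  move=> x0 Ex; have := mulr_gt0 (g_gt0 x0) (mulr_gt0 (v_gt0 x0) (a_gt0 x0)).
  move: Ex; rewrite /E mulrDr mulr1; lra.
have psi_gt0 : forall x, 0 < x < y0 -> 0 < psi x.
  apply: (@derive_lt0_backward R psi (fun x =>
     - (E x / (w x * a x) * (v y0 * a x + 1) + g x * (v y0 * (a x * (m x - g x))))) y0 y00 _ _ E0).
  - move=> x /andP[x0 _]; have ? := dg x0; have ? := da x0.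
    apply: is_derive_eq; rewrite /GRing.scale /=; ring.
  - move=> x xI px; have x0 : 0 < x by case/andP: xI.
    have Ex := le_trans px (psiE x xI).
    rewrite oppr_lt0 ltr_wpDl //.
      have h1 := mulr_gt0 (w_gt0 x0) (a_gt0 x0).
      have h2 := mulr_gt0 (v_gt0 y00) (a_gt0 x0).
      by rewrite mulr_ge0 ?(divr_ge0 Ex) ?addr_ge0 ?(ltW h1) ?(ltW h2).
    have h1 : 0 < m x - g x by rewrite subr_gt0 m_gt_g.
    exact: mulr_gt0 (g_gt0 x0) (mulr_gt0 (v_gt0 y00) (mulr_gt0 (a_gt0 x0) h1)).
have a_lt x : 0 < x < y0 -> a x < a y0.
  apply: (@pos_increasing R a (fun x => a x * (m x - g x)) 0 y0) => //.
    by move=> t /andP[t0 _]; exact: da.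
  move=> t tI; have /andP[t0 ty] := tI.
  rewrite mulr_gt0 ?a_gt0 // subr_gt0 m_gt_g //.
  by apply: le_trans (ltW (psi_gt0 t tI)) (psiE t _); rewrite t0 ltW.
have b0 : 0 < v y0 * a y0 + 1 by have := mulr_gt0 (v_gt0 y00) (a_gt0 y00); lra.
(* r0 is N' / D' at y0. *)
pose r0 := m y0 / (v y0 * a y0 + 1).
have r00 : 0 < r0.
  by rewrite divr_gt0 // (lt_trans (g_gt0 y00)) // m_gt_g.
have : 0 < N y0 - r0 * D y0.
  apply: (@pos_from_zero R (fun x => N x - r0 * D x)
    (fun x => - (phi x * M1 x) - r0 * (v x * h x + phi x * M x))) => //.
  - move=> x /andP[x0 _]; have ? := dN x0; have ? := dD x0.
    apply: is_derive_eq; rewrite /GRing.scale /=; ring.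
  - move=> x xI; have /andP[x0 xy] := xI; have xI' : 0 < x <= y0 by rewrite x0 ltW.
    have PM := mulr_gt0 (phi_gt0 x0) (M_gt0 x0).
    have -> : - (phi x * M1 x) - r0 * (v x * h x + phi x * M x) =
        phi x * M x * (m x - r0 * (v x * a x + 1)).
      rewrite /a /m; have := lt0r_neq0 (phi_gt0 x0); have := lt0r_neq0 (M_gt0 x0).
      by move: (phi x) (M x) (M1 x) (h x) (v x) => A B C H V A0 B0; field; rewrite A0 B0.
    rewrite mulr_gt0 // subr_gt0; apply: lt_le_trans (m_ge x xI').
    have -> : m y0 = r0 * (v y0 * a y0 + 1) by rewrite /r0 divfK // lt0r_neq0.
    rewrite ltr_pM2l // ltrD2r; apply: (@le_lt_trans _ _ (v y0 * a x)).
      by rewrite ler_wpM2r ?v_le // ltW // a_gt0.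
    by rewrite ltr_pM2l ?v_gt0 // a_lt.
  - move=> e e0; have rw := mulr_gt0 r00 (w_gt0 y00).
    have [d d0 Hd] := h_small (divr_gt0 e0 rw).
    exists (Num.min d y0) => [|x]; first by rewrite lt_min d0.
    rewrite lt_min => /and3P[x0 xd xy].
    have := Hd x; rewrite x0 xd => /(_ isT); rewrite ltr_pdivlMr // => hx.
    have wx : w x < w y0.
      apply: (@pos_increasing R w v 0 y0) => //; last by rewrite x0.
        by move=> t /andP[t0 _]; exact: dw.
      by move=> t /andP[t0 _]; exact: v_gt0.
    have h1 : r0 * D x <= h x * (r0 * w y0).
      have -> : r0 * D x = h x * (r0 * w x) by rewrite /D; ring.
      by rewrite !ler_wpM2l ?(ltW r00) ?(ltW wx) // ltW // h_gt0.
    have := N_gt0 x0; lra.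
rewrite subr_gt0 -ltr_pdivlMr ?D_gt0 // -/(g y0) /r0 ltr_pdivrMr // => h1.
by move: E0; rewrite /E leNgt subr_lt0 h1.
Qed.

Lemma weighted_mean_ratio :
  [/\ forall y, 0 < y -> 0 < h y / phi y,
   exists F1 F2 : R -> R, [/\ forall y, 0 < y -> is_derive y 1 (fun t => h t / phi t) (F1 y),
     forall y, 0 < y -> is_derive y 1 F1 (F2 y) & forall y, 0 < y -> F1 y < 0] &
   exists G1 G2 : R -> R, [/\ forall y, 0 < y -> is_derive y 1 (fun t => ln (h t / phi t)) (G1 y),
     forall y, 0 < y -> is_derive y 1 G1 (G2 y) & forall y, 0 < y -> 0 < G2 y]].
Proof.
have F0 y : 0 < y -> 0 < h y / phi y by move=> y0; rewrite divr_gt0 ?h_gt0 ?phi_gt0.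
have dF y : 0 < y -> is_derive y 1 (fun t => h t / phi t) (- (phi1 y * N y / (phi y * phi y))).
  move=> y0; have P0 := lt0r_neq0 (phi_gt0 y0).
  apply: is_derive_eq; first exact: (is_derive_div P0 (dh y0) (dphi y0)).
  by rewrite /N; move: (phi y) (phi1 y) (h y) (M y) P0 => A B C H A0; field.
split => //.
  exists (fun y => - (phi1 y * N y / (phi y * phi y))), (fun y => - (((phi2 y * N y + phi1 y * - (phi y * M1 y)) * (phi y * phi y)
    - (phi1 y * N y) * (phi1 y * phi y + phi y * phi1 y)) / (phi y * phi y) ^+ 2)); split => //.
    move=> y y0; have P0 := lt0r_neq0 (mulr_gt0 (phi_gt0 y0) (phi_gt0 y0)).
    have ? := dN y0; have ? := dphi y0; have ? := dphi1 y0.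
    have d1 : is_derive y 1 (fun y => phi1 y * N y) (phi2 y * N y + phi1 y * - (phi y * M1 y)).
      by apply: is_derive_eq; rewrite /GRing.scale /=; ring.
    have d2 : is_derive y 1 (fun y => phi y * phi y) (phi1 y * phi y + phi y * phi1 y).
      by apply: is_derive_eq; rewrite /GRing.scale /=; ring.
    by have := is_deriveN (@is_derive_div R (fun y => phi1 y * N y) (fun y => phi y * phi y) _ _ y P0 d1 d2).
  move=> y y0; rewrite oppr_lt0 divr_gt0 ?mulr_gt0 ?phi_gt0 ?phi1_gt0 ?N_gt0 //.
exists (fun y => - g y), (fun y => - (E y / (w y * a y))); split => [y y0|y y0|y y0].
- have d2 := @is_derive1_ln R _ (F0 y y0).
  apply: is_derive_eq; first exact: (@is_derive1_comp R (@ln R) _ y _ _ d2 (dF y y0)).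
  rewrite /g /D /w.
  have := lt0r_neq0 (phi_gt0 y0); have := lt0r_neq0 (phi1_gt0 y0); have := lt0r_neq0 (h_gt0 y0).
  by move: (phi y) (phi1 y) (h y) (N y) => A B C H A0 B0 C0; field; rewrite A0 B0 C0.
- exact: is_deriveN (dg y0).
- have h1 := mulr_gt0 (w_gt0 y0) (a_gt0 y0).
  by rewrite oppr_gt0 pmulr_llt0 ?invr_gt0 // decay_gap_lt0.
Qed.

End WeightedMean.

(** * The Hardy means and the weight *)

Section HardyMean.
Context {R : realType}.
Implicit Types (f : R[i] -> R[i]) (p a b y : R).

Lemma hardy_hmean_bounded p f : hardy p f -> exists B, forall y, 0 < y -> hmean p f y <= B.
Proof.
move=> [_]; set s := ereal_sup _ => sy.
have sub y : 0 < y -> (hardy_mean p f y <= s)%E.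
  by move=> y0; apply: ereal_sup_ubound; exists y => //=; rewrite in_itv /= andbT.
have nn y : (0 <= hardy_mean p f y)%E.
  by apply: integral_ge0 => x _; rewrite lee_fin powR_ge0.
have s0 : (0 <= s)%E := le_trans (nn 1) (sub 1 ltr01).
exists (fine s) => y y0; rewrite /hmean /Rintegral -/(hardy_mean p f y).
by apply: fine_le; rewrite ?ge0_fin_numE // ?sub // (le_lt_trans (sub y y0)).
Qed.

Lemma hardy_mean_log_convex p f : 2 <= p -> hardy p f ->
  (exists z : R[i], 0 < complex.Im z /\ f z <> 0) ->
  [/\ forall y, 0 < y -> 0 < hmean p f y,
      forall y, 0 < y -> is_derive y 1 (hmean p f) ('D_1 (hmean p f) y),
      forall y, 0 < y -> 'D_1 (hmean p f) y < 0 &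
      forall a b, 0 < a -> a < b ->
        'D_1 (hmean p f) a / hmean p f a <= 'D_1 (hmean p f) b / hmean p f b].
Proof.
move=> p2 hf [[u c] /= [c0 fz]]; have p1 : 1 < p by lra.
have lf := hardy_locally_hardy hf.
have dM y : 0 < y -> derivable (hmean p f) y 1 by exact: derivable_hmean.
have [B HB] := hardy_hmean_bounded hf.
have nz : exists2 y : R, 0 < y & hmean p f y != 0.
  apply: contrapT => H; apply: fz; apply: (hmean_eq0_normc u p1 lf c0) => y y0.
  by apply/eqP; apply/negPn/negP => h; apply: H; exists y.
have [] := logconvex_bounded_derive (fun y _ => hmean_ge0 p f y) dM
  (fun c r rc => hmean_log_midpoint p1 lf rc) (fun c r rc => hmean_midpoint_eq p1 lf rc) HB nz.
move=> h1 h2 h3; split => //.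
by move=> y y0; split => //; exact: dM.
Qed.

End HardyMean.

Section Quotient.
Context {R : realType}.
Variables phi phi1 phi2 phi3 : R -> R.
Hypothesis dphi : forall y : R, 0 < y -> is_derive y 1 phi (phi1 y).
Hypothesis dphi1 : forall y : R, 0 < y -> is_derive y 1 phi1 (phi2 y).
Hypothesis dphi2 : forall y : R, 0 < y -> is_derive y 1 phi2 (phi3 y).
Hypothesis phi1_gt0 : forall y : R, 0 < y -> 0 < phi1 y.
Let q y := phi2 y * phi y / phi1 y ^+ 2.
Let q1 y := phi1 y ^+ 2 * phi2 y + phi y * phi1 y * phi3 y - 2 * phi y * phi2 y ^+ 2.

(** The expression of the third-order condition is the numerator of q'. *)
Lemma is_derive_quotient (y : R) : 0 < y -> is_derive y 1 q (q1 y / phi1 y ^+ 3).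
Proof.
move=> y0; have i0 := dphi y0; have i1 := dphi1 y0; have i2 := dphi2 y0.
have P1 := lt0r_neq0 (phi1_gt0 y0); have P2 := lt0r_neq0 (exprn_gt0 2 (phi1_gt0 y0)).
have d1 : is_derive y 1 (fun y => phi2 y * phi y) (phi3 y * phi y + phi2 y * phi1 y).
  by apply: is_derive_eq; rewrite /GRing.scale /=; ring.
have d2 : is_derive y 1 (fun y => phi1 y ^+ 2) (2 * phi1 y * phi2 y).
  by apply: is_derive_eq; rewrite /GRing.scale /=; ring.
apply: (is_derive_eq (@is_derive_div R (fun y => phi2 y * phi y) (fun y => phi1 y ^+ 2) _ _ y P2 d1 d2)).
by rewrite /q1; move: (phi y) (phi1 y) (phi2 y) (phi3 y) P1 => A B C D B0; field.
Qed.

Lemma quotient_diff (a b : R) : 0 < a -> a < b ->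
  exists2 c : R, 0 < c & q b - q a = q1 c * ((b - a) / phi1 c ^+ 3).
Proof.
move=> a0 ab.
have [|c /andP[ac _] E] := @mean_value R q (fun y => q1 y / phi1 y ^+ 3) a b ab.
  by move=> x /andP[ax _]; apply: is_derive_quotient; exact: lt_le_trans ax.
by exists c; [exact: lt_trans ac|rewrite E -mulrA [_^-1 * _]mulrC].
Qed.

(** A nonincreasing q is at most its limit at 0, and less than it if q is strictly
   decreasing. *)
Lemma quotient_lt1 :
  ((exists l : \bar R, (q y)%:E @[y --> 0^'+] --> l /\ (l < 1%:E)%E) /\
     (forall y : R, 0 < y -> q1 y <= 0)) \/
  (q y @[y --> 0^'+] --> (1 : R) /\ (forall y : R, 0 < y -> q1 y < 0)) ->
  (forall y : R, 0 < y -> q y < 1) /\ (forall a b : R, 0 < a -> a < b -> q b <= q a).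
Proof.
move=> H.
have q1_le0 (y : R) : 0 < y -> q1 y <= 0.
  by case: H => -[_ H] y0; [exact: H|apply: ltW; exact: H].
have den (a b c : R) : a < b -> 0 < c -> 0 < (b - a) / phi1 c ^+ 3.
  by move=> ab c0; rewrite divr_gt0 ?subr_gt0 ?exprn_gt0 ?phi1_gt0.
have mono (a b : R) : 0 < a -> a < b -> q b <= q a.
  move=> a0 ab; have [c c0 E] := quotient_diff a0 ab.
  by rewrite -subr_le0 E pmulr_lle0 ?den // q1_le0.
split => // y y0.
have near0 x : 0 < x -> \forall t \near 0^'+, q x <= q t.
  move=> x0; near=> t; apply: mono; first by near: t; exact: nbhs_right_gt.
  by near: t; exact: nbhs_right_lt.
case: H => -[].
  move=> [l [cl l1]] _; rewrite -lte_fin; apply: le_lt_trans l1.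
  apply: (cvge_to_ge cl).
  by near=> t; rewrite lee_fin; near: t; exact: near0.
move=> c1 neg; have y2 : 0 < y / 2 by rewrite divr_gt0.
have yy : y / 2 < y by lra.
have [c c0 E] := quotient_diff y2 yy.
have : q y < q (y / 2) by rewrite -subr_lt0 E pmulr_llt0 ?den // neg.
move=> /lt_le_trans; apply.
apply: (cvgr_to_ge c1).
exact: near0.
Unshelve. all: end_near. Qed.

End Quotient.

Theorem theorem13 (R : realType) (p : R) (f : R[i] -> R[i]) (phi h : R -> R)
  (hp : 2 <= p)
  (hf : hardy p f)
  (hf0 : exists z : R[i], 0 < complex.Im z /\ f z <> 0)
  (hphi : classD 3 `]0, +oo[ phi)
  (hi : forall y : R, 0 < y ->
     (phi y)%:E = (\int[@lebesgue_measure R]_(t in `]0%R, y[) (derive1 phi t)%:E)%E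
     /\ 0 < derive1 phi y)
  (hii :
     ((exists l : \bar R,
         (derive1n 2 phi y * phi y / derive1 phi y ^+ 2)%:E @[y --> 0^'+] --> l
         /\ (l < 1%:E)%E)
      /\ (forall y : R, 0 < y ->
            derive1 phi y ^+ 2 * derive1n 2 phi y + phi y * derive1 phi y * derive1n 3 phi y
              - 2 * phi y * derive1n 2 phi y ^+ 2 <= 0))
     \/
     (((derive1n 2 phi y * phi y / derive1 phi y ^+ 2) @[y --> 0^'+] --> (1 : R))
      /\ (forall y : R, 0 < y ->
            derive1 phi y ^+ 2 * derive1n 2 phi y + phi y * derive1 phi y * derive1n 3 phi y
              - 2 * phi y * derive1n 2 phi y ^+ 2 < 0)))
  (hiii : forall y : R, 0 < y ->
     (h y)%:E = (\int[@lebesgue_measure R]_(t in `]0%R, y[)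
                   ((derive1 phi t)%:E * hardy_mean p f t))%E) :
  [/\ classD 2 `]0, +oo[ (fun y => h y / phi y),
      (forall y : R, 0 < y -> 0 < h y / phi y),
      classD 2 `]0, +oo[ (fun y => ln (h y / phi y)),
      (forall y : R, 0 < y -> derive1 (fun t => h t / phi t) y < 0)
    & (forall y : R, 0 < y -> 0 < derive1n 2 (fun t => ln (h t / phi t)) y)].
Proof.
have dn k (y : R) : (k < 3)%N -> 0 < y -> is_derive y 1 (derive1n k phi) (derive1n k.+1 phi y).
  move=> k3 y0; split; last by rewrite /= derive1E.
  by apply: hphi => //=; rewrite in_itv /= andbT.
have d0 (y : R) : 0 < y -> is_derive y 1 phi (derive1 phi y) by exact: (dn 0%N).
have d1 (y : R) : 0 < y -> is_derive y 1 (derive1 phi) (derive1n 2 phi y) by exact: (dn 1%N).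
have d2 (y : R) : 0 < y -> is_derive y 1 (derive1n 2 phi) (derive1n 3 phi y) by exact: (dn 2%N).
have p0 (y : R) : 0 < y -> 0 < derive1 phi y by move=> /hi[].
have [q1 qm] := quotient_lt1 d0 d1 d2 p0 hii.
have [M0 dM M1 ML] := hardy_mean_log_convex hp hf hf0.
have lf := hardy_locally_hardy hf.
have [||F0 [F1 [F2 [dF dF1 F1n]]] [G1 [G2 [dG dG1 G2p]]]] :=
    @weighted_mean_ratio R (hmean p f) _ phi (derive1 phi) (derive1n 2 phi) h
    M0 dM M1 ML d1 p0 _ _ q1 qm.
- by move=> y /hi[].
- move=> y y0; rewrite hiii //; apply: eq_integral => t /set_mem /=.
  by rewrite in_itv /= => /andP[t0 _]; rewrite (hmeanE lf t0) -EFinM.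
have [cF EF _] := classD2_pos dF dF1; have [cG _ EG] := classD2_pos dG dG1.
split => // y y0; first by rewrite EF // F1n.
by rewrite EG // G2p.
Qed.
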